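(* Let $1/2<\sigma<1$ and $0<\delta<1$ be fixed, and put $b(\sigma)=8(1-\sigma)/(2\sigma-1)$. Let $q$ be a sufficiently large prime and let $\mathcal{H}$ be a subgroup of $\mathcal{X}_q$ of order $H=\#\mathcal{H}$. Suppose that one of the following holds: (i) $H\ge q^{(2-2\sigma)/(2-\sigma)+\delta}$ (unconditionally); or (ii) the Generalised Riemann Hypothesis holds and $H\ge(\log q)^{(1+\delta)b(\sigma)}$. Then there exists a non-principal character $\chi\in\mathcal{H}$ such that $$\log|L(\sigma,\chi)|\gg(\log H)^{1-\sigma}(\log_2 H)^{-\sigma}$$ as $H\to\infty$, where the implied constant depends only on $\sigma$ and $\delta$.
   Context: $\mathcal{X}_q$ is the group of multiplicative (Dirichlet) characters modulo $q$. For a non-principal $\chi\in\mathcal{X}_q$, $L(s,\chi)=\sum_{n\ge1}\chi(n)n^{-s}$ for $\Re s>0$. $A\gg B$ means $|B|\le cA$ for some constant $c>0$. Iterated logarithms: $\log_1 z=\max\{2,\log z\}$ and, for $\nu\ge2$, $\log_\nu z=\max\{2,\log(\log_{\nu-1}z)\}$ (not base-$\nu$ logarithms). The Generalised Riemann Hypothesis (GRH) states that for every Dirichlet character $\chi$ all zeros of $L(s,\chi)$ with $0<\Re s<1$ satisfy $\Re s=1/2$. *)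

(* Defs.v *)
(* Stdlib reals with Coquelicot's complex numbers. *)
From Stdlib Require Import Reals Ensembles Finite_sets Znumtheory.
From Coquelicot Require Import Coquelicot.
Open Scope R_scope.

Definition dirichlet_character (N : nat) (chi : nat -> C) : Prop :=
  (forall n : nat, chi (n + N)%nat = chi n) /\
  (forall m n : nat, chi (m * n)%nat = (chi m * chi n)%C) /\
  (forall n : nat, chi n <> RtoC 0 <-> Nat.gcd n N = 1%nat).

Definition principal_character (N : nat) (n : nat) : C :=
  if Nat.eqb (Nat.gcd n N) 1 then RtoC 1 else RtoC 0.

Definition character_mul (chi psi : nat -> C) (n : nat) : C :=
  (chi n * psi n)%C.

Definition character_subgroup (q : nat) (X : Ensemble (nat -> C)) : Prop :=
  Included (nat -> C) X (dirichlet_character q) /\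
  In (nat -> C) X (principal_character q) /\
  (forall chi psi : nat -> C,
     In (nat -> C) X chi -> In (nat -> C) X psi ->
     In (nat -> C) X (character_mul chi psi)) /\
  (forall chi : nat -> C,
     In (nat -> C) X chi ->
     exists psi : nat -> C,
       In (nat -> C) X psi /\
       character_mul chi psi = principal_character q).

Definition Cexp (z : C) : C :=
  (exp (Re z) * cos (Im z), exp (Re z) * sin (Im z)).

(* The index k stands for the integer n = k + 1, and n^(-s) = exp (- s log n). *)
Definition dirichlet_term (chi : nat -> C) (s : C) (k : nat) : C :=
  (chi (S k) * Cexp (- (s * RtoC (ln (INR (S k))))))%C.

Definition is_dirichlet_series (chi : nat -> C) (s l : C) : Prop :=
  is_series (K := C_AbsRing) (V := C_NormedModule) (dirichlet_term chi s) l.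

(* L is s |-> L(s, chi) on the half-plane Re s > 0.  For non-principal chi the
   series converges there (conditionally when Re s <= 1).  For principal chi it
   converges only for Re s > 1, and L is its analytic continuation, with s = 1
   removed; this determines L on the half-plane by the identity theorem. *)
Definition is_L_function (N : nat) (chi : nat -> C) (L : C -> C) : Prop :=
  (chi <> principal_character N /\
   forall s : C, 0 < Re s -> is_dirichlet_series chi s (L s)) \/
  (chi = principal_character N /\
   (forall s : C, 1 < Re s -> is_dirichlet_series chi s (L s)) /\
   (forall s : C, 0 < Re s -> s <> RtoC 1 ->
      ex_derive (K := C_AbsRing) (V := C_NormedModule) L s)).

Definition GRH : Prop :=
  forall (N : nat) (chi : nat -> C) (L : C -> C),
    (0 < N)%nat -> dirichlet_character N chi -> is_L_function N chi L ->
    forall s : C, 0 < Re s < 1 -> L s = RtoC 0 -> Re s = 1 / 2.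

(* For nu >= 1 this is log_nu of the iterated-logarithm convention
   log_1 z = max (2, log z), log_nu z = max (2, log (log_(nu-1) z)). *)
Fixpoint iterlog (nu : nat) (z : R) : R :=
  match nu with
  | O => z
  | S k => Rmax 2 (ln (iterlog k z))
  end.

Definition b (sigma : R) : R := 8 * (1 - sigma) / (2 * sigma - 1).

(* Main.v *)
(* Put h = log H and let S be a set of about eps * h primes p <= 3 h log h.  Each chi in the
   subgroup gets the weight w(chi) = prod_{p in S} |1 - chi(p)/2|^(-2), a nonnegative
   combination of the functions chi |-> chi(n).  Such functions have nonnegative sums over
   the subgroup, and moving a factor chi(p), p in S, into the weight costs at most 1/2.
   Hence, for f with nonnegative coefficients, the sum of w(chi) Re f(chi) is at least Q
   times the sum of w(chi), where Q collects the contribution of the primes in S to f; no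
   congruence has to be counted.  A bounded number of excluded characters costs at most
   4^|S| f(1) each, which is a small power of H.
   Unconditionally, f is the partial sum of L(sigma, chi) of length about q^(2/(2-sigma)),
   and Q comes from the products of one prime from each of the blocks into which S is cut;
   the tail of L(sigma, chi) is controlled in mean square over the subgroup, again by
   positivity.
   Under GRH, f is the Taylor polynomial at s = 2 of log L(s, chi), evaluated at sigma.
   Its error is bounded by Borel-Caratheodory in the disc |s - 2| < 3/2, where L has no
   zero: by GRH for Re s < 1, and by the 3-4-1 inequality on Re s = 1, which needs chi^2 to
   be non-principal, so that real characters are excluded.  In place of holomorphic function
   theory, L(2 - z, chi) is approximated by polynomials, which are split into linear
   factors. *)
From mathcomp Require all_boot all_algebra complex Rstruct.
Require Import Defs.
From Stdlib Require Import List Permutation Lra Lia Arith ZArith ClassicalEpsilon FunctionalExtensionality.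
From Stdlib Require Import Reals Ensembles Finite_sets Znumtheory.
From Coquelicot Require Import Coquelicot.
Open Scope R_scope.

(** * Prime counting and the factorization of complex polynomials *)

(** The aim is log |L|, so a lower bound for |L| that is only linear in the primes of S would lose a
    logarithm. Unconditionally each of j blocks contributes a factor 6/2 = 3, and |L| exceeds 3^j -
    4 with j of order h y^(-sigma), y = 3 h log h. Under GRH the logarithm itself is approximated.
    Expanding in z = 2 - s makes the Taylor coefficients of every p^(-ms) nonnegative, as positivity
    requires, but the degree K is then felt twice: the error (t/rho)^K log q forces K to be of order
    log log q / (2 sigma - 1), while the value at an excluded character can be as large as
    (t/lam)^K, with lam < 1 close to 1 and log t <= 1 - sigma. Together these dictate the power of
    log q in the hypothesis: 7 (1 - sigma)/(2 sigma - 1) times a factor close to 1 stays below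
    b(sigma). The excluded characters are the principal one and, under GRH, also the real
    non-principal one, of which a prime modulus has at most one. Since |S| <= delta h / 64, the
    factor 4^|S| is at most H^(delta/32), which the delta in the hypothesis or the slack between 7
    and 8 pays for. *)

Module Chebyshev.
Import mathcomp.boot.all_boot.
Local Open Scope nat_scope.
Lemma prime_Z (p : nat) : prime p -> Znumtheory.prime (Z.of_nat p).
Proof.
move=> /primeP [p_gt1 Hp]; apply/Znumtheory.prime_alt; split.
  by move/ltP: p_gt1; Lia.lia.
move=> n [Hn1 Hnp] [k Hk].
have : Z.to_nat n %| p.
  apply/dvdnP; exists (Z.to_nat k); rewrite -multE; Lia.nia.
by move/Hp => /orP [] /eqP; Lia.lia.
Qed.

(** By Pascal's rule and symmetry, C(2n+2, n+1) is twice C(2n+1, n+1), which is at least C(2n,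
    n). *)
Lemma central_binomial_lower n : 2 ^ n <= 'C(2 * n, n).
Proof.
elim: n => [|n IHn] //.
have -> : 2 * n.+1 = (2 * n).+2 by rewrite mulnS.
have Hle : 'C(2 * n, n) <= 'C((2 * n).+1, n.+1) by rewrite binS leq_addl.
have Hsym : 'C((2 * n).+1, n) = 'C((2 * n).+1, n.+1).
  by rewrite -bin_sub; [congr 'C(_, _); rewrite mul2n -addnn subSn ?leq_addl // addnK | rewrite mul2n -addnn -addnS leq_addr].
rewrite binS Hsym expnS mul2n -addnn.
by apply: leq_add; apply: leq_trans Hle.
Qed.

Lemma sum_leq_indicator m t : \sum_(1 <= k < m.+1) (k <= t) = minn m t.
Proof.
elim: m => [|m IHm]; first by rewrite big_nil min0n.
rewrite big_nat_recr //= IHm; case: (ltnP m t) => Hmt /=.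
  by rewrite (minn_idPl Hmt) addn1.
by rewrite addn0 (minn_idPr (leqW Hmt)).
Qed.

(** Legendre's formula: the exponent of p is the sum over k of floor(2n/p^k) - 2 floor(n/p^k), whose
    terms are 0 or 1 and vanish once p^k > 2n. *)
Lemma prime_power_central_binomial p n : prime p -> 0 < n ->
  p ^ logn p 'C(2 * n, n) <= 2 * n.
Proof.
move=> Hp n_gt0.
have n2_gt0 : 0 < 2 * n by rewrite muln_gt0.
suff Hlog : logn p 'C(2 * n, n) <= trunc_log p (2 * n).
  apply: leq_trans (trunc_logP (prime_gt1 Hp) n2_gt0).
  by rewrite leq_pexp2l // prime_gt0.
have Hn : n <= 2 * n by rewrite mul2n -addnn leq_addr.
have := bin_fact Hn; rewrite {2}mul2n -addnn addnK => Hfact.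
have := congr1 (logn p) Hfact.
rewrite lognM ?muln_gt0 ?fact_gt0 ?bin_gt0 // lognM ?fact_gt0 // !logn_fact //.
have -> : \sum_(1 <= k < n.+1) n %/ p ^ k = \sum_(1 <= k < (2 * n).+1) n %/ p ^ k.
  rewrite [RHS](@big_cat_nat _ _ _ n.+1) //= [X in _ = _ + X]big_nat [X in _ = _ + X]big1 ?addn0 //.
  move=> k /andP [Hk _]; rewrite divn_small //; apply: ltn_trans Hk _.
  exact: ltn_expl (prime_gt1 Hp).
set A := \sum_(1 <= k < _) _ => H.
have : \sum_(1 <= k < (2 * n).+1) (2 * n) %/ p ^ k <=
   (A + A) + \sum_(1 <= k < (2 * n).+1) (k <= trunc_log p (2 * n)).
  rewrite /A -!big_split /= leq_sum // => k _.
  have pk_gt0 : 0 < p ^ k by rewrite expn_gt0 prime_gt0.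
  case: (leqP k (trunc_log p (2 * n))) => Hk.
    rewrite -ltnS ltn_divLR //.
    have := ltn_ceil n pk_gt0; rewrite mul2n -addnn; set u := n %/ _ => Hu.
    apply: (@leq_trans (u.+1 * p ^ k + u.+1 * p ^ k)).
      by apply: leq_trans (leq_add Hu Hu); rewrite addSn addnS.
    by rewrite -mulnDl leq_mul2r addSn addnS addn1 leqnn orbT.
  rewrite divn_small //.
  have := trunc_log_ltn (2 * n) (prime_gt1 Hp) => H2.
  by apply: leq_trans H2 _; rewrite leq_pexp2l // prime_gt0.
rewrite -H [_ + (A + A)]addnC leq_add2l => Hle; apply: leq_trans Hle _.
by rewrite sum_leq_indicator geq_minr.
Qed.

(** Chebyshev's lower bound, left in multiplicative form. The list consists of the prime divisors of
    C(2n, n); each enters with a prime power of size at most 2n, and C(2n, n) is at least 2^n. *)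
Lemma many_primes (n : nat) : (1 <= n)%coq_nat ->
  exists l : list nat, List.NoDup l /\
    (forall p, List.In p l -> Znumtheory.prime (Z.of_nat p) /\ (p <= 2 * n)%coq_nat) /\
    (Nat.pow 2 n <= Nat.pow (2 * n) (length l))%coq_nat.
Proof.
move=> /leP n_gt0; set c := 'C(2 * n, n).
have c_gt0 : 0 < c by rewrite bin_gt0 mul2n -addnn leq_addr.
have HIn (s : seq nat) x : List.In x s -> x \in s.
  by elim: s => //= y s IHs [->|/IHs Hx]; rewrite inE ?eqxx // Hx orbT.
exists (primes c); split; last split.
- have : uniq (primes c) by exact: primes_uniq.
  elim: (primes c) => [|x s IHs] /=; first by move=> _; exact: List.NoDup_nil.
  by case/andP=> Hx /IHs Hs; apply: List.NoDup_cons => // /HIn; apply/negP.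
- move=> p /HIn; rewrite mem_primes => /and3P [Hp _ Hpc]; split; first exact: prime_Z.
  apply/leP; apply: (@leq_trans (p ^ logn p c)); last exact: prime_power_central_binomial.
  have Hlog : 0 < logn p c by rewrite logn_gt0 mem_primes Hp c_gt0 Hpc.
  by rewrite -{1}(expn1 p) leq_exp2l // prime_gt1.
have Hpow (a b : nat) : Nat.pow a b = a ^ b by elim: b => //= b ->; rewrite expnS.
rewrite !Hpow; apply/leP; apply: (leq_trans (central_binomial_lower n)).
rewrite -/c [leqLHS](prod_prime_decomp c_gt0) prime_decompE big_map /=.
have : all prime (primes c) by apply/allP => p; rewrite mem_primes => /andP [].
elim: (primes c) => [|p s IHs] /=; first by rewrite big_nil.
case/andP=> Hp /IHs Hs; rewrite big_cons /= expnS leq_mul //.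
exact: prime_power_central_binomial.
Qed.
End Chebyshev.

Module Factorization.
Import mathcomp.boot.all_boot mathcomp.algebra.all_algebra mathcomp.real_closed.complex.
Import mathcomp.reals_stdlib.Rstruct GRing.Theory.
Local Open Scope ring_scope.

Definition of_C (z : C) : complex.complex Rdefinitions.R := Complex z.1 z.2.
Definition to_C (z : complex.complex Rdefinitions.R) : C :=
  let: Complex x y := z in (x, y).

Lemma of_C_add (x y : C) : of_C (Cplus x y) = of_C x + of_C y.
Proof. by []. Qed.

Lemma of_C_mul (x y : C) : of_C (Cmult x y) = of_C x * of_C y.
Proof. by []. Qed.

Lemma to_C_mul x y : to_C (x * y) = Cmult (to_C x) (to_C y).
Proof. by case: x y => [a b] [c d]. Qed.

Lemma to_C_sub x y : to_C (x - y) = Cminus (to_C x) (to_C y).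
Proof. by case: x y => [a b] [c d]. Qed.

Lemma of_CK (z : C) : to_C (of_C z) = z.
Proof. by case: z. Qed.

Lemma of_C_pow (z : C) n : of_C (Cpow z n) = of_C z ^+ n.
Proof. by elim: n => [|n IHn] //; rewrite exprS -IHn -of_C_mul. Qed.

(** The fundamental theorem of algebra, in the form [closed_field_poly_normal], transported along
    [of_C] and [to_C]. Sum and product are written with [fold_right] so that the statement involves
    Coquelicot's complex numbers alone. *)
Lemma complex_factorization (b : nat -> C) (n : nat) :
  exists (a : C) (rs : list C), forall z : C,
    List.fold_right (fun k s => Cplus (Cmult (b k) (Cpow z k)) s) (RtoC R0) (List.seq 0 n) =
    Cmult a (List.fold_right (fun r s => Cmult (Cminus z r) s) (RtoC R1) rs).
Proof.
set p := \poly_(i < n) of_C (b i).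
have [rs Hrs] := closed_field_poly_normal p.
exists (to_C (lead_coef p)), (map to_C rs) => z.
rewrite -[LHS]of_CK.
have -> : of_C (List.fold_right (fun k s => Cplus (Cmult (b k) (Cpow z k)) s) (RtoC R0) (List.seq 0 n)) = p.[of_C z].
  rewrite horner_poly -(big_mkord xpredT (fun i => of_C (b i) * of_C z ^+ i)) /index_iota subn0.
  have -> : List.seq 0 n = iota 0 n.
    by elim: n 0%N {p rs Hrs} => //= n IHn m; rewrite IHn.
  elim: (iota 0 n) => [|k s IHs]; first by rewrite big_nil.
  by rewrite big_cons /= of_C_add IHs of_C_mul of_C_pow.
rewrite {1}Hrs hornerZ to_C_mul; congr Cmult.
rewrite horner_prod; elim: rs {Hrs} => [|r rs IHrs]; first by rewrite big_nil.
by rewrite big_cons /= to_C_mul IHrs hornerXsubC to_C_sub of_CK.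
Qed.
End Factorization.

(** * Finite sums and the complex exponential *)

Definition Csum {A : Type} (f : A -> C) (l : list A) : C :=
  fold_right (fun a s => (f a + s)%C) (RtoC 0) l.

Definition Rsum {A : Type} (f : A -> R) (l : list A) : R :=
  fold_right (fun a s => f a + s) 0 l.

Lemma Csum_app {A : Type} (f : A -> C) l m :
  Csum f (l ++ m) = (Csum f l + Csum f m)%C.
Proof. induction l as [|a l IH]; simpl; [ring|rewrite IH; ring]. Qed.

Lemma Rsum_app {A : Type} (f : A -> R) l m :
  Rsum f (l ++ m) = Rsum f l + Rsum f m.
Proof. induction l as [|a l IH]; simpl; [ring|rewrite IH; ring]. Qed.

Lemma Csum_ext {A : Type} (f g : A -> C) l :
  (forall a, List.In a l -> f a = g a) -> Csum f l = Csum g l.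
Proof.
  induction l as [|a l IH]; intros E; simpl; [reflexivity|].
  rewrite E, IH; auto using in_eq, in_cons.
Qed.

Lemma Rsum_ext {A : Type} (f g : A -> R) l :
  (forall a, List.In a l -> f a = g a) -> Rsum f l = Rsum g l.
Proof.
  induction l as [|a l IH]; intros E; simpl; [reflexivity|].
  rewrite E, IH; auto using in_eq, in_cons.
Qed.

Lemma Csum_plus {A : Type} (f g : A -> C) l :
  Csum (fun a => f a + g a)%C l = (Csum f l + Csum g l)%C.
Proof. induction l as [|a l IH]; simpl; [ring|rewrite IH; ring]. Qed.

Lemma Csum_minus {A : Type} (f g : A -> C) l :
  Csum (fun a => f a - g a)%C l = (Csum f l - Csum g l)%C.
Proof. induction l as [|a l IH]; simpl; [ring|rewrite IH; ring]. Qed.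

Lemma Csum_scal {A : Type} (c : C) (f : A -> C) l :
  Csum (fun a => c * f a)%C l = (c * Csum f l)%C.
Proof. induction l as [|a l IH]; simpl; [ring|rewrite IH; ring]. Qed.

Lemma Rsum_plus {A : Type} (f g : A -> R) l :
  Rsum (fun a => f a + g a) l = Rsum f l + Rsum g l.
Proof. induction l as [|a l IH]; simpl; [ring|rewrite IH; ring]. Qed.

Lemma Rsum_scal {A : Type} (c : R) (f : A -> R) l :
  Rsum (fun a => c * f a) l = c * Rsum f l.
Proof. induction l as [|a l IH]; simpl; [ring|rewrite IH; ring]. Qed.

Lemma Csum_zero {A : Type} (f : A -> C) l :
  (forall a, List.In a l -> f a = RtoC 0) -> Csum f l = RtoC 0.
Proof.
  induction l as [|a l IH]; intros E; simpl; [reflexivity|].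
  rewrite E, IH; auto using in_eq, in_cons; ring.
Qed.

Lemma Rsum_le {A : Type} (f g : A -> R) l :
  (forall a, List.In a l -> f a <= g a) -> Rsum f l <= Rsum g l.
Proof.
  induction l as [|a l IH]; intros E; simpl; [lra|].
  apply Rplus_le_compat; auto using in_eq, in_cons.
Qed.

Lemma Rsum_const {A : Type} (c : R) (l : list A) :
  Rsum (fun _ => c) l = INR (length l) * c.
Proof.
  induction l as [|a l IH]; [simpl; ring|].
  change (length (a :: l)) with (S (length l)). rewrite S_INR.
  simpl. rewrite IH. ring.
Qed.

Lemma Rsum_nonneg {A : Type} (f : A -> R) l :
  (forall a, List.In a l -> 0 <= f a) -> 0 <= Rsum f l.
Proof.
  intros E. replace 0 with (Rsum (fun _ : A => 0) l) by (rewrite Rsum_const; ring).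
  now apply Rsum_le.
Qed.

Lemma Rsum_le_const {A : Type} (f : A -> R) c l :
  (forall a, List.In a l -> f a <= c) -> Rsum f l <= INR (length l) * c.
Proof. intros E. rewrite <- Rsum_const. now apply Rsum_le. Qed.

Lemma Rsum_ge_const {A : Type} (f : A -> R) c l :
  (forall a, List.In a l -> c <= f a) -> INR (length l) * c <= Rsum f l.
Proof. intros E. rewrite <- Rsum_const. now apply Rsum_le. Qed.

Lemma Csum_perm {A : Type} (f : A -> C) l m :
  Permutation l m -> Csum f l = Csum f m.
Proof.
  induction 1; simpl; try congruence; ring.
Qed.

Lemma Rsum_perm {A : Type} (f : A -> R) l m :
  Permutation l m -> Rsum f l = Rsum f m.
Proof.
  induction 1; simpl; try congruence; ring.
Qed.

Lemma Csum_map {A B : Type} (g : A -> B) (f : B -> C) l :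
  Csum f (map g l) = Csum (fun a => f (g a)) l.
Proof. induction l as [|a l IH]; simpl; [|rewrite IH]; reflexivity. Qed.

Lemma Rsum_map {A B : Type} (g : A -> B) (f : B -> R) l :
  Rsum f (map g l) = Rsum (fun a => f (g a)) l.
Proof. induction l as [|a l IH]; simpl; [|rewrite IH]; reflexivity. Qed.

Lemma Csum_swap {A B : Type} (f : A -> B -> C) l m :
  Csum (fun a => Csum (f a) m) l = Csum (fun b => Csum (fun a => f a b) l) m.
Proof.
  induction l as [|a l IH]; simpl.
  - symmetry. apply Csum_zero. reflexivity.
  - rewrite IH. symmetry. apply Csum_plus.
Qed.

Lemma Cmod_Csum {A : Type} (f : A -> C) l :
  Cmod (Csum f l) <= Rsum (fun a => Cmod (f a)) l.
Proof.
  induction l as [|a l IH]; simpl; [rewrite Cmod_0; lra|].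
  eapply Rle_trans; [apply Cmod_triangle|]. lra.
Qed.

Lemma Re_Csum {A : Type} (f : A -> C) l :
  Re (Csum f l) = Rsum (fun a => Re (f a)) l.
Proof. induction l as [|a l IH]; simpl; [|rewrite <- IH]; reflexivity. Qed.

Lemma Csum_RtoC {A : Type} (f : A -> R) l :
  Csum (fun a => RtoC (f a)) l = RtoC (Rsum f l).
Proof. induction l as [|a l IH]; simpl; [|rewrite IH, RtoC_plus]; reflexivity. Qed.

Lemma Csum_seq_S (f : nat -> C) a n :
  Csum f (seq a (S n)) = (Csum f (seq a n) + f (a + n)%nat)%C.
Proof. rewrite seq_S, Csum_app. simpl. ring. Qed.

Lemma Rsum_seq_S (f : nat -> R) a n :
  Rsum f (seq a (S n)) = Rsum f (seq a n) + f (a + n)%nat.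
Proof. rewrite seq_S, Rsum_app. simpl. ring. Qed.

Lemma Csum_seq_shift (f : nat -> C) a b n :
  Csum f (seq (a + b) n) = Csum (fun k => f (a + k)%nat) (seq b n).
Proof.
  induction n as [|n IH]; [reflexivity|].
  rewrite !Csum_seq_S, IH. f_equal. f_equal. lia.
Qed.

Lemma Rsum_telescope (f : nat -> R) a n :
  Rsum (fun k => f k - f (S k)) (seq a n) = f a - f (a + n)%nat.
Proof.
  induction n as [|n IH]; [simpl; rewrite Nat.add_0_r; ring|].
  rewrite Rsum_seq_S, IH, <- plus_n_Sm. ring.
Qed.

(** * The complex exponential and log |1 - w| *)

Lemma Cexp_add z w : Cexp (z + w) = (Cexp z * Cexp w)%C.
Proof.
  unfold Cexp. destruct z as [a b], w as [c d].
  apply injective_projections; simpl;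
    rewrite exp_plus; [rewrite cos_plus|rewrite sin_plus]; ring.
Qed.

Lemma Cexp_0 : Cexp (RtoC 0) = RtoC 1.
Proof.
  unfold Cexp. apply injective_projections; simpl; rewrite exp_0;
    [rewrite cos_0|rewrite sin_0]; ring.
Qed.

Lemma Cexp_RtoC x : Cexp (RtoC x) = RtoC (exp x).
Proof.
  unfold Cexp. apply injective_projections; simpl; [rewrite cos_0|rewrite sin_0]; ring.
Qed.

Lemma Cexp_pow z n : (Cexp z ^ n)%C = Cexp (RtoC (INR n) * z).
Proof.
  induction n as [|n IH].
  - simpl. rewrite <- Cexp_0. f_equal. ring.
  - rewrite Cpow_S, IH, <- Cexp_add, S_INR, RtoC_plus. f_equal. ring.
Qed.

Lemma Cmod_sqr z : Cmod z * Cmod z = Re z * Re z + Im z * Im z.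
Proof. pose proof (Cmod2_alt z) as E. simpl in E. lra. Qed.

Lemma Cmod_Cexp z : Cmod (Cexp z) = exp (Re z).
Proof.
  pose proof (exp_pos (Re z)) as P.
  apply Rsqr_inj; [apply Cmod_ge_0|lra|].
  unfold Rsqr. rewrite Cmod_sqr. simpl.
  pose proof (sin2_cos2 (Im z)) as E. unfold Rsqr in E.
  transitivity (exp (Re z) * exp (Re z) *
    (sin (Im z) * sin (Im z) + cos (Im z) * cos (Im z))); [ring|].
  rewrite E. ring.
Qed.

Lemma Re_mult_le (z w : C) : Re z * Re w + Im z * Im w <= Cmod z * Cmod w.
Proof.
  replace (Re z * Re w + Im z * Im w) with (Re (z * Cconj w)%C) by (simpl; unfold Re, Im; ring).
  rewrite <- (Cmod_conj w), <- Cmod_mult.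
  eapply Rle_trans; [apply Rle_abs|apply re_le_Cmod].
Qed.

Lemma Re_le_Cmod z : Re z <= Cmod z.
Proof. eapply Rle_trans; [apply Rle_abs|apply re_le_Cmod]. Qed.

(* The increment of f is projected on its own direction, which reduces the
   inequality to the monotonicity of a real function. *)
Lemma increment_le (f f' : R -> C) (g g' : R -> R) (a b : R) :
  a <= b ->
  (forall s, a <= s <= b -> is_derive (fun x => Re (f x)) s (Re (f' s))) ->
  (forall s, a <= s <= b -> is_derive (fun x => Im (f x)) s (Im (f' s))) ->
  (forall s, a <= s <= b -> is_derive g s (g' s)) ->
  (forall s, a <= s <= b -> Cmod (f' s) <= g' s) ->
  Cmod (f b - f a) <= g b - g a.
Proof.
  intros Hab HR HI Hg Hle.
  set (d := (f b - f a)%C).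
  set (phi := fun s => Cmod d * g s - (Re d * Re (f s) + Im d * Im (f s))).
  set (phi' := fun s => Cmod d * g' s - (Re d * Re (f' s) + Im d * Im (f' s))).
  assert (Hd : forall s, a <= s <= b -> is_derive phi s (phi' s)).
  { intros s Hs. unfold phi, phi'.
    apply (is_derive_minus (V := R_NormedModule)).
    - apply (is_derive_scal g). auto.
    - apply (is_derive_plus (V := R_NormedModule));
        [apply (is_derive_scal (fun x => Re (f x)))|apply (is_derive_scal (fun x => Im (f x)))]; auto. }
  destruct (MVT_gen phi a b phi') as [c [Hc E]].
  - intros s Hs. apply Hd. rewrite Rmin_left, Rmax_right in Hs by lra. lra.
  - intros s Hs. rewrite Rmin_left, Rmax_right in Hs by lra.
    apply continuity_pt_filterlim. apply (ex_derive_continuous (V := R_NormedModule)).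
    exists (phi' s). auto.
  - rewrite Rmin_left, Rmax_right in Hc by lra.
    assert (P : 0 <= phi' c).
    { unfold phi'. pose proof (Re_mult_le d (f' c)). pose proof (Hle c Hc).
      pose proof (Cmod_ge_0 d). nra. }
    assert (Q : 0 <= phi b - phi a) by nra.
    unfold phi in Q.
    pose proof (Cmod_sqr d) as S.
    assert (E1 : Re d = Re (f b) - Re (f a)) by reflexivity.
    assert (E2 : Im d = Im (f b) - Im (f a)) by reflexivity.
    pose proof (Cmod_ge_0 d) as [Pd|Zd].
    + apply Rmult_le_reg_l with (Cmod d); [assumption|]. rewrite S. rewrite E1, E2 in *. nra.
    (* If the increment is 0, projecting on it says nothing, and the monotonicity of [g] is proved
       directly. *)
    + assert (0 <= g b - g a).
      { destruct (MVT_gen g a b g') as [c' [Hc' E']].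
        - intros s Hs. apply Hg. rewrite Rmin_left, Rmax_right in Hs by lra. lra.
        - intros s Hs. rewrite Rmin_left, Rmax_right in Hs by lra.
          apply continuity_pt_filterlim. apply (ex_derive_continuous (V := R_NormedModule)).
          exists (g' s). auto.
        - rewrite Rmin_left, Rmax_right in Hc' by lra.
          pose proof (Hle c' Hc'). pose proof (Cmod_ge_0 (f' c')). nra. }
      lra.
Qed.

Lemma Re_plus z w : Re (z + w)%C = Re z + Re w.
Proof. reflexivity. Qed.

Lemma Im_plus z w : Im (z + w)%C = Im z + Im w.
Proof. reflexivity. Qed.

Lemma Re_scal a z : Re (RtoC a * z)%C = a * Re z.
Proof. unfold Re. simpl. ring. Qed.

Lemma Im_scal a z : Im (RtoC a * z)%C = a * Im z.
Proof. unfold Im. simpl. ring. Qed.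

Lemma Re_minus z w : Re (z - w)%C = Re z - Re w.
Proof. reflexivity. Qed.

Lemma exp_le_compat x y : x <= y -> exp x <= exp y.
Proof. intros [H| ->]; [left; now apply exp_increasing|lra]. Qed.

Lemma exp_pow_INR x n : exp x ^ n = exp (INR n * x).
Proof.
  induction n as [|n IH]; [simpl; rewrite Rmult_0_l, exp_0; reflexivity|].
  rewrite S_INR. simpl. rewrite IH, <- exp_plus. f_equal. ring.
Qed.

Lemma Re_RtoC x : Re (RtoC x) = x.
Proof. reflexivity. Qed.

Definition exp_poly (n : nat) (w : C) : C :=
  Csum (fun k => w ^ k / RtoC (INR (fact k)))%C (seq 0 n).

Lemma is_derive_monomial (r : R) (n : nat) (s : R) :
  is_derive (fun x => x ^ S n * r) s (INR (S n) * s ^ n * r).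
Proof.
  apply (is_derive_ext (fun x => scal (x ^ S n) r)); [reflexivity|].
  evar_last; [apply (is_derive_scal_l (V := R_NormedModule)); apply is_derive_pow; apply is_derive_id|].
  unfold scal; simpl; unfold mult, one; simpl. ring.
Qed.

Lemma is_derive_exp_poly (w : C) (n : nat) (s : R) :
  is_derive (fun x => Re (exp_poly (S n) (RtoC x * w))) s (Re (w * exp_poly n (RtoC s * w))%C) /\
  is_derive (fun x => Im (exp_poly (S n) (RtoC x * w))) s (Im (w * exp_poly n (RtoC s * w))%C).
Proof.
  assert (E : forall x k, ((RtoC x * w) ^ k / RtoC (INR (fact k)))%C =
     (RtoC (x ^ k) * (w ^ k / RtoC (INR (fact k))))%C).
  { intros x k. rewrite Cpow_mult_l, RtoC_pow. unfold Cdiv. ring. }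
  assert (F : forall k, (RtoC (INR (S k)) * (w ^ S k / RtoC (INR (fact (S k)))) =
     w * (w ^ k / RtoC (INR (fact k))))%C).
  { intros k. change (fact (S k)) with (S k * fact k)%nat. rewrite mult_INR, RtoC_mult, Cpow_S.
    field. split; intro H; apply RtoC_inj in H; revert H;
      [apply INR_fact_neq_0|apply not_0_INR; lia]. }
  induction n as [|n [IHR IHI]].
  - split.
    + apply (is_derive_ext (fun _ => 1)).
      { intros t. unfold exp_poly. simpl. field. }
      replace (Re (w * exp_poly 0 (RtoC s * w))%C) with 0 by (unfold exp_poly, Re; simpl; ring).
      apply (is_derive_const (V := R_NormedModule) 1).
    + apply (is_derive_ext (fun _ => 0)).
      { intros t. unfold exp_poly. simpl. field. }
      replace (Im (w * exp_poly 0 (RtoC s * w))%C) with 0 by (unfold exp_poly, Im; simpl; ring).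
      apply (is_derive_const (V := R_NormedModule) 0).
  - assert (G : forall x, exp_poly (S (S n)) (RtoC x * w) = (exp_poly (S n) (RtoC x * w) +
      RtoC (x ^ S n) * (w ^ S n / RtoC (INR (fact (S n)))))%C).
    { intros x. unfold exp_poly at 1. rewrite Csum_seq_S. rewrite <- E. reflexivity. }
    assert (G' : (w * exp_poly (S n) (RtoC s * w) = w * exp_poly n (RtoC s * w) +
      RtoC (INR (S n) * s ^ n) * (w ^ S n / RtoC (INR (fact (S n)))))%C).
    { unfold exp_poly at 1. rewrite Csum_seq_S. fold (exp_poly n (RtoC s * w)).
      simpl (0 + n)%nat. rewrite E, RtoC_mult.
      replace (RtoC (INR (S n)) * RtoC (s ^ n) * (w ^ S n / RtoC (INR (fact (S n)))))%C with
        (RtoC (s ^ n) * (RtoC (INR (S n)) * (w ^ S n / RtoC (INR (fact (S n))))))%C by ring.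
      rewrite F. ring. }
    rewrite G'. set (c := (w ^ S n / RtoC (INR (fact (S n))))%C) in *.
    split.
    + apply (is_derive_ext (fun x => Re (exp_poly (S n) (RtoC x * w)) + x ^ S n * Re c)).
      { intros t. rewrite G, Re_plus, Re_scal. reflexivity. }
      rewrite Re_plus, Re_scal.
      apply (is_derive_plus (V := R_NormedModule)); [exact IHR|].
      apply is_derive_monomial.
    + apply (is_derive_ext (fun x => Im (exp_poly (S n) (RtoC x * w)) + x ^ S n * Im c)).
      { intros t. rewrite G, Im_plus, Im_scal. reflexivity. }
      rewrite Im_plus, Im_scal.
      apply (is_derive_plus (V := R_NormedModule)); [exact IHI|].
      apply is_derive_monomial.
Qed.

Lemma is_derive_Cexp (w : C) (s : R) :
  is_derive (fun x => Re (Cexp (RtoC x * w))) s (Re (w * Cexp (RtoC s * w))%C) /\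
  is_derive (fun x => Im (Cexp (RtoC x * w))) s (Im (w * Cexp (RtoC s * w))%C).
Proof.
  destruct w as [a b].
  assert (E : forall x, Cexp (RtoC x * (a, b)) = (exp (x * a) * cos (x * b), exp (x * a) * sin (x * b))).
  { intros x. unfold Cexp. simpl.
    replace (x * a - 0 * b) with (x * a) by ring. replace (x * b + 0 * a) with (x * b) by ring.
    reflexivity. }
  rewrite E. split.
  - apply (is_derive_ext (fun x => exp (x * a) * cos (x * b))).
    { intros t. rewrite E. reflexivity. }
    auto_derive; [trivial|]. simpl. ring.
  - apply (is_derive_ext (fun x => exp (x * a) * sin (x * b))).
    { intros t. rewrite E. reflexivity. }
    auto_derive; [trivial|]. simpl. ring.
Qed.

(** Induction on [n] along the segment from 0 to [w]: the derivative in [s] of the remainder of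
    order n + 1 is [w] times the remainder of order n, and [increment_le] integrates the bound. The
    parameter [s] makes this integration possible. *)
Lemma Cexp_taylor_segment (w : C) (n : nat) : forall s : R, 0 <= s <= 1 ->
  Cmod (Cexp (RtoC s * w) - exp_poly n (RtoC s * w)) <=
  (s * Cmod w) ^ n / INR (fact n) * exp (Cmod w).
Proof.
  induction n as [|n IH]; intros s Hs.
  - unfold exp_poly. simpl. replace (Cexp (RtoC s * w) - 0)%C with (Cexp (RtoC s * w)) by ring.
    rewrite Cmod_Cexp. replace (1 / 1 * exp (Cmod w)) with (exp (Cmod w)) by field.
    apply exp_le_compat.
    pose proof (Re_le_Cmod w). pose proof (Cmod_ge_0 w). unfold Re in *. simpl. nra.
  - assert (N : INR (fact n) <> 0) by apply INR_fact_neq_0.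
    assert (N' : INR (S n) <> 0) by (apply not_0_INR; lia).
    pose proof (increment_le
      (fun x => Cexp (RtoC x * w) - exp_poly (S n) (RtoC x * w))%C
      (fun x => w * Cexp (RtoC x * w) - w * exp_poly n (RtoC x * w))%C
      (fun x => (x * Cmod w) ^ S n / INR (fact (S n)) * exp (Cmod w))
      (fun x => Cmod w * ((x * Cmod w) ^ n / INR (fact n) * exp (Cmod w))) 0 s) as I.
    assert (Z : (Cexp (RtoC 0 * w) - exp_poly (S n) (RtoC 0 * w))%C = RtoC 0).
    { replace (RtoC 0 * w)%C with (RtoC 0) by ring. rewrite Cexp_0.
      unfold exp_poly. simpl. rewrite Csum_zero.
      - field.
      - intros k Hk. apply in_seq in Hk. destruct k; [lia|]. rewrite Cpow_S. unfold Cdiv. ring. }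
    cbv beta in I. rewrite Z in I. replace ((0 * Cmod w) ^ S n) with 0 in I by (simpl; ring).
    replace (0 / INR (fact (S n)) * exp (Cmod w)) with 0 in I by (unfold Rdiv; ring).
    rewrite Rminus_0_r in I.
    replace (Cexp (RtoC s * w) - exp_poly (S n) (RtoC s * w) - 0)%C with
      (Cexp (RtoC s * w) - exp_poly (S n) (RtoC s * w))%C in I by ring.
    apply I; [lra| | | |].
    + intros x Hx. apply (is_derive_minus (V := R_NormedModule) (fun x => Re (Cexp (RtoC x * w)))
        (fun x => Re (exp_poly (S n) (RtoC x * w)))); [apply is_derive_Cexp|apply is_derive_exp_poly].
    + intros x Hx. apply (is_derive_minus (V := R_NormedModule) (fun x => Im (Cexp (RtoC x * w)))
        (fun x => Im (exp_poly (S n) (RtoC x * w)))); [apply is_derive_Cexp|apply is_derive_exp_poly].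
    + intros x Hx.
      apply (is_derive_ext (fun x => x ^ S n * (Cmod w ^ S n / INR (fact (S n)) * exp (Cmod w)))).
      { intros t. rewrite Rpow_mult_distr. unfold Rdiv. apply Rmult_eq_reg_l with 1; [ring|lra]. }
      evar_last; [apply is_derive_monomial|].
      change (fact (S n)) with (S n * fact n)%nat. rewrite mult_INR, Rpow_mult_distr.
      simpl (Cmod w ^ S n). field. auto.
    + intros x Hx.
      replace (w * Cexp (RtoC x * w) - w * exp_poly n (RtoC x * w))%C with
        (w * (Cexp (RtoC x * w) - exp_poly n (RtoC x * w)))%C by ring.
      rewrite Cmod_mult. apply Rmult_le_compat_l; [apply Cmod_ge_0|]. apply IH. lra.
Qed.

Lemma Cexp_taylor (w : C) (n : nat) :
  Cmod (Cexp w - exp_poly n w) <= Cmod w ^ n / INR (fact n) * exp (Cmod w).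
Proof.
  pose proof (Cexp_taylor_segment w n 1 ltac:(lra)) as H.
  replace (RtoC 1 * w)%C with w in H by ring. now rewrite Rmult_1_l in H.
Qed.

(** With [w] replaced by s w, the left-hand side has derivative -Re (s^n w^(n+1) / (1 - s w)) in s,
    by the finite geometric sum. It vanishes at s = 0, so bounding the derivative on [0, 1]
    suffices, and only the real logarithm occurs. *)
Lemma ln_Cmod_expansion (w : C) (n : nat) : Cmod w < 1 ->
  Rabs (ln (Cmod (1 - w)) + Re (Csum (fun k => w ^ S k / RtoC (INR (S k)))%C (seq 0 n)))
    <= Cmod w ^ S n / (1 - Cmod w).
Proof.
  intros Hw.
  assert (Hpos : forall s, 0 <= s <= 1 -> 1 - Cmod w <= Cmod (1 - RtoC s * w)).
  { intros s Hs. pose proof (Cmod_triangle (1 - RtoC s * w) (RtoC s * w)) as T.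
    replace (1 - RtoC s * w + RtoC s * w)%C with (RtoC 1) in T by ring.
    rewrite Cmod_1, Cmod_mult, Cmod_R, Rabs_right in T by lra.
    pose proof (Cmod_ge_0 w). nra. }
  set (D := fun s => (1 - s * Re w) * (1 - s * Re w) + (s * Im w) * (s * Im w)).
  assert (HD : forall s, Cmod (1 - RtoC s * w) * Cmod (1 - RtoC s * w) = D s).
  { intros s. rewrite Cmod_sqr. unfold D, Re, Im. simpl. ring. }
  assert (HDp : forall s, 0 <= s <= 1 -> 0 < D s).
  { intros s Hs. rewrite <- HD. pose proof (Hpos s Hs). nra. }
  set (q := fun m x => Rsum (fun k => x ^ S k * Re (w ^ S k / RtoC (INR (S k)))%C) (seq 0 m)).
  set (q' := fun m x => Rsum (fun k => x ^ k * Re (w ^ S k)%C) (seq 0 m)).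
  assert (Hq : forall m s, is_derive (q m) s (q' m s)).
  { intros m s. induction m as [|m IH].
    - apply (is_derive_const (V := R_NormedModule) 0).
    - apply (is_derive_ext (fun x => q m x + x ^ S m * Re (w ^ S m / RtoC (INR (S m)))%C)).
      { intros t. unfold q. rewrite Rsum_seq_S. reflexivity. }
      unfold q'. rewrite Rsum_seq_S. apply (is_derive_plus (V := R_NormedModule)); [exact IH|].
      change (0 + m)%nat with m. replace (s ^ m * Re (w ^ S m)%C) with
        (INR (S m) * s ^ m * Re (w ^ S m / RtoC (INR (S m)))%C); [apply is_derive_monomial|].
      replace (Re (w ^ S m)%C) with (INR (S m) * Re (w ^ S m / RtoC (INR (S m)))%C).
      + ring.
      + rewrite <- Re_scal. f_equal. field. intro H. apply RtoC_inj in H. revert H.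
        apply not_0_INR. lia. }
  assert (Hgeo : forall m s, 0 <= s <= 1 ->
    (Csum (fun k => RtoC (s ^ k) * w ^ S k) (seq 0 m) * (1 - RtoC s * w))%C = (w - RtoC (s ^ m) * w ^ S m)%C).
  { intros m s Hs. induction m as [|m IH].
    - simpl. ring.
    - rewrite Csum_seq_S, Cmult_plus_distr_r, IH. simpl. rewrite RtoC_mult. ring. }
  set (f := fun x => (RtoC (/ 2 * ln (D x) + q n x))).
  set (f' := fun s => RtoC (- Re (RtoC (s ^ n) * w ^ S n / (1 - RtoC s * w))%C)).
  pose proof (increment_le f f'
     (fun x => x * (Cmod w ^ S n / (1 - Cmod w))) (fun _ => Cmod w ^ S n / (1 - Cmod w)) 0 1) as I.
  assert (F0 : f 0 = RtoC 0).
  { unfold f, D. f_equal. replace ((1 - 0 * Re w) * (1 - 0 * Re w) + 0 * Im w * (0 * Im w)) with 1 by ring.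
    rewrite ln_1. unfold q. rewrite (Rsum_ext _ (fun _ => 0)).
    - rewrite Rsum_const. ring.
    - intros k _. simpl. ring. }
  assert (F1 : f 1 = RtoC (ln (Cmod (1 - w)) + Re (Csum (fun k => w ^ S k / RtoC (INR (S k)))%C (seq 0 n)))).
  { unfold f. f_equal. rewrite <- HD. replace (1 - RtoC 1 * w)%C with (1 - w)%C by ring.
    assert (0 < Cmod (1 - w)).
    { pose proof (Hpos 1 ltac:(lra)) as P. replace (1 - RtoC 1 * w)%C with (1 - w)%C in P by ring. lra. }
    rewrite ln_mult by assumption. rewrite Re_Csum. unfold q.
    rewrite (Rsum_ext (fun k => 1 ^ S k * _) (fun k => Re (w ^ S k / RtoC (INR (S k)))%C)).
    - field.
    - intros k _. rewrite pow1. ring. }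
  cbv beta in I. rewrite F0, F1 in I.
  match type of I with context [Cmod (?x - RtoC 0)%C] => replace (x - RtoC 0)%C with x in I by ring end.
  rewrite Cmod_R in I. eapply Rle_trans; [apply I|lra]; clear I; try lra.
  - intros s Hs.
    change (is_derive (fun x => / 2 * ln (D x) + q n x) s
      (- Re (RtoC (s ^ n) * w ^ S n / (1 - RtoC s * w))%C)).
    assert (E : - Re (RtoC (s ^ n) * w ^ S n / (1 - RtoC s * w))%C =
      - ((1 - s * Re w) * Re w - s * Im w * Im w) / D s + q' n s).
    { unfold q'. rewrite (Rsum_ext _ (fun k => Re (RtoC (s ^ k) * w ^ S k)%C)).
      2:{ intros k _. unfold Re. set (y := (w ^ S k)%C). simpl. ring. }
      rewrite <- Re_Csum.
      assert (NZ : (1 - RtoC s * w)%C <> RtoC 0).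
      { intro Z. pose proof (Hpos s Hs) as P. rewrite Z, Cmod_0 in P. lra. }
      assert (E1 : Csum (fun k => RtoC (s ^ k) * w ^ S k)%C (seq 0 n) =
        (w / (1 - RtoC s * w) - RtoC (s ^ n) * w ^ S n / (1 - RtoC s * w))%C).
      { replace (w / (1 - RtoC s * w) - RtoC (s ^ n) * w ^ S n / (1 - RtoC s * w))%C with
         ((w - RtoC (s ^ n) * w ^ S n) / (1 - RtoC s * w))%C by (unfold Cdiv; ring).
        rewrite <- (Hgeo n s Hs). field. exact NZ. }
      rewrite E1.
      assert (E2 : Re (w / (1 - RtoC s * w))%C = ((1 - s * Re w) * Re w - s * Im w * Im w) / D s).
      { pose proof (HDp s Hs) as P. unfold D, Re, Im in *. destruct w as [a b]. simpl in *.
        field. repeat split; intro Z; nra. }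
      rewrite Re_minus, E2. unfold Rdiv. ring. }
    rewrite E. apply (is_derive_plus (V := R_NormedModule)); [|apply Hq].
    unfold D. auto_derive.
    + apply HDp. exact Hs.
    + pose proof (HDp s Hs). unfold D in *. unfold Re, Im in *. field. lra.
  - intros s Hs. simpl. apply (is_derive_const (V := R_NormedModule) 0).
  - intros s Hs. generalize (Cmod w ^ S n / (1 - Cmod w)). intros c.
    auto_derive; [trivial|ring].
  - intros s Hs. unfold f'. rewrite Cmod_R.
    eapply Rle_trans; [rewrite Rabs_Ropp; apply re_le_Cmod|].
    pose proof (Hpos s Hs) as P.
    rewrite Cmod_div by (intro Z; rewrite Z, Cmod_0 in P; lra).
    rewrite Cmod_mult, Cmod_R, Cmod_pow.
    assert (0 <= s ^ n <= 1).
    { split; [apply pow_le; lra|]. rewrite <- (pow1 n). apply pow_incr. lra. }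
    rewrite Rabs_right by lra.
    assert (0 <= Cmod w ^ S n) by (apply pow_le, Cmod_ge_0).
    unfold Rdiv. apply Rmult_le_compat.
    + nra.
    + left. apply Rinv_0_lt_compat. lra.
    + nra.
    + apply Rinv_le_contravar; lra.
Qed.

(** * Polynomials without zeros in a disc *)

Definition zeta_root (M : nat) : C := Cexp (0, 2 * PI / INR M).

Lemma zeta_root_pow M e : (0 < M)%nat -> (zeta_root M ^ e)%C = Cexp (0, 2 * PI * INR e / INR M).
Proof.
  intros HM. unfold zeta_root. rewrite Cexp_pow. f_equal.
  apply injective_projections; simpl; [ring|].
  field. apply not_0_INR. lia.
Qed.

Lemma zeta_root_order M : (0 < M)%nat -> (zeta_root M ^ M)%C = RtoC 1.
Proof.
  intros HM. rewrite zeta_root_pow by assumption. unfold Cexp. simpl.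
  replace (2 * PI * INR M / INR M) with (2 * PI) by (field; apply not_0_INR; lia).
  rewrite exp_0, cos_2PI, sin_2PI. apply injective_projections; simpl; ring.
Qed.

Lemma zeta_root_primitive M e : (0 < e < M)%nat -> (zeta_root M ^ e)%C <> RtoC 1.
Proof.
  intros He E. rewrite zeta_root_pow in E by lia.
  apply (f_equal Re) in E. unfold Cexp in E. simpl in E.
  rewrite exp_0, Rmult_1_l in E.
  assert (P : 0 < INR M) by (apply lt_0_INR; lia).
  set (x := PI * INR e / INR M).
  replace (2 * PI * INR e / INR M) with (2 * x) in E by (unfold x; field; lra).
  rewrite cos_2a_sin in E.
  assert (Hx : 0 < sin x).
  { pose proof PI_RGT_0. assert (0 < INR e) by (apply lt_0_INR; lia).
    assert (INR e < INR M) by (apply lt_INR; lia).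
    apply sin_gt_0; unfold x.
    - apply Rdiv_lt_0_compat; nra.
    - apply Rmult_lt_reg_r with (INR M); [lra|]. unfold Rdiv. rewrite Rmult_assoc, Rinv_l by lra. nra. }
  nra.
Qed.

Lemma Cmod_zeta_root M : Cmod (zeta_root M) = 1.
Proof. unfold zeta_root. rewrite Cmod_Cexp. simpl. apply exp_0. Qed.

Lemma geometric_sum (w : C) n : ((w - 1) * Csum (fun j => w ^ j) (seq 0 n) = w ^ n - 1)%C.
Proof.
  induction n as [|n IH]; [simpl; ring|].
  rewrite Csum_seq_S, Cmult_plus_distr_l, IH. simpl. ring.
Qed.

(** The unnormalised mean of z^e over the M-th roots of unity, in place of an integral over the
    circle. *)
Definition root_mean (M e : nat) : C := Csum (fun j => (zeta_root M ^ j) ^ e)%C (seq 0 M).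

Lemma root_mean_shift M e : (0 < M)%nat -> root_mean M (e + M) = root_mean M e.
Proof.
  intros HM. apply Csum_ext. intros j _.
  rewrite Cpow_add_r, <- (Cpow_mult_r (zeta_root M) j M), Nat.mul_comm, Cpow_mult_r, zeta_root_order by assumption.
  rewrite Cpow_1_l. ring.
Qed.

Lemma root_mean_0 M : root_mean M 0 = RtoC (INR M).
Proof.
  unfold root_mean. rewrite (Csum_ext _ (fun _ => RtoC 1)) by (intros; reflexivity).
  rewrite (Csum_RtoC (fun _ : nat => 1)), Rsum_const, length_seq. f_equal. ring.
Qed.

Lemma root_mean_lt M e : (0 < e < M)%nat -> root_mean M e = RtoC 0.
Proof.
  intros He. unfold root_mean.
  assert (E : Csum (fun j => (zeta_root M ^ j) ^ e)%C (seq 0 M) =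
     Csum (fun j => (zeta_root M ^ e) ^ j)%C (seq 0 M)).
  { apply Csum_ext. intros j _. rewrite <- !Cpow_mult_r. f_equal. lia. }
  rewrite E. pose proof (geometric_sum (zeta_root M ^ e) M) as G.
  rewrite <- Cpow_mult_r, (Nat.mul_comm e M), Cpow_mult_r, zeta_root_order, Cpow_1_l in G by lia.
  replace (1 - 1)%C with (RtoC 0) in G by ring.
  apply Cmod_eq_0. apply (f_equal Cmod) in G. rewrite Cmod_mult, Cmod_0 in G.
  apply Rmult_integral in G as [Z|Z]; [|exact Z].
  exfalso. apply (zeta_root_primitive M e He). apply Cmod_eq_0 in Z.
  rewrite <- (Cplus_0_r 1), <- Z. ring.
Qed.

Lemma zeta_root_conj M j k : (k <= M)%nat -> (0 < M)%nat ->
  Cconj ((zeta_root M ^ j) ^ k) = ((zeta_root M ^ j) ^ (M - k))%C.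
Proof.
  intros Hk HM. set (w := ((zeta_root M ^ j) ^ k)%C).
  assert (E : (w * (zeta_root M ^ j) ^ (M - k))%C = RtoC 1).
  { unfold w. rewrite <- Cpow_add_r. replace (k + (M - k))%nat with M by lia.
    rewrite <- Cpow_mult_r, Nat.mul_comm, Cpow_mult_r, zeta_root_order by assumption. apply Cpow_1_l. }
  assert (E' : (Cconj w * w)%C = RtoC 1).
  { rewrite Cmult_comm, <- Cmod2_conj. f_equal. unfold w. rewrite !Cmod_pow, Cmod_zeta_root, !pow1. ring. }
  rewrite <- (Cmult_1_r (Cconj w)), <- E, Cmult_assoc, E'. ring.
Qed.

(* Integrate B - Re T against the nonnegative weight |b| + Re (b z^k), where b is
   the k-th coefficient of T. *)
Lemma trig_polynomial_coefficient (d : nat -> C) (n k : nat) (B : R) :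
  (1 <= k < n)%nat ->
  (forall j, Re (Csum (fun l => d l * (zeta_root (2 * n) ^ j) ^ l)%C (seq 0 n)) <= B) ->
  Cmod (d k) <= 2 * (B - Re (d 0%nat)).
Proof.
  (* Twice as many nodes as coefficients: the frequencies l + k with l, k < n stay below [M], so the
     discrete means separate them exactly. *)
  intros Hk HB. set (M := (2 * n)%nat) in *.
  set (T := fun j => Csum (fun l => d l * (zeta_root M ^ j) ^ l)%C (seq 0 n)) in *.
  assert (HM : 0 < INR M) by (apply lt_0_INR; lia).
  assert (S0 : forall e, Csum (fun j => T j * (zeta_root M ^ j) ^ e)%C (seq 0 M) =
     Csum (fun l => d l * root_mean M (l + e))%C (seq 0 n)).
  { intros e. unfold T, root_mean.
    rewrite (Csum_ext _ (fun j => Csum (fun l => d l * (zeta_root M ^ j) ^ (l + e))%C (seq 0 n))).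
    - rewrite Csum_swap. apply Csum_ext. intros l _. apply Csum_scal.
    - intros j _. rewrite Cmult_comm, <- Csum_scal. apply Csum_ext. intros l _.
      rewrite Cpow_add_r. ring. }
  assert (Sel : forall i e, (i < n)%nat -> (forall l, (l < n)%nat -> l <> i -> root_mean M (l + e) = RtoC 0) ->
     root_mean M (i + e) = RtoC (INR M) ->
     Csum (fun l => d l * root_mean M (l + e))%C (seq 0 n) = (d i * RtoC (INR M))%C).
  { intros i e Hi Hz Hm.
    replace (seq 0 n) with (seq 0 i ++ i :: seq (S i) (n - S i)).
    - rewrite Csum_app. simpl. rewrite Hm.
      rewrite (Csum_zero _ (seq 0 i)), (Csum_zero _ (seq (S i) _)); [ring| |];
        intros l Hl; apply in_seq in Hl; rewrite Hz by lia; ring.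
    - replace n with (i + S (n - S i))%nat at 2 by lia. rewrite seq_app. reflexivity. }
  assert (A0 : Csum T (seq 0 M) = (d 0%nat * RtoC (INR M))%C).
  { rewrite (Csum_ext T (fun j => T j * (zeta_root M ^ j) ^ 0)%C) by (intros; simpl; ring).
    rewrite S0. apply Sel; [lia| |].
    - intros l Hl Hl0. rewrite Nat.add_0_r. apply root_mean_lt. lia.
    - apply root_mean_0. }
  assert (A1 : Csum (fun j => T j * (zeta_root M ^ j) ^ k)%C (seq 0 M) = RtoC 0).
  { rewrite S0. apply Csum_zero. intros l Hl. apply in_seq in Hl.
    rewrite root_mean_lt by lia. ring. }
  assert (A2 : Csum (fun j => T j * Cconj ((zeta_root M ^ j) ^ k))%C (seq 0 M) = (d k * RtoC (INR M))%C).
  { rewrite (Csum_ext _ (fun j => T j * (zeta_root M ^ j) ^ (M - k))%C)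
      by (intros; rewrite zeta_root_conj by lia; reflexivity).
    rewrite S0. apply Sel; [lia| |].
    - intros l Hl Hlk. destruct (Nat.lt_ge_cases l k).
      + apply root_mean_lt. lia.
      + replace (l + (M - k))%nat with ((l - k) + M)%nat by lia. rewrite root_mean_shift by lia.
        apply root_mean_lt. lia.
    - replace (k + (M - k))%nat with (0 + M)%nat by lia. rewrite root_mean_shift by lia. apply root_mean_0. }
  assert (A3 : Csum (fun j => (zeta_root M ^ j) ^ k)%C (seq 0 M) = RtoC 0) by (apply root_mean_lt; lia).
  assert (P0 : Re (d 0%nat) <= B).
  { assert (Rsum (fun j => Re (T j)) (seq 0 M) <= INR M * B).
    { rewrite <- (length_seq M 0) at 2. apply Rsum_le_const. intros j _. apply HB. }
    rewrite <- Re_Csum, A0, Cmult_comm, Re_scal in H. nra. }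
  set (b := d k).
  assert (Q : 0 <= Rsum (fun j => (B - Re (T j)) * (Cmod b + Re (b * (zeta_root M ^ j) ^ k)%C)) (seq 0 M)).
  { apply Rsum_nonneg. intros j _. apply Rmult_le_pos; [specialize (HB j); fold (T j) in HB; lra|].
    pose proof (re_le_Cmod (b * (zeta_root M ^ j) ^ k)%C) as I.
    rewrite Cmod_mult, !Cmod_pow, Cmod_zeta_root, !pow1, Rmult_1_r in I.
    apply Rabs_le_between in I. lra. }
  (* The product is expanded into terms whose means are [A0] to [A3]. For w = b z^k, the product Re
     T Re w is half of Re (T w) + Re (T conj w). *)
  rewrite (Rsum_ext _ (fun j => Cmod b * B + (- Cmod b) * Re (T j) + B * Re (b * (zeta_root M ^ j) ^ k)%C
     + ((- / 2) * Re (b * (T j * (zeta_root M ^ j) ^ k))%C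
     + (- / 2) * Re (Cconj b * (T j * Cconj ((zeta_root M ^ j) ^ k)))%C))) in Q.
  2:{ intros j _. set (y := ((zeta_root M ^ j) ^ k)%C). unfold Re, Cconj. simpl. field. }
  rewrite !Rsum_plus, Rsum_const, length_seq, !Rsum_scal, <- !Re_Csum, !Csum_scal, A0, A1, A2, A3 in Q.
  replace (Cconj b * (d k * RtoC (INR M)))%C with (RtoC (INR M * (Cmod b ^ 2))) in Q
    by (unfold b; rewrite RtoC_mult, Cmod2_conj; ring).
  rewrite (Cmult_comm (d 0%nat)), Re_scal in Q.
  replace (b * RtoC 0)%C with (RtoC 0) in Q by ring.
  simpl (Re (RtoC _)) in Q.
  assert (Q' : 0 <= Cmod b * (2 * (B - Re (d 0%nat)) - Cmod b)).
  { apply Rmult_le_reg_l with (INR M / 2); [lra|]. nra. }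
  destruct (Cmod_ge_0 b) as [L|L]; [|lra]. nra.
Qed.

(** * Real parts of power series on a disc *)

(** [u] is the uniform limit, on the closed disc, of the real parts of the partial sums of a power
    series. Recording only real parts lets log |F| be expanded without choosing a branch of the
    logarithm. *)
Definition harm_exp (u : C -> R) (c : nat -> C) (rho : R) : Prop :=
  forall eps, 0 < eps -> exists n0, forall n, (n0 <= n)%nat -> forall z, Cmod z <= rho ->
    Rabs (u z - Re (Csum (fun k => c k * z ^ k)%C (seq 0 n))) <= eps.

Lemma harm_exp_0 u c rho : 0 <= rho -> harm_exp u c rho -> u (RtoC 0) = Re (c 0%nat).
Proof.
  intros Hr H.
  assert (E : forall eps, 0 < eps -> Rabs (u (RtoC 0) - Re (c 0%nat)) <= eps).
  { intros eps He. destruct (H eps He) as [n0 Hn].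
    specialize (Hn (S n0) ltac:(lia) (RtoC 0)). rewrite Cmod_0 in Hn. specialize (Hn Hr).
    replace (Csum (fun k => c k * RtoC 0 ^ k)%C (seq 0 (S n0))) with (c 0%nat) in Hn; [exact Hn|].
    simpl. rewrite Csum_zero; [ring|]. intros k Hk. apply in_seq in Hk.
    destruct k; [lia|]. simpl. ring. }
  destruct (Req_dec (u (RtoC 0)) (Re (c 0%nat))) as [|N]; [assumption|].
  assert (P : 0 < Rabs (u (RtoC 0) - Re (c 0%nat))) by (apply Rabs_pos_lt; lra).
  specialize (E (Rabs (u (RtoC 0) - Re (c 0%nat)) / 2) ltac:(lra)). lra.
Qed.

Lemma harm_exp_minus u v c d rho : harm_exp u c rho -> harm_exp v d rho ->
  harm_exp (fun z => u z - v z) (fun k => c k - d k)%C rho.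
Proof.
  intros Hu Hv eps He.
  destruct (Hu (eps / 2) ltac:(lra)) as [n Hn]. destruct (Hv (eps / 2) ltac:(lra)) as [m Hm].
  exists (n + m)%nat. intros k Hk z Hz.
  specialize (Hn k ltac:(lia) z Hz). specialize (Hm k ltac:(lia) z Hz).
  rewrite (Csum_ext _ (fun i => c i * z ^ i - d i * z ^ i)%C) by (intros; ring).
  rewrite Csum_minus, Re_minus. apply Rabs_le_between in Hn, Hm. apply Rabs_le_between. lra.
Qed.

Lemma harm_exp_plus u v c d rho : harm_exp u c rho -> harm_exp v d rho ->
  harm_exp (fun z => u z + v z) (fun k => c k + d k)%C rho.
Proof.
  intros Hu Hv eps He.
  destruct (Hu (eps / 2) ltac:(lra)) as [n Hn]. destruct (Hv (eps / 2) ltac:(lra)) as [m Hm].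
  exists (n + m)%nat. intros k Hk z Hz.
  specialize (Hn k ltac:(lia) z Hz). specialize (Hm k ltac:(lia) z Hz).
  rewrite (Csum_ext _ (fun i => c i * z ^ i + d i * z ^ i)%C) by (intros; ring).
  rewrite Csum_plus, Re_plus. apply Rabs_le_between in Hn, Hm. apply Rabs_le_between. lra.
Qed.

Lemma harm_exp_ext u v c rho : (forall z, Cmod z <= rho -> u z = v z) ->
  harm_exp u c rho -> harm_exp v c rho.
Proof.
  intros E H eps He. destruct (H eps He) as [n0 Hn]. exists n0. intros n Hn0 z Hz.
  rewrite <- E by assumption. now apply Hn.
Qed.

Lemma harm_exp_le u c rho rho' : rho' <= rho -> harm_exp u c rho -> harm_exp u c rho'.
Proof.
  intros L H eps He. destruct (H eps He) as [n0 Hn]. exists n0. intros n Hn0 z Hz.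
  apply Hn; [assumption|lra].
Qed.

Lemma harm_exp_const r rho :
  harm_exp (fun _ => r) (fun k => match k with O => RtoC r | _ => RtoC 0 end) rho.
Proof.
  intros eps He. exists 1%nat. intros [|n] Hn z Hz; [lia|].
  match goal with |- context [Csum ?f _] => replace (Csum f (seq 0 (S n))) with (RtoC r) end.
  - simpl. rewrite Rminus_diag, Rabs_R0. lra.
  - simpl. rewrite Csum_zero; [ring|].
    intros [|k] Hk; [apply in_seq in Hk; lia|ring].
Qed.

Lemma harm_exp_Rsum {A : Type} (u : A -> C -> R) (c : A -> nat -> C) (l : list A) rho :
  (forall a, List.In a l -> harm_exp (u a) (c a) rho) ->
  harm_exp (fun z => Rsum (fun a => u a z) l) (fun k => Csum (fun a => c a k) l) rho.
Proof.
  induction l as [|a l IH]; intros H.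
  - intros eps He. exists 0%nat. intros n _ z _. simpl. rewrite Csum_zero by (intros; ring).
    simpl. rewrite Rminus_0_r, Rabs_R0. lra.
  - apply (harm_exp_plus (u a) (fun z => Rsum (fun a => u a z) l)); auto using in_eq, in_cons.
Qed.

(** A long truncation, rescaled to the unit circle, has real part at most A + eps/2 at all nodes;
    [trig_polynomial_coefficient] bounds its coefficients, and eps is arbitrary. *)
Lemma borel_caratheodory u c rho A k :
  0 <= rho -> harm_exp u c rho -> (forall z, Cmod z <= rho -> u z <= A) -> (1 <= k)%nat ->
  Cmod (c k) * rho ^ k <= 2 * (A - u (RtoC 0)).
Proof.
  intros Hr H HA Hk. rewrite (harm_exp_0 u c rho Hr H).
  apply le_epsilon. intros eps He.
  destruct (H (eps / 2) ltac:(lra)) as [n0 Hn].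
  set (n := (n0 + k + 1)%nat).
  pose proof (trig_polynomial_coefficient (fun l => c l * RtoC (rho ^ l))%C n k (A + eps / 2)) as B.
  cbv beta in B. rewrite Cmod_mult, Cmod_R, Rabs_right in B by (apply Rle_ge, pow_le; exact Hr).
  change (rho ^ 0) with 1 in B. rewrite Cmult_1_r in B.
  assert (Cmod (c k) * rho ^ k <= 2 * (A + eps / 2 - Re (c 0%nat))); [|lra].
  apply B; [lia|].
  intros j. set (w := (zeta_root (2 * n) ^ j)%C).
  assert (Hw : Cmod (RtoC rho * w) <= rho).
  { unfold w. rewrite Cmod_mult, Cmod_R, Cmod_pow, Cmod_zeta_root, pow1, Rabs_right; lra. }
  specialize (Hn n ltac:(lia) _ Hw). specialize (HA _ Hw).
  rewrite (Csum_ext _ (fun k => c k * (RtoC rho * w) ^ k)%C).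
  - apply Rabs_le_between in Hn. lra.
  - intros l _. rewrite Cpow_mult_l, RtoC_pow. ring.
Qed.

(** Borel-Caratheodory for the difference, which is at most [eps] on the disc and at least -[eps] at
    0. The conclusion is stated for the real part because of k = 0, where the expansion does not see
    the imaginary part of the coefficient. *)
Lemma harm_exp_coefficient_close u v c d rho eps k :
  0 <= rho -> harm_exp u c rho -> harm_exp v d rho ->
  (forall z, Cmod z <= rho -> Rabs (u z - v z) <= eps) ->
  Rabs (Re ((c k - d k) * RtoC (rho ^ k))%C) <= 4 * eps.
Proof.
  intros Hr Hu Hv Hd.
  pose proof (harm_exp_minus u v c d rho Hu Hv) as H.
  pose proof (Hd (RtoC 0)) as H0. rewrite Cmod_0 in H0. specialize (H0 Hr).
  destruct k as [|k].
  - change (rho ^ 0) with 1. rewrite Cmult_1_r, <- (harm_exp_0 _ _ rho Hr H).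
    pose proof (Rabs_pos (u (RtoC 0) - v (RtoC 0))). lra.
  - pose proof (borel_caratheodory _ _ rho eps (S k) Hr H) as B. cbv beta in B.
    eapply Rle_trans; [apply re_le_Cmod|].
    rewrite Cmod_mult, Cmod_R, (Rabs_right (rho ^ S k)) by (apply Rle_ge, pow_le; exact Hr).
    apply Rabs_le_between in H0.
    eapply Rle_trans; [apply B; [|lia]|lra].
    intros z Hz. specialize (Hd z Hz). apply Rabs_le_between in Hd. lra.
Qed.

Lemma geometric_tail (x : R) (a n : nat) : 0 <= x < 1 ->
  Rsum (fun k => x ^ k) (seq a n) <= x ^ a / (1 - x).
Proof.
  intros Hx.
  assert (E : Rsum (fun k => x ^ k) (seq a n) = (x ^ a - x ^ (a + n)) / (1 - x)).
  { induction n as [|n IH].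
    - simpl. rewrite Nat.add_0_r. unfold Rdiv. ring.
    - rewrite Rsum_seq_S, IH, <- plus_n_Sm. simpl. field. lra. }
  rewrite E. unfold Rdiv. apply Rmult_le_compat_r; [left; apply Rinv_0_lt_compat; lra|].
  assert (0 <= x ^ (a + n)) by (apply pow_le; lra). lra.
Qed.

Lemma pow_lim_0 (x c eps : R) : 0 <= x < 1 -> 0 <= c -> 0 < eps ->
  exists n0, forall n, (n0 <= n)%nat -> x ^ n * c <= eps.
Proof.
  intros Hx Hc He.
  destruct (pow_lt_1_zero x ltac:(rewrite Rabs_right; lra) (eps / (c + 1)) ltac:(apply Rdiv_lt_0_compat; lra)) as [n0 Hn].
  exists n0. intros n Hn0. specialize (Hn n Hn0).
  rewrite Rabs_right in Hn by (apply Rle_ge, pow_le; lra).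
  assert (x ^ n * (c + 1) <= eps).
  { apply Rmult_le_reg_r with (/ (c + 1)); [apply Rinv_0_lt_compat; lra|].
    rewrite Rmult_assoc, Rinv_r, Rmult_1_r by lra. unfold Rdiv in Hn. lra. }
  assert (0 <= x ^ n) by (apply pow_le; lra). nra.
Qed.

Lemma pow_fact_lim_0 (x c eps : R) : 0 <= x -> 0 <= c -> 0 < eps ->
  exists n0, forall n, (n0 <= n)%nat -> x ^ n / INR (fact n) * c <= eps.
Proof.
  intros Hx Hc He.
  destruct (cv_speed_pow_fact x (eps / (c + 1)) ltac:(apply Rdiv_lt_0_compat; lra)) as [n0 Hn].
  exists n0. intros n Hn0. specialize (Hn n Hn0). unfold Rdist in Hn.
  assert (P : 0 <= x ^ n / INR (fact n)).
  { apply Rdiv_le_0_compat; [apply pow_le; lra|apply lt_0_INR, lt_O_fact]. }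
  rewrite Rminus_0_r, Rabs_right in Hn by lra.
  assert (x ^ n / INR (fact n) * (c + 1) <= eps).
  { apply Rmult_le_reg_r with (/ (c + 1)); [apply Rinv_0_lt_compat; lra|].
    rewrite Rmult_assoc, Rinv_r, Rmult_1_r by lra. unfold Rdiv in *. lra. }
  nra.
Qed.

Lemma Cexp_taylor_le (b z : C) (n : nat) rho : Cmod z <= rho ->
  Cmod (Cexp (b * z) - exp_poly n (b * z)) <=
    (Cmod b * rho) ^ n / INR (fact n) * exp (Cmod b * rho).
Proof.
  intros Hz. eapply Rle_trans; [apply Cexp_taylor|]. rewrite Cmod_mult.
  pose proof (Cmod_ge_0 b). pose proof (Cmod_ge_0 z).
  assert (I : Cmod b * Cmod z <= Cmod b * rho) by nra.
  assert (0 <= Cmod b * Cmod z) by nra.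
  assert (F : 0 < / INR (fact n)) by apply Rinv_0_lt_compat, lt_0_INR, lt_O_fact.
  assert (I1 : (Cmod b * Cmod z) ^ n <= (Cmod b * rho) ^ n) by (apply pow_incr; lra).
  assert (I2 : exp (Cmod b * Cmod z) <= exp (Cmod b * rho)) by now apply exp_le_compat.
  assert (0 <= (Cmod b * Cmod z) ^ n) by (apply pow_le; lra).
  pose proof (exp_pos (Cmod b * Cmod z)).
  unfold Rdiv. apply Rmult_le_compat; try lra; nra.
Qed.

Lemma harm_exp_Cexp (a b : C) rho : 0 <= rho ->
  harm_exp (fun z => Re (a * Cexp (b * z))%C) (fun k => a * (b ^ k / RtoC (INR (fact k))))%C rho.
Proof.
  intros Hr eps He.
  destruct (pow_fact_lim_0 (Cmod b * rho) (Cmod a * exp (Cmod b * rho)) eps) as [n0 Hn];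
    [pose proof (Cmod_ge_0 b); nra|pose proof (Cmod_ge_0 a); pose proof (exp_pos (Cmod b * rho)); nra|exact He|].
  exists n0. intros n Hn0 z Hz. specialize (Hn n Hn0).
  rewrite (Csum_ext _ (fun k => a * ((b * z) ^ k / RtoC (INR (fact k))))%C).
  2:{ intros k _. rewrite Cpow_mult_l. unfold Cdiv. ring. }
  rewrite Csum_scal, <- Re_minus. fold (exp_poly n (b * z)).
  replace (a * Cexp (b * z) - a * exp_poly n (b * z))%C with (a * (Cexp (b * z) - exp_poly n (b * z)))%C by ring.
  eapply Rle_trans; [apply re_le_Cmod|]. rewrite Cmod_mult.
  eapply Rle_trans; [|exact Hn].
  eapply Rle_trans; [apply Rmult_le_compat_l; [apply Cmod_ge_0|exact (Cexp_taylor_le b z n rho Hz)]|].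
  right. ring.
Qed.

(** Write z - r = -r (1 - z/r) and expand log |1 - z/r|; the convergence is uniform since |z/r| <=
    rho/|r| < 1. *)
Lemma harm_exp_ln_linear (r : C) rho : 0 <= rho < Cmod r ->
  exists c, harm_exp (fun z => ln (Cmod (z - r))) c rho.
Proof.
  intros Hr.
  assert (Nr : r <> RtoC 0) by (intro Z; rewrite Z, Cmod_0 in Hr; lra).
  exists (fun k => (match k with O => RtoC (ln (Cmod r)) | _ => RtoC 0 end) -
     match k with O => RtoC 0 | S j => (/ r) ^ S j / RtoC (INR (S j)) end)%C.
  apply (harm_exp_ext (fun z => ln (Cmod r) - (- ln (Cmod (1 - z / r))%C))).
  { intros z Hz. assert (E : (z - r)%C = (- (r * (1 - z / r)))%C) by (field; exact Nr).
    rewrite E, Cmod_opp, Cmod_mult.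
    assert (0 < Cmod (1 - z / r)).
    { apply Cmod_gt_0. intro Z. assert (z = r).
      { transitivity (r * (1 - (1 - z / r)))%C; [field; exact Nr|]. rewrite Z. ring. }
      subst. lra. }
    rewrite ln_mult by (assumption || (apply Cmod_gt_0; assumption)). ring. }
  apply harm_exp_minus; [apply harm_exp_const|].
  intros eps He.
  set (th := rho / Cmod r).
  assert (Hth : 0 <= th < 1).
  { unfold th. split; [apply Rdiv_le_0_compat; lra|].
    apply Rmult_lt_reg_r with (Cmod r); [lra|]. unfold Rdiv. rewrite Rmult_assoc, Rinv_l by lra. lra. }
  destruct (pow_lim_0 th (/ (1 - th)) eps Hth) as [n0 Hn]; [left; apply Rinv_0_lt_compat; lra|exact He|].
  exists (S n0). intros [|n] Hn0 z Hz; [lia|].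
  specialize (Hn (S n) ltac:(lia)).
  assert (Hw : Cmod (z / r) <= th).
  { rewrite Cmod_div by exact Nr. unfold th, Rdiv. apply Rmult_le_compat_r; [left; apply Rinv_0_lt_compat|]; lra. }
  pose proof (ln_Cmod_expansion (z / r) n ltac:(lra)) as L.
  match goal with |- context [Csum ?f (seq 0 (S n))] =>
    replace (Csum f (seq 0 (S n))) with (Csum (fun k => (z / r) ^ S k / RtoC (INR (S k)))%C (seq 0 n)) end.
  - rewrite <- Rabs_Ropp. replace (- (- ln (Cmod (1 - z / r)) - _)) with
      (ln (Cmod (1 - z / r)) + Re (Csum (fun k => (z / r) ^ S k / RtoC (INR (S k)))%C (seq 0 n))) by ring.
    eapply Rle_trans; [exact L|]. eapply Rle_trans; [|exact Hn].
    pose proof (Cmod_ge_0 (z / r)).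
    apply Rmult_le_compat.
    + apply pow_le; lra.
    + left; apply Rinv_0_lt_compat; lra.
    + apply pow_incr; lra.
    + apply Rinv_le_contravar; lra.
  - change (seq 0 (S n)) with (0%nat :: seq (1 + 0) n). cbn [Csum fold_right].
    fold (Csum (fun k => (match k with O => RtoC 0 | S j => (/ r) ^ S j / RtoC (INR (S j)) end * z ^ k)%C) (seq (1 + 0) n)).
    rewrite Csum_seq_shift. rewrite Cmult_0_l, Cplus_0_l. apply Csum_ext. intros k _.
    change (1 + k)%nat with (S k). unfold Cdiv. rewrite Cpow_mult_l. ring.
Qed.

(** All roots lie outside the disc, as [P] has no zero in it; so every linear factor has an
    expansion, and their sum is one for log |P|. The induction removes one root and keeps the
    zero-freeness of the rest. *)
Lemma harm_exp_ln_polynomial (a : C) (rs : list C) rho : 0 <= rho ->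
  let P z := (a * fold_right (fun r s => (z - r) * s) (RtoC 1) rs)%C in
  (forall z, Cmod z <= rho -> P z <> RtoC 0) ->
  exists c, harm_exp (fun z => ln (Cmod (P z))) c rho.
Proof.
  intros Hr P. unfold P. clear P. induction rs as [|r rs IH]; intros H.
  - simpl. exists (fun k => match k with O => RtoC (ln (Cmod (a * 1))) | _ => RtoC 0 end).
    apply harm_exp_const.
  - simpl in H.
    assert (H1 : forall z, Cmod z <= rho -> (a * fold_right (fun r s => (z - r) * s) (RtoC 1) rs)%C <> RtoC 0).
    { intros z Hz Z. apply (H z Hz). 
      replace (a * ((z - r) * fold_right (fun r s => (z - r) * s) (RtoC 1) rs))%C with
        ((z - r) * (a * fold_right (fun r s => (z - r) * s) (RtoC 1) rs))%C by ring.
      rewrite Z. ring. }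
    destruct (IH H1) as [c Hc].
    destruct (Rle_lt_dec (Cmod r) rho) as [L|L].
    { exfalso. apply (H r L). ring. }
    destruct (harm_exp_ln_linear r rho ltac:(lra)) as [d Hd].
    exists (fun k => d k + c k)%C.
    apply (harm_exp_ext (fun z => ln (Cmod (z - r)) +
      ln (Cmod (a * fold_right (fun r s => (z - r) * s)%C (RtoC 1) rs)))).
    + intros z Hz. simpl.
      replace (a * ((z - r) * fold_right (fun r s => (z - r) * s) (RtoC 1) rs))%C with
        ((z - r) * (a * fold_right (fun r s => (z - r) * s) (RtoC 1) rs))%C by ring.
      rewrite (Cmod_mult (z - r)), ln_mult; [reflexivity| |]; apply Cmod_gt_0.
      * intro Z. assert (z = r) by (transitivity (z - r + r)%C; [ring|rewrite Z; ring]). subst. lra.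
      * now apply H1.
    + apply (harm_exp_plus (fun z => ln (Cmod (z - r)))); assumption.
Qed.

Lemma polynomial_lipschitz (b : nat -> C) (n : nat) rho : 0 <= rho ->
  exists lip, 0 <= lip /\ forall z w, Cmod z <= rho -> Cmod w <= rho ->
    Cmod (Csum (fun k => b k * z ^ k)%C (seq 0 n) - Csum (fun k => b k * w ^ k)%C (seq 0 n))
      <= lip * Cmod (z - w).
Proof.
  intros Hr.
  assert (M : forall k, exists lip, 0 <= lip /\ forall z w, Cmod z <= rho -> Cmod w <= rho ->
     Cmod (z ^ k - w ^ k) <= lip * Cmod (z - w)).
  { induction k as [|k [lip [L0 L]]].
    - exists 0. split; [lra|]. intros z w _ _. simpl. replace (1 - 1)%C with (RtoC 0) by ring. rewrite Cmod_0. lra.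
    - exists (rho * lip + rho ^ k).
      assert (0 <= rho ^ k) by (apply pow_le; lra).
      split; [nra|]. intros z w Hz Hw.
      replace (z ^ S k - w ^ S k)%C with (z * (z ^ k - w ^ k) + (z - w) * w ^ k)%C by (simpl; ring).
      eapply Rle_trans; [apply Cmod_triangle|]. rewrite !Cmod_mult, Cmod_pow.
      specialize (L z w Hz Hw). pose proof (Cmod_ge_0 z). pose proof (Cmod_ge_0 (z ^ k - w ^ k)).
      pose proof (Cmod_ge_0 (z - w)).
      assert (Cmod w ^ k <= rho ^ k) by (apply pow_incr; split; [apply Cmod_ge_0|lra]).
      assert (Cmod z * Cmod (z ^ k - w ^ k) <= rho * (lip * Cmod (z - w))) by (apply Rmult_le_compat; lra).
      nra. }
  induction n as [|n [lip [L0 L]]].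
  - exists 0. split; [lra|]. intros z w _ _. simpl. replace (0 - 0)%C with (RtoC 0) by ring. rewrite Cmod_0. lra.
  - destruct (M n) as [lip' [L0' L']]. exists (lip + Cmod (b n) * lip').
    pose proof (Cmod_ge_0 (b n)).
    split; [nra|]. intros z w Hz Hw. rewrite !Csum_seq_S. simpl (0 + n)%nat.
    match goal with |- Cmod ?x <= _ => replace x with
      ((Csum (fun k => b k * z ^ k) (seq 0 n) - Csum (fun k => b k * w ^ k) (seq 0 n)) +
       b n * (z ^ n - w ^ n))%C by ring end.
    eapply Rle_trans; [apply Cmod_triangle|]. rewrite Cmod_mult.
    specialize (L z w Hz Hw). specialize (L' z w Hz Hw). nra.
Qed.

(** * Zero-free functions approximable by polynomials *)

Definition polynomially_approximable (F : C -> C) (rho : R) : Prop :=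
  forall eps, 0 < eps -> exists (n : nat) (b : nat -> C), forall z, Cmod z <= rho ->
    Cmod (F z - Csum (fun k => b k * z ^ k)%C (seq 0 n)) <= eps.

(** Compactness in the gauge form [compactness_value_2d]. The local radius is at the same time a
    local lower bound for |F|, so the uniform radius is the constant [mu]. Points of the square
    outside the disc receive a neighbourhood that does not meet the disc. *)
Lemma disc_lower_bound (F : C -> C) rho : 0 <= rho ->
  polynomially_approximable F rho -> (forall z, Cmod z <= rho -> F z <> RtoC 0) ->
  exists mu, 0 < mu /\ forall z, Cmod z <= rho -> mu <= Cmod (F z).
Proof.
  intros Hr HF Hnz.
  assert (Loc : forall w : C, exists d : posreal, forall z, Cmod z <= rho ->
     Rabs (Re z - Re w) < d -> Rabs (Im z - Im w) < d -> d <= Cmod (F z)).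
  { intros w.
    assert (Near : forall (d : R) z, Rabs (Re z - Re w) < d -> Rabs (Im z - Im w) < d -> Cmod (z - w) < 2 * d).
    { intros d z H1 H2.
      assert (E : Cmod (z - w) * Cmod (z - w) = (Re z - Re w) * (Re z - Re w) + (Im z - Im w) * (Im z - Im w)).
      { rewrite Cmod_sqr. reflexivity. }
      pose proof (Cmod_ge_0 (z - w)). apply Rabs_def2 in H1, H2. nra. }
    destruct (Rle_lt_dec (Cmod w) rho) as [Hw|Hw].
    - assert (P : 0 < Cmod (F w)) by (apply Cmod_gt_0; auto).
      destruct (HF (Cmod (F w) / 8) ltac:(lra)) as [n [b Hb]].
      destruct (polynomial_lipschitz b n rho Hr) as [lip [L0 L]].
      assert (D : 0 < Rmin (Cmod (F w) / 8) (Cmod (F w) / (16 * (lip + 1)))).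
      { apply Rmin_glb_lt; [lra|]. apply Rdiv_lt_0_compat; lra. }
      exists (mkposreal _ D). simpl. intros z Hz H1 H2.
      pose proof (Near _ z H1 H2) as N.
      pose proof (Rmin_l (Cmod (F w) / 8) (Cmod (F w) / (16 * (lip + 1)))) as M1.
      pose proof (Rmin_r (Cmod (F w) / 8) (Cmod (F w) / (16 * (lip + 1)))) as M2.
      set (d := Rmin _ _) in *.
      assert (M3 : lip * Cmod (z - w) <= Cmod (F w) / 8).
      { apply Rle_trans with (lip * (2 * (Cmod (F w) / (16 * (lip + 1))))).
        - apply Rmult_le_compat_l; lra.
        - replace (lip * (2 * (Cmod (F w) / (16 * (lip + 1))))) with
            (Cmod (F w) / 8 * (lip / (lip + 1))) by (field; lra).
          assert (lip / (lip + 1) <= 1).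
          { apply Rmult_le_reg_r with (lip + 1); [lra|]. unfold Rdiv. rewrite Rmult_assoc, Rinv_l by lra. lra. }
          nra. }
      specialize (L z w Hz Hw). pose proof (Hb z Hz) as B1. pose proof (Hb w Hw) as B2.
      set (Pz := Csum (fun k => b k * z ^ k)%C (seq 0 n)) in *.
      set (Pw := Csum (fun k => b k * w ^ k)%C (seq 0 n)) in *.
      pose proof (Cmod_triangle (F z) (- (F z - Pz) + (- (Pz - Pw) + (F w - Pw)))) as T1.
      replace (F z + (- (F z - Pz) + (- (Pz - Pw) + (F w - Pw))))%C with (F w) in T1 by ring.
      pose proof (Cmod_triangle (- (F z - Pz)) (- (Pz - Pw) + (F w - Pw))) as T2.
      pose proof (Cmod_triangle (- (Pz - Pw)) (F w - Pw)) as T3.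
      rewrite !Cmod_opp in *. lra.
    - assert (D : 0 < (Cmod w - rho) / 2) by lra.
      exists (mkposreal _ D). simpl. intros z Hz H1 H2. exfalso.
      pose proof (Near _ z H1 H2) as N.
      pose proof (Cmod_triangle z (- (z - w))) as T. rewrite Cmod_opp in T.
      replace (z + - (z - w))%C with w in T by ring. lra. }
  set (P := fun u v (d : posreal) => forall z, Cmod z <= rho ->
     Rabs (Re z - u) < d -> Rabs (Im z - v) < d -> d <= Cmod (F z)).
  set (delta := fun u v => epsilon (inhabits (mkposreal 1 Rlt_0_1)) (P u v)).
  assert (Hdelta : forall u v, P u v (delta u v)).
  { intros u v. apply epsilon_spec. destruct (Loc (u, v)) as [d Hd]. exists d. exact Hd. }
  destruct (compactness_value_2d (- rho) rho (- rho) rho delta) as [d Hd].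
  exists d. split; [apply cond_pos|]. intros z Hz.
  (* The compactness statement is doubly negated, so the inequality is proved by contradiction. *)
  apply Rnot_lt_le. intro Hlt.
  pose proof (Rmax_Cmod z) as Mx.
  pose proof (Rmax_l (Rabs (fst z)) (Rabs (snd z))). pose proof (Rmax_r (Rabs (fst z)) (Rabs (snd z))).
  apply (Hd (fst z) (snd z)); try (apply Rabs_le_between; lra).
  intros [u [v [_ [_ [H1 [H2 H3]]]]]].
  pose proof (Hdelta u v z Hz H1 H2). lra.
Qed.

Lemma ln_dist_le (a b m : R) : 0 < m -> m <= a -> m <= b -> Rabs (ln a - ln b) <= Rabs (a - b) / m.
Proof.
  intros Hm Ha Hb.
  assert (K : forall x y, m <= x -> m <= y -> ln x - ln y <= Rabs (x - y) / m).
  { intros x y Hx Hy.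
    assert (ln (x / y) <= x / y - 1).
    { assert (0 < x / y) by (apply Rdiv_lt_0_compat; lra).
      pose proof (exp_ineq1_le (ln (x / y))) as E. rewrite exp_ln in E by assumption. lra. }
    rewrite ln_div in H by lra.
    replace (x / y - 1) with ((x - y) / y) in H by (field; lra).
    apply Rle_trans with (Rabs (x - y) / y).
    - apply Rle_trans with ((x - y) / y); [exact H|]. unfold Rdiv.
      apply Rmult_le_compat_r; [left; apply Rinv_0_lt_compat; lra|apply Rle_abs].
    - unfold Rdiv. apply Rmult_le_compat_l; [apply Rabs_pos|]. apply Rinv_le_contravar; lra. }
  apply Rabs_le. split.
  - specialize (K b a Hb Ha). rewrite Rabs_minus_sym in K. lra.
  - apply K; assumption.
Qed.

(** [V] is close to log |F| only on the small disc, which need not contain [t]. On the large disc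
    log |F| is within [eps] of log |P| for a zero-free polynomial [P]; by Borel-Caratheodory its
    terms from [K] on form a geometric tail. On the small disc [V] and log |P| are close, hence so
    are their first [K] coefficients. Moving these to [t] costs factors (t/rho1)^k, which is
    harmless as long as [eps] is chosen after [K]. *)
Lemma ln_modulus_truncation (F : C -> C) (V : C -> R) (e : nat -> C) (rho rho1 B t eps : R) (K : nat) :
  0 < rho1 <= rho -> 0 <= t < rho -> 0 < eps -> (1 <= K)%nat ->
  polynomially_approximable F rho ->
  (forall z, Cmod z <= rho -> F z <> RtoC 0) ->
  (forall z, Cmod z <= rho -> Cmod (F z) <= B) ->
  harm_exp V e rho1 ->
  (forall z, Cmod z <= rho1 -> Rabs (V z - ln (Cmod (F z))) <= eps) ->
  Rabs (ln (Cmod (F (RtoC t))) - Re (Csum (fun k => e k * RtoC t ^ k)%C (seq 0 K))) <=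
    2 * (ln B - ln (Cmod (F (RtoC 0))) + 2 * eps) * ((t / rho) ^ K / (1 - t / rho)) + 2 * eps
    + 8 * eps * Rsum (fun k => (t / rho1) ^ k) (seq 0 K).
Proof.
  intros Hrho Ht He HK Happ Hnz HB HV Hclose.
  destruct (disc_lower_bound F rho ltac:(lra) Happ Hnz) as [mu [Hmu Hmin]].
  (* The first bound keeps |P| above mu/2 on the disc; the second then brings log |P| within [eps]
     of log |F|. *)
  assert (Hme : 0 < Rmin (mu / 2) (mu * eps / 2)) by (apply Rmin_glb_lt; nra).
  destruct (Happ _ Hme) as [n [b Hb]].
  destruct (Factorization.complex_factorization b n) as [a [rs Hfac]].
  set (P := fun z : C => (a * fold_right (fun r s => (z - r) * s) (RtoC 1) rs)%C).
  assert (HP : forall z, Cmod z <= rho -> Cmod (F z - P z) <= Rmin (mu / 2) (mu * eps / 2)).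
  { intros z Hz. specialize (Hb z Hz). unfold P. rewrite <- Hfac. exact Hb. }
  assert (Hlow : forall z, Cmod z <= rho -> mu / 2 <= Cmod (P z)).
  { intros z Hz. specialize (HP z Hz). specialize (Hmin z Hz).
    pose proof (Rmin_l (mu / 2) (mu * eps / 2)).
    pose proof (Cmod_triangle (P z) (F z - P z)) as T. replace (P z + (F z - P z))%C with (F z) in T by ring. lra. }
  set (u := fun z => ln (Cmod (P z))).
  assert (Hu : forall z, Cmod z <= rho -> Rabs (u z - ln (Cmod (F z))) <= eps).
  { intros z Hz. unfold u.
    eapply Rle_trans; [apply (ln_dist_le _ _ (mu / 2)); [lra|auto|specialize (Hmin z Hz); lra]|].
    specialize (HP z Hz). pose proof (Rmin_r (mu / 2) (mu * eps / 2)).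
    assert (I : Rabs (Cmod (P z) - Cmod (F z)) <= Cmod (F z - P z)).
    { pose proof (Cmod_triangle (P z) (F z - P z)) as T1. replace (P z + (F z - P z))%C with (F z) in T1 by ring.
      pose proof (Cmod_triangle (F z) (- (F z - P z))) as T2. replace (F z + - (F z - P z))%C with (P z) in T2 by ring.
      rewrite Cmod_opp in T2. apply Rabs_le. lra. }
    apply Rmult_le_reg_r with (mu / 2); [lra|]. unfold Rdiv at 1. rewrite Rmult_assoc, Rinv_l by lra. lra. }
  destruct (harm_exp_ln_polynomial a rs rho ltac:(lra)) as [c Hc].
  { intros z Hz Z. specialize (Hlow z Hz). unfold P in Hlow. rewrite Z, Cmod_0 in Hlow. lra. }
  fold P in Hc. change (harm_exp u c rho) in Hc.
  assert (Z0 : Cmod (RtoC 0) <= rho) by (rewrite Cmod_0; lra).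
  set (D := ln B - ln (Cmod (F (RtoC 0))) + 2 * eps).
  assert (HBC : forall k, (1 <= k)%nat -> Cmod (c k) * rho ^ k <= 2 * D).
  { intros k Hk. eapply Rle_trans; [apply (borel_caratheodory u c rho (ln B + eps)); auto; [lra|]|].
    - intros z Hz. specialize (Hu z Hz). apply Rabs_le_between in Hu.
      assert (ln (Cmod (F z)) <= ln B).
      { specialize (Hmin z Hz). specialize (HB z Hz).
        destruct HB as [HB|HB]; [left; apply ln_increasing; lra|rewrite HB; lra]. }
      lra.
    - specialize (Hu (RtoC 0) Z0). apply Rabs_le_between in Hu. unfold D. lra. }
  assert (HD : 0 <= D).
  { specialize (HBC 1%nat ltac:(lia)). pose proof (Cmod_ge_0 (c 1%nat)). simpl in HBC. nra. }
  set (x := t / rho).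
  assert (Hx : 0 <= x < 1).
  { unfold x. split; [apply Rdiv_le_0_compat; lra|].
    apply Rmult_lt_reg_r with rho; [lra|]. unfold Rdiv. rewrite Rmult_assoc, Rinv_l; lra. }
  assert (Ht' : Cmod (RtoC t) <= rho) by (rewrite Cmod_R, Rabs_right; lra).
  assert (Htail : Rabs (u (RtoC t) - Re (Csum (fun k => c k * RtoC t ^ k)%C (seq 0 K))) <= 2 * D * (x ^ K / (1 - x))).
  { apply le_epsilon. intros eta Heta. destruct (Hc eta Heta) as [n0 Hn0].
    specialize (Hn0 (K + n0)%nat ltac:(lia) (RtoC t) Ht').
    rewrite seq_app, Csum_app, Re_plus in Hn0. simpl (0 + K)%nat in Hn0.
    assert (T : Rabs (Re (Csum (fun k => c k * RtoC t ^ k)%C (seq K n0))) <= 2 * D * (x ^ K / (1 - x))).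
    { eapply Rle_trans; [apply re_le_Cmod|]. eapply Rle_trans; [apply Cmod_Csum|].
      apply Rle_trans with (Rsum (fun k => 2 * D * x ^ k) (seq K n0)).
      - apply Rsum_le. intros k Hk. apply in_seq in Hk.
        rewrite Cmod_mult, Cmod_pow, Cmod_R, (Rabs_right t) by lra.
        specialize (HBC k ltac:(lia)).
        replace (t ^ k) with (rho ^ k * x ^ k).
        + assert (0 <= x ^ k) by (apply pow_le; lra). nra.
        + rewrite <- Rpow_mult_distr. f_equal. unfold x. field. lra.
      - rewrite Rsum_scal. apply Rmult_le_compat_l; [lra|]. apply geometric_tail. exact Hx. }
    apply Rabs_le_between in Hn0, T. apply Rabs_le. lra. }
  (* On the small disc [u] and [V] are both within [eps] of log |F|, so at distance 2 eps; the
     coefficient lemma multiplies this by 4. *)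
  assert (Hcoef : Rabs (Re (Csum (fun k => c k * RtoC t ^ k)%C (seq 0 K)) - Re (Csum (fun k => e k * RtoC t ^ k)%C (seq 0 K)))
     <= 8 * eps * Rsum (fun k => (t / rho1) ^ k) (seq 0 K)).
  { rewrite <- Re_minus, <- Csum_minus, Re_Csum, <- Rsum_scal.
    assert (Q : forall k, Rabs (Re (c k * RtoC t ^ k - e k * RtoC t ^ k)%C) <= 8 * eps * (t / rho1) ^ k).
    { intros k.
      pose proof (harm_exp_coefficient_close u V c e rho1 (2 * eps) k ltac:(lra)
        (harm_exp_le u c rho rho1 ltac:(lra) Hc) HV) as I.
      replace (c k * RtoC t ^ k - e k * RtoC t ^ k)%C with
        (RtoC ((t / rho1) ^ k) * ((c k - e k) * RtoC (rho1 ^ k)))%C.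
      - assert (Pk : 0 <= (t / rho1) ^ k) by (apply pow_le, Rdiv_le_0_compat; lra).
        rewrite Re_scal, Rabs_mult, (Rabs_right ((t / rho1) ^ k)) by lra.
        rewrite (Rmult_comm (8 * eps)). apply Rmult_le_compat_l; [exact Pk|].
        eapply Rle_trans; [apply I|lra].
        intros z Hz. specialize (Hu z ltac:(lra)). specialize (Hclose z Hz).
        apply Rabs_le_between in Hu, Hclose. apply Rabs_le. lra.
      - replace (RtoC t ^ k)%C with (RtoC ((t / rho1) ^ k) * RtoC (rho1 ^ k))%C; [ring|].
        rewrite <- RtoC_mult, <- Rpow_mult_distr, <- RtoC_pow. f_equal. f_equal. field. lra. }
    clear Htail. induction (seq 0 K) as [|k l IH]; cbn [Rsum fold_right]; [rewrite Rabs_R0; lra|].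
    eapply Rle_trans; [apply Rabs_triang|]. apply Rplus_le_compat; [apply Q|exact IH]. }
  specialize (Hu (RtoC t) Ht'). fold D x.
  apply Rabs_le_between in Hu, Htail, Hcoef. apply Rabs_le. lra.
Qed.

(** * Dirichlet series of characters *)

Definition npow (n : nat) (s : C) : C := Cexp (- (s * RtoC (ln (INR n)))).

Definition dsum (chi : nat -> C) (s : C) (m n : nat) : C :=
  Csum (fun k => chi k * npow k s)%C (seq m n).

Lemma dirichlet_term_sum chi s n :
  sum_n (dirichlet_term chi s) n = dsum chi s 1 (S n).
Proof.
  induction n as [|n IH].
  - rewrite sum_O. unfold dsum, dirichlet_term, npow. cbn [seq Csum fold_right].
    rewrite Cplus_0_r. reflexivity.
  - rewrite sum_Sn, IH. unfold dsum. rewrite (Csum_seq_S _ 1 (S n)). reflexivity.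
Qed.

Lemma dirichlet_term_sum_range chi s n k :
  sum_n_m (dirichlet_term chi s) n (n + k) = dsum chi s (S n) (S k).
Proof.
  induction k as [|k IH].
  - rewrite Nat.add_0_r, sum_n_n. unfold dsum, dirichlet_term, npow. cbn [seq Csum fold_right].
    rewrite Cplus_0_r. reflexivity.
  - rewrite <- plus_n_Sm, sum_n_Sm by lia. rewrite IH. unfold dsum. rewrite (Csum_seq_S _ (S n) (S k)).
    replace (S n + S k)%nat with (S (S (n + k))) by lia. reflexivity.
Qed.

Lemma is_dirichlet_series_cvg chi s l : is_dirichlet_series chi s l ->
  forall eps, 0 < eps -> exists N, forall n, (N <= n)%nat -> Cmod (dsum chi s 1 n - l) <= eps.
Proof.
  intros H eps He.
  pose proof (proj1 (filterlim_locally_ball_norm (K := C_AbsRing) (U := C_NormedModule) _ _) H (mkposreal eps He)) as [N HN].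
  exists (S N). intros [|n] Hn; [lia|]. specialize (HN n ltac:(lia)).
  rewrite dirichlet_term_sum in HN. left. exact HN.
Qed.

Lemma cvg_is_dirichlet_series chi s l :
  (forall eps, 0 < eps -> exists N, forall n, (N <= n)%nat -> Cmod (dsum chi s 1 n - l) <= eps) ->
  is_dirichlet_series chi s l.
Proof.
  intros H.
  apply (proj2 (filterlim_locally_ball_norm (K := C_AbsRing) (U := C_NormedModule) _ _)).
  intros eps. destruct (H (eps / 2)) as [N HN]; [destruct eps; simpl; lra|].
  exists N. intros n Hn. specialize (HN (S n) ltac:(lia)).
  rewrite <- dirichlet_term_sum in HN. apply Rle_lt_trans with (eps / 2); [exact HN|].
  destruct eps; simpl; lra.
Qed.

Lemma dsum_app chi s m n k : dsum chi s m (n + k) = (dsum chi s m n + dsum chi s (m + n) k)%C.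
Proof. unfold dsum. rewrite seq_app, Csum_app. reflexivity. Qed.

(** [tau] need not be monotone: one N with small [tau N] is enough, since any block beyond N is a
    difference of two sums starting at [S N]. *)
Lemma dirichlet_series_tail chi s (tau : nat -> R) :
  (forall N n, Cmod (dsum chi s (S N) n) <= tau N) ->
  (forall eps, 0 < eps -> exists N, tau N <= eps) ->
  exists l, is_dirichlet_series chi s l.
Proof.
  intros Ht H0.
  assert (X : ex_series (K := C_AbsRing) (V := C_NormedModule) (dirichlet_term chi s)).
  { apply (ex_series_Cauchy (K := C_AbsRing) (V := C_CompleteNormedModule)).
    intros eps. destruct (H0 (eps / 4)) as [N HN]; [destruct eps; simpl; lra|].
    exists N. intros n m Hn Hm.
    destruct (Nat.le_gt_cases n m) as [L|L].
    - replace m with (n + (m - n))%nat by lia.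
      change (Cmod (sum_n_m (dirichlet_term chi s) n (n + (m - n))) < eps).
      rewrite dirichlet_term_sum_range.
      assert (E : dsum chi s (S n) (S (m - n)) = (dsum chi s (S N) (n - N + S (m - n)) - dsum chi s (S N) (n - N))%C).
      { rewrite dsum_app. replace (S N + (n - N))%nat with (S n) by lia. ring. }
      rewrite E. eapply Rle_lt_trans; [apply Cmod_triangle|]. rewrite Cmod_opp.
      pose proof (Ht N (n - N + S (m - n))%nat). pose proof (Ht N (n - N)%nat).
      destruct eps as [e He]; simpl in *; lra.
    - rewrite sum_n_m_zero by lia. rewrite norm_zero. apply cond_pos. }
  exact X.
Qed.

Lemma dirichlet_series_tail_le chi s l (N : nat) (tau : R) :
  is_dirichlet_series chi s l ->
  (forall n, Cmod (dsum chi s (S N) n) <= tau) -> Cmod (l - dsum chi s 1 N) <= tau.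
Proof.
  intros H Ht. apply le_epsilon. intros eps He.
  destruct (is_dirichlet_series_cvg chi s l H eps He) as [M HM].
  specialize (HM (N + M)%nat ltac:(lia)). rewrite dsum_app in HM. simpl (1 + N)%nat in HM.
  replace (l - dsum chi s 1 N)%C with
    (- (dsum chi s 1 N + dsum chi s (S N) M - l) + dsum chi s (S N) M)%C by ring.
  eapply Rle_trans; [apply Cmod_triangle|]. rewrite Cmod_opp. specialize (Ht M). lra.
Qed.

Lemma Cmod_npow n s : Cmod (npow n s) = exp (- Re s * ln (INR n)).
Proof. unfold npow. rewrite Cmod_Cexp. f_equal. unfold Re. simpl. ring. Qed.

Lemma npow_1 s : npow 1 s = RtoC 1.
Proof. unfold npow. simpl INR. rewrite ln_1, <- Cexp_0. f_equal. ring. Qed.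

Lemma npow_mult m n s : (0 < m)%nat -> (0 < n)%nat -> npow (m * n) s = (npow m s * npow n s)%C.
Proof.
  intros Hm Hn. unfold npow. rewrite <- Cexp_add. f_equal.
  rewrite mult_INR, ln_mult by (apply lt_0_INR; assumption). rewrite RtoC_plus. ring.
Qed.

(** In the variable x = log n, the derivative of exp(-s x) has modulus |s| exp(-Re s x), which is
    the derivative of -(|s|/Re s) exp(-Re s x). The bound is a difference of consecutive terms, so
    it telescopes in [dsum_bound]. *)
Lemma npow_step n s : (0 < n)%nat -> 0 < Re s ->
  Cmod (npow n s - npow (S n) s) <=
    Cmod s / Re s * (exp (- Re s * ln (INR n)) - exp (- Re s * ln (INR (S n)))).
Proof.
  intros Hn Hs.
  assert (Pn : 0 < INR n) by (apply lt_0_INR; assumption).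
  assert (L : ln (INR n) <= ln (INR (S n))) by (left; apply ln_increasing; [|apply lt_INR]; auto).
  assert (E : forall k, npow k s = Cexp (RtoC (ln (INR k)) * (- s))).
  { intros k. unfold npow. f_equal. ring. }
  rewrite (E n), (E (S n)), <- Cmod_opp, Copp_minus_distr.
  replace (Cmod s / Re s * (exp (- Re s * ln (INR n)) - exp (- Re s * ln (INR (S n))))) with
    (- (Cmod s / Re s) * exp (- Re s * ln (INR (S n))) - - (Cmod s / Re s) * exp (- Re s * ln (INR n))) by ring.
  apply (increment_le (fun x => Cexp (RtoC x * (- s))) (fun x => - s * Cexp (RtoC x * (- s)))%C
    (fun x => - (Cmod s / Re s) * exp (- Re s * x)) (fun x => Cmod s * exp (- Re s * x))); [exact L| | | |].
  - intros x _. apply (is_derive_Cexp (- s)%C x).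
  - intros x _. apply (is_derive_Cexp (- s)%C x).
  - intros x _. generalize (Cmod s). intros c. revert Hs. generalize (Re s). intros r Hr.
    auto_derive; [trivial|]. field. lra.
  - intros x _. rewrite Cmod_mult, Cmod_opp, Cmod_Cexp. right. f_equal. f_equal. unfold Re. simpl. ring.
Qed.

Lemma Rsum_seq_from (f : nat -> R) m n :
  Rsum f (seq m n) = Rsum (fun k => f (m + k)%nat) (seq 0 n).
Proof.
  induction n as [|n IH]; [reflexivity|].
  rewrite !Rsum_seq_S, IH. reflexivity.
Qed.

Lemma abel_summation (a g : nat -> C) (m n : nat) (B : R) :
  (forall j, Cmod (Csum a (seq m j)) <= B) ->
  Cmod (Csum (fun k => a k * g k)%C (seq m n)) <=
    B * (Rsum (fun k => Cmod (g k - g (S k))) (seq m n) + Cmod (g (m + n)%nat)).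
Proof.
  intros HB.
  assert (E : Csum (fun k => a k * g k)%C (seq m n) =
    (Csum a (seq m n) * g (m + n)%nat +
     Csum (fun j => Csum a (seq m (S j)) * (g (m + j)%nat - g (S (m + j))))%C (seq 0 n))%C).
  { induction n as [|n IH]; [simpl; ring|].
    rewrite Csum_seq_S, IH, (Csum_seq_S _ 0 n), (Csum_seq_S a m n), <- plus_n_Sm.
    simpl (0 + n)%nat. rewrite (Csum_seq_S a m n). ring. }
  rewrite E. eapply Rle_trans; [apply Cmod_triangle|]. rewrite Cmod_mult.
  assert (P : Cmod (Csum (fun j => Csum a (seq m (S j)) * (g (m + j)%nat - g (S (m + j))))%C (seq 0 n)) <=
     B * Rsum (fun k => Cmod (g k - g (S k))) (seq m n)).
  { eapply Rle_trans; [apply Cmod_Csum|]. rewrite <- Rsum_scal.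
    rewrite (Rsum_seq_from _ m).
    apply Rsum_le. intros j _. rewrite Cmod_mult.
    apply Rmult_le_compat_r; [apply Cmod_ge_0|apply HB]. }
  pose proof (Rmult_le_compat_r _ _ _ (Cmod_ge_0 (g (m + n)%nat)) (HB n)). lra.
Qed.

Lemma dsum_bound chi s m n B : (0 < m)%nat -> 0 < Re s ->
  (forall j, Cmod (Csum chi (seq m j)) <= B) ->
  Cmod (dsum chi s m n) <= B * (Cmod s / Re s + 1) * exp (- Re s * ln (INR m)).
Proof.
  intros Hm Hs HB.
  assert (B0 : 0 <= B) by (eapply Rle_trans; [apply Cmod_ge_0|apply (HB 0%nat)]).
  assert (C0 : 0 <= Cmod s / Re s) by (apply Rdiv_le_0_compat; [apply Cmod_ge_0|lra]).
  unfold dsum. eapply Rle_trans; [apply abel_summation; exact HB|].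
  rewrite Rmult_assoc. apply Rmult_le_compat_l; [exact B0|].
  rewrite Cmod_npow.
  assert (S : Rsum (fun k => Cmod (npow k s - npow (S k) s)) (seq m n) <=
     Cmod s / Re s * (exp (- Re s * ln (INR m)) - exp (- Re s * ln (INR (m + n))))).
  { rewrite <- (Rsum_telescope (fun k => exp (- Re s * ln (INR k)))), <- Rsum_scal.
    apply Rsum_le. intros k Hk. apply in_seq in Hk. apply npow_step; [lia|exact Hs]. }
  assert (D : exp (- Re s * ln (INR (m + n))) <= exp (- Re s * ln (INR m))).
  { assert (L : ln (INR m) <= ln (INR (m + n))).
    { apply ln_le; [apply lt_0_INR; lia|apply le_INR; lia]. }
    apply exp_le_compat. nra. }
  pose proof (exp_pos (- Re s * ln (INR (m + n)))). nra.
Qed.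

(** * Dirichlet characters modulo q *)

Lemma char_add_mul q chi n k : dirichlet_character q chi -> chi (n + k * q)%nat = chi n.
Proof.
  intros [Hp _]. induction k as [|k IH].
  - f_equal. lia.
  - rewrite <- IH, <- (Hp (n + k * q)%nat). f_equal. lia.
Qed.

Lemma char_mod q chi n : (0 < q)%nat -> dirichlet_character q chi -> chi (n mod q)%nat = chi n.
Proof.
  intros Hq H. rewrite (Nat.div_mod n q) at 2 by lia.
  rewrite Nat.add_comm, Nat.mul_comm. symmetry. now apply char_add_mul.
Qed.

Lemma char_1 q chi : dirichlet_character q chi -> chi 1%nat = RtoC 1.
Proof.
  intros [_ [Hm Hu]].
  assert (N : chi 1%nat <> RtoC 0) by (apply Hu, Nat.divide_1_r, Nat.gcd_divide_l).
  pose proof (Hm 1%nat 1%nat) as E. simpl in E.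
  rewrite <- (Cmult_1_r (chi 1%nat)), <- (Cinv_r (chi 1%nat)) at 1 by exact N.
  rewrite Cmult_assoc, <- E. apply Cinv_r. exact N.
Qed.

Lemma char_nonunit q chi n : dirichlet_character q chi -> Nat.gcd n q <> 1%nat -> chi n = RtoC 0.
Proof.
  intros [_ [_ Hu]] Hn. apply NNPP. intro N. apply Hn, Hu, N.
Qed.

Lemma char_pow q chi n k : dirichlet_character q chi -> chi (n ^ k)%nat = (chi n ^ k)%C.
Proof.
  intros H. induction k as [|k IH]; [exact (char_1 q chi H)|].
  destruct H as [_ [Hm _]]. simpl. rewrite Hm, IH. reflexivity.
Qed.

Lemma unit_inverse q n : (2 <= q)%nat -> Nat.gcd n q = 1%nat ->
  exists n', Nat.gcd n' q = 1%nat /\ forall chi, dirichlet_character q chi -> (chi n' * chi n)%C = RtoC 1.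
Proof.
  intros Hq Hn.
  assert (0 < n)%nat by (destruct n; [rewrite Nat.gcd_0_l in Hn; lia|lia]).
  destruct (Nat.gcd_bezout_pos n q ltac:(lia)) as [a [c E]]. rewrite Hn in E.
  exists a. split.
  - apply Nat.bezout_1_gcd. exists n, c. lia.
  - intros chi H1. pose proof H1 as [_ [Hm _]]. rewrite <- Hm, E, char_add_mul by assumption.
    exact (char_1 q chi H1).
Qed.

Lemma char_bounded q chi : (0 < q)%nat -> dirichlet_character q chi ->
  exists B, forall n, Cmod (chi n) <= B.
Proof.
  intros Hq H. exists (Rsum (fun k => Cmod (chi k)) (seq 0 q)). intros n.
  rewrite <- (char_mod q chi n Hq H).
  assert (I : List.In (n mod q)%nat (seq 0 q)) by (apply in_seq; pose proof (Nat.mod_upper_bound n q); lia).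
  induction (seq 0 q) as [|k l IH]; [contradiction|]. simpl.
  pose proof (Rsum_nonneg (fun k => Cmod (chi k)) l (fun k _ => Cmod_ge_0 (chi k))).
  destruct I as [<-|I]; [lra|]. specialize (IH I). pose proof (Cmod_ge_0 (chi k)). lra.
Qed.

(** All powers of chi(n) are again values of chi, and these are bounded by periodicity. *)
Lemma char_Cmod_le_1 q chi n : (0 < q)%nat -> dirichlet_character q chi -> Cmod (chi n) <= 1.
Proof.
  intros Hq H. apply Rnot_lt_le. intro L.
  destruct (char_bounded q chi Hq H) as [B HB].
  destruct (Pow_x_infinity (Cmod (chi n)) ltac:(rewrite Rabs_right; lra) (B + 1)) as [N HN].
  specialize (HN N ltac:(lia)). specialize (HB (n ^ N)%nat).
  rewrite (char_pow q), Cmod_pow in HB by assumption.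
  rewrite Rabs_right in HN by (apply Rle_ge, pow_le; lra). lra.
Qed.

Lemma char_Cmod_1 q chi n : (2 <= q)%nat -> dirichlet_character q chi -> Nat.gcd n q = 1%nat ->
  Cmod (chi n) = 1.
Proof.
  intros Hq H Hn. destruct (unit_inverse q n Hq Hn) as [n' [_ E]].
  specialize (E chi H). apply (f_equal Cmod) in E. rewrite Cmod_mult, Cmod_1 in E.
  pose proof (char_Cmod_le_1 q chi n ltac:(lia) H). pose proof (char_Cmod_le_1 q chi n' ltac:(lia) H).
  pose proof (Cmod_ge_0 (chi n)). pose proof (Cmod_ge_0 (chi n')). nra.
Qed.

(** One n' serves all characters at once; hence the conjugate of an evaluation is again an
    evaluation, which [pos_conj] uses. *)
Lemma char_conj q n : (2 <= q)%nat ->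
  exists n', forall chi, dirichlet_character q chi -> Cconj (chi n) = chi n'.
Proof.
  intros Hq. destruct (Nat.eq_dec (Nat.gcd n q) 1) as [Hn|Hn].
  - destruct (unit_inverse q n Hq Hn) as [n' [_ E]]. exists n'. intros chi H.
    specialize (E chi H). pose proof (char_Cmod_1 q chi n Hq H Hn) as M.
    assert (E' : (chi n * Cconj (chi n))%C = RtoC 1) by (rewrite <- Cmod2_conj, M; f_equal; ring).
    rewrite <- (Cmult_1_l (Cconj (chi n))), <- E, <- Cmult_assoc, E'. ring.
  - exists n. intros chi H. rewrite (char_nonunit q chi n H Hn). apply injective_projections; simpl; ring.
Qed.

Lemma gcd_mul_1 m n q : Nat.gcd m q = 1%nat -> Nat.gcd n q = 1%nat -> Nat.gcd (m * n) q = 1%nat.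
Proof.
  intros Hm Hn. set (g := Nat.gcd (m * n) q).
  assert (Hgq : Nat.divide g q) by apply Nat.gcd_divide_r.
  assert (Hgm : Nat.gcd g m = 1%nat).
  { apply Nat.divide_1_r. rewrite <- Hm. apply Nat.gcd_greatest; [apply Nat.gcd_divide_r|].
    eapply Nat.divide_trans; [apply Nat.gcd_divide_l|exact Hgq]. }
  apply Nat.divide_1_r. rewrite <- Hn. apply Nat.gcd_greatest; [|exact Hgq].
  apply (Nat.gauss g m n); [apply Nat.gcd_divide_l|exact Hgm].
Qed.

Lemma principal_is_character q : dirichlet_character q (principal_character q).
Proof.
  split; [|split].
  - intros n. unfold principal_character. rewrite <- (Nat.mul_1_l q) at 1.
    rewrite Nat.gcd_comm, Nat.gcd_add_mult_diag_r, Nat.gcd_comm. reflexivity.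
  - intros m n. unfold principal_character.
    destruct (Nat.eqb_spec (Nat.gcd m q) 1) as [Hm|Hm], (Nat.eqb_spec (Nat.gcd n q) 1) as [Hn|Hn];
      destruct (Nat.eqb_spec (Nat.gcd (m * n) q) 1) as [Hmn|Hmn]; try ring; exfalso.
    + apply Hmn. now apply gcd_mul_1.
    + apply Hn. apply Nat.divide_1_r. rewrite <- Hmn. apply Nat.gcd_greatest.
      * apply Nat.divide_mul_r, Nat.gcd_divide_l.
      * apply Nat.gcd_divide_r.
    + apply Hm. apply Nat.divide_1_r. rewrite <- Hmn. apply Nat.gcd_greatest.
      * apply Nat.divide_mul_l, Nat.gcd_divide_l.
      * apply Nat.gcd_divide_r.
    + apply Hm. apply Nat.divide_1_r. rewrite <- Hmn. apply Nat.gcd_greatest.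
      * apply Nat.divide_mul_l, Nat.gcd_divide_l.
      * apply Nat.gcd_divide_r.
  - intros n. unfold principal_character. destruct (Nat.eqb_spec (Nat.gcd n q) 1); split; try tauto.
    intros _ E. apply RtoC_inj in E. lra.
Qed.

Lemma character_mul_is_character q chi psi :
  dirichlet_character q chi -> dirichlet_character q psi -> dirichlet_character q (character_mul chi psi).
Proof.
  intros [P1 [M1 U1]] [P2 [M2 U2]]. unfold character_mul. split; [|split].
  - intros n. rewrite P1, P2. reflexivity.
  - intros m n. rewrite M1, M2. ring.
  - intros n. split.
    + intros H. apply U1. intro Z. apply H. rewrite Z. ring.
    + intros H. apply Cmult_neq_0; [apply U1|apply U2]; assumption.
Qed.

Lemma character_mul_principal_l q chi : dirichlet_character q chi ->
  character_mul (principal_character q) chi = chi.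
Proof.
  intros H. apply functional_extensionality. intros n. unfold character_mul, principal_character.
  destruct (Nat.eqb_spec (Nat.gcd n q) 1); [ring|]. rewrite (char_nonunit q chi n) by assumption. ring.
Qed.

Lemma nonprincipal_value q chi : dirichlet_character q chi -> chi <> principal_character q ->
  exists n, Nat.gcd n q = 1%nat /\ chi n <> RtoC 1.
Proof.
  intros H Hne. apply NNPP. intro N. apply Hne.
  apply functional_extensionality. intros n. unfold principal_character.
  destruct (Nat.eqb_spec (Nat.gcd n q) 1) as [Hn|Hn].
  - apply NNPP. intro E. apply N. exists n. auto.
  - now apply (char_nonunit q).
Qed.

Lemma residues_mul_permutation q n : (2 <= q)%nat -> Nat.gcd n q = 1%nat ->
  Permutation (map (fun a => (n * a) mod q)%nat (seq 0 q)) (seq 0 q).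
Proof.
  intros Hq Hn.
  apply NoDup_Permutation_bis.
  - apply FinFun.Injective_map_NoDup_in; [|apply seq_NoDup].
    intros a b Ha Hb E. apply in_seq in Ha, Hb.
    assert (G : forall x y, (x <= y < q)%nat -> ((n * x) mod q = (n * y) mod q)%nat -> x = y).
    { intros x y Hxy Exy.
      assert (D : Nat.divide q (n * (y - x))).
      { rewrite Nat.mul_sub_distr_l.
        exists ((n * y) / q - (n * x) / q)%nat.
        pose proof (Nat.div_mod (n * x) q ltac:(lia)). pose proof (Nat.div_mod (n * y) q ltac:(lia)).
        rewrite Nat.mul_sub_distr_r. nia. }
      apply Nat.gauss in D; [|rewrite Nat.gcd_comm; exact Hn].
      destruct D as [k Hk]. destruct k; [lia|]. exfalso. nia. }
    destruct (Nat.le_ge_cases a b); [apply G|symmetry; apply G]; auto; lia.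
  - rewrite length_map. lia.
  - intros x Hx. apply in_map_iff in Hx as [a [<- _]]. apply in_seq.
    pose proof (Nat.mod_upper_bound (n * a) q). lia.
Qed.

Lemma char_sum_zero q chi : (2 <= q)%nat -> dirichlet_character q chi -> chi <> principal_character q ->
  Csum chi (seq 0 q) = RtoC 0.
Proof.
  intros Hq H Hne. destruct (nonprincipal_value q chi H Hne) as [n [Hn Hc]].
  assert (E : Csum chi (seq 0 q) = (chi n * Csum chi (seq 0 q))%C).
  { rewrite <- (Csum_perm _ _ _ (residues_mul_permutation q n Hq Hn)) at 1.
    rewrite Csum_map, <- Csum_scal. apply Csum_ext. intros a _.
    rewrite char_mod by (lia || assumption). apply H. }
  assert (Z : ((chi n - 1) * Csum chi (seq 0 q))%C = RtoC 0) by (transitivity (chi n * Csum chi (seq 0 q) - Csum chi (seq 0 q))%C; [ring|rewrite <- E; ring]).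
  apply Cmod_eq_0. apply (f_equal Cmod) in Z. rewrite Cmod_mult, Cmod_0 in Z.
  apply Rmult_integral in Z as [Z|Z]; [|exact Z]. exfalso. apply Hc.
  apply Cmod_eq_0 in Z. rewrite <- (Cplus_0_r 1), <- Z. ring.
Qed.

Lemma char_sum_period q chi m : (2 <= q)%nat -> dirichlet_character q chi ->
  Csum chi (seq m q) = Csum chi (seq 0 q).
Proof.
  intros Hq H. induction m as [|m IH]; [reflexivity|]. rewrite <- IH.
  destruct q as [|q']; [lia|].
  rewrite Csum_seq_S. change (seq m (S q')) with (m :: seq (S m) q'). cbn [Csum fold_right].
  fold (Csum chi (seq (S m) q')).
  replace (S m + q')%nat with (m + S q')%nat by lia. destruct H as [Hp _]. rewrite Hp. ring.
Qed.

(** Whole periods cancel, and fewer than [q] terms remain. This trivial bound is enough because it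
    enters only through log q or through limits taken for fixed [q]. *)
Lemma char_partial_sum q chi m n : (2 <= q)%nat -> dirichlet_character q chi -> chi <> principal_character q ->
  Cmod (Csum chi (seq m n)) <= INR q.
Proof.
  intros Hq H Hne.
  assert (E : forall k r, Csum chi (seq m (k * q + r)) = Csum chi (seq (m + k * q) r)).
  { induction k as [|k IH]; intros r; [simpl; f_equal; f_equal; lia|].
    replace (S k * q + r)%nat with (k * q + (q + r))%nat by lia. rewrite IH, seq_app, Csum_app.
    rewrite char_sum_period, char_sum_zero, Cplus_0_l by assumption. f_equal. f_equal. lia. }
  rewrite (Nat.div_mod n q) by lia. rewrite (Nat.mul_comm q), E.
  eapply Rle_trans; [apply Cmod_Csum|].
  eapply Rle_trans; [apply (Rsum_le_const _ 1)|].
  - intros a _. apply (char_Cmod_le_1 q); [lia|assumption].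
  - rewrite length_seq, Rmult_1_r. apply le_INR. pose proof (Nat.mod_upper_bound n q). lia.
Qed.

(** * L-functions of non-principal characters, and power sums *)

(** The sum of the series where it converges, and an arbitrary value elsewhere. *)
Definition Lfun (chi : nat -> C) (s : C) : C := epsilon (inhabits (RtoC 0)) (is_dirichlet_series chi s).

Lemma exp_neg_ln_lim (a c : R) : 0 < a -> 0 <= c ->
  forall eps, 0 < eps -> exists N0, forall N, (N0 <= N)%nat -> c * exp (- a * ln (INR (S N))) <= eps.
Proof.
  intros Ha Hc eps He.
  set (x := exp (ln ((c + 1) / eps) / a)).
  destruct (INR_unbounded x) as [N0 HN0]. exists N0. intros N HN.
  assert (HN' : INR N0 <= INR (S N)) by (apply le_INR; lia).
  assert (Px : 0 < x) by apply exp_pos.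
  assert (Pc : 0 < (c + 1) / eps) by (apply Rdiv_lt_0_compat; lra).
  assert (L : ln ((c + 1) / eps) / a <= ln (INR (S N))).
  { rewrite <- (ln_exp (ln ((c + 1) / eps) / a)). apply ln_le; [exact Px|]. fold x. lra. }
  assert (L' : ln ((c + 1) / eps) <= a * ln (INR (S N))).
  { apply Rmult_le_compat_l with (r := a) in L; [|lra].
    replace (a * (ln ((c + 1) / eps) / a)) with (ln ((c + 1) / eps)) in L by (field; lra). exact L. }
  assert (E : exp (- a * ln (INR (S N))) <= eps / (c + 1)).
  { replace (eps / (c + 1)) with (exp (- ln ((c + 1) / eps))).
    - apply exp_le_compat. lra.
    - rewrite exp_Ropp, exp_ln by assumption. field. lra. }
  pose proof (exp_pos (- a * ln (INR (S N)))).
  apply Rle_trans with (c * (eps / (c + 1))); [apply Rmult_le_compat_l; lra|].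
  replace (c * (eps / (c + 1))) with (eps * (c / (c + 1))) by (field; lra).
  assert (c / (c + 1) <= 1).
  { apply Rmult_le_reg_r with (c + 1); [lra|]. unfold Rdiv. rewrite Rmult_assoc, Rinv_l; lra. }
  nra.
Qed.

Lemma Lfun_series q chi s : (2 <= q)%nat -> dirichlet_character q chi -> chi <> principal_character q ->
  0 < Re s -> is_dirichlet_series chi s (Lfun chi s).
Proof.
  intros Hq H Hne Hs. unfold Lfun. apply epsilon_spec.
  apply (dirichlet_series_tail chi s (fun N => INR q * (Cmod s / Re s + 1) * exp (- Re s * ln (INR (S N))))).
  - intros N n. apply dsum_bound; [lia|exact Hs|].
    intros j. apply (char_partial_sum q); assumption.
  - intros eps He. destruct (exp_neg_ln_lim (Re s) (INR q * (Cmod s / Re s + 1)) Hs) with (eps := eps) as [N HN];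
      [|exact He|exists N; apply HN; lia].
    apply Rmult_le_pos; [apply pos_INR|].
    assert (0 <= Cmod s / Re s) by (apply Rdiv_le_0_compat; [apply Cmod_ge_0|exact Hs]). lra.
Qed.

Lemma Lfun_is_L_function q chi : (2 <= q)%nat -> dirichlet_character q chi -> chi <> principal_character q ->
  is_L_function q chi (Lfun chi).
Proof. intros Hq H Hne. left. split; [exact Hne|]. intros s Hs. now apply (Lfun_series q). Qed.

Lemma Lfun_tail q chi s N : (2 <= q)%nat -> dirichlet_character q chi -> chi <> principal_character q ->
  0 < Re s ->
  Cmod (Lfun chi s - dsum chi s 1 N) <= INR q * (Cmod s / Re s + 1) * exp (- Re s * ln (INR (S N))).
Proof.
  intros Hq H Hne Hs. apply dirichlet_series_tail_le; [now apply (Lfun_series q)|].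
  intros n. apply dsum_bound; [lia|exact Hs|].
  intros j. apply (char_partial_sum q); assumption.
Qed.

Lemma Lfun_bound q chi s : (2 <= q)%nat -> dirichlet_character q chi -> chi <> principal_character q ->
  0 < Re s -> Cmod (Lfun chi s) <= INR q * (Cmod s / Re s + 1).
Proof.
  intros Hq H Hne Hs. pose proof (Lfun_tail q chi s 0 Hq H Hne Hs) as T.
  unfold dsum in T. cbn [seq Csum fold_right] in T. simpl INR in T at 2.
  rewrite ln_1, Rmult_0_r, exp_0, Rmult_1_r in T.
  replace (Lfun chi s - 0)%C with (Lfun chi s) in T by ring. exact T.
Qed.

Lemma ln_step_lower n : (1 <= n)%nat -> / INR (S n) <= ln (INR (S n)) - ln (INR n).
Proof.
  intros Hn. assert (P : 0 < INR n) by (apply lt_0_INR; lia).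
  rewrite S_INR in *.
  assert (E : ln (INR n / (INR n + 1)) <= INR n / (INR n + 1) - 1).
  { assert (Q : 0 < INR n / (INR n + 1)) by (apply Rdiv_lt_0_compat; lra).
    pose proof (exp_ineq1_le (ln (INR n / (INR n + 1)))) as X. rewrite exp_ln in X by exact Q. lra. }
  rewrite ln_div in E by lra.
  replace (INR n / (INR n + 1) - 1) with (- / (INR n + 1)) in E by (field; lra). lra.
Qed.

(** A discrete comparison with the integral: exp x >= 1 + x together with log(n+1) - log n >=
    1/(n+1). *)
Lemma power_sum_step_gt1 sg n : 1 < sg -> (1 <= n)%nat ->
  exp (- sg * ln (INR (S n))) <=
    / (sg - 1) * (exp ((1 - sg) * ln (INR n)) - exp ((1 - sg) * ln (INR (S n)))).
Proof.
  intros Hs Hn. pose proof (ln_step_lower n Hn) as L.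
  assert (P : 0 < INR (S n)) by (apply lt_0_INR; lia).
  set (h := ln (INR (S n)) - ln (INR n)) in *.
  replace (exp ((1 - sg) * ln (INR n))) with (exp ((1 - sg) * ln (INR (S n))) * exp ((sg - 1) * h)).
  2:{ rewrite <- exp_plus. f_equal. unfold h. ring. }
  replace (exp (- sg * ln (INR (S n)))) with (exp ((1 - sg) * ln (INR (S n))) * / INR (S n)).
  2:{ rewrite <- (exp_ln (INR (S n))) at 2 by exact P. rewrite <- exp_Ropp, <- exp_plus. f_equal. ring. }
  pose proof (exp_pos ((1 - sg) * ln (INR (S n)))) as Pe.
  pose proof (exp_ineq1_le ((sg - 1) * h)).
  set (y := exp ((1 - sg) * ln (INR (S n)))) in *. set (z := exp ((sg - 1) * h)) in *.
  replace (/ (sg - 1) * (y * z - y)) with (y * (/ (sg - 1) * (z - 1))) by ring.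
  apply Rmult_le_compat_l; [lra|].
  apply Rmult_le_reg_l with (sg - 1); [lra|]. rewrite <- Rmult_assoc, Rinv_r, Rmult_1_l by lra. nra.
Qed.

Lemma power_sum_gt1 sg N n : 1 < sg -> (1 <= N)%nat ->
  Rsum (fun k => exp (- sg * ln (INR k))) (seq (S N) n) <= / (sg - 1) * exp ((1 - sg) * ln (INR N)).
Proof.
  intros Hs HN.
  apply Rle_trans with (/ (sg - 1) * (exp ((1 - sg) * ln (INR N)) - exp ((1 - sg) * ln (INR (N + n))))).
  - rewrite <- (Rsum_telescope (fun k => exp ((1 - sg) * ln (INR k)))), <- Rsum_scal.
    rewrite (Rsum_seq_from _ (S N)), (Rsum_seq_from _ N). apply Rsum_le. intros k _.
    apply power_sum_step_gt1; [exact Hs|lia].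
  - apply Rmult_le_compat_l; [left; apply Rinv_0_lt_compat; lra|].
    pose proof (exp_pos ((1 - sg) * ln (INR (N + n)))). lra.
Qed.

(** In the induction the new term is at most 2 N^(1-sg)/(N+1), because ((N+1)/N)^(1-sg) <= 2, while
    the right-hand side grows by at least 3 N^(1-sg)/(N+1); this is the reason for the 3. *)
Lemma power_sum_lt1 sg N : 0 < sg < 1 -> (1 <= N)%nat ->
  Rsum (fun k => exp (- sg * ln (INR k))) (seq 1 N) <= 3 / (1 - sg) * exp ((1 - sg) * ln (INR N)).
Proof.
  intros Hs HN.
  assert (Pi : 1 < / (1 - sg)) by (rewrite <- Rinv_1; apply Rinv_lt_contravar; lra).
  induction N as [|N IH]; [lia|].
  destruct (Nat.eq_dec N 0) as [->|N0].
  - simpl. rewrite ln_1, !Rmult_0_r, exp_0. unfold Rdiv. lra.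
  - rewrite Rsum_seq_S. specialize (IH ltac:(lia)). change (1 + N)%nat with (S N).
    pose proof (ln_step_lower N ltac:(lia)) as L.
    assert (P : 0 < INR N) by (apply lt_0_INR; lia).
    assert (P1 : 1 <= INR N) by (change 1 with (INR 1); apply le_INR; lia).
    set (h := ln (INR (S N)) - ln (INR N)) in *.
    set (y := exp ((1 - sg) * ln (INR N))) in *.
    assert (E1 : exp ((1 - sg) * ln (INR (S N))) = y * exp ((1 - sg) * h)).
    { unfold y. rewrite <- exp_plus. f_equal. unfold h. ring. }
    assert (E2 : exp (- sg * ln (INR (S N))) = exp ((1 - sg) * ln (INR (S N))) * / INR (S N)).
    { rewrite <- (exp_ln (INR (S N))) at 3 by (apply lt_0_INR; lia).
      rewrite <- exp_Ropp, <- exp_plus. f_equal. ring. }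
    assert (Py : 0 < y) by apply exp_pos.
    pose proof (exp_ineq1_le ((1 - sg) * h)) as X.
    rewrite E2, E1. set (z := exp ((1 - sg) * h)) in *.
    assert (Hz : z <= 2).
    { unfold z. apply Rle_trans with (exp h).
      - assert (0 <= h) by (pose proof (Rinv_0_lt_compat (INR (S N)) ltac:(apply lt_0_INR; lia)); lra).
        apply exp_le_compat. nra.
      - unfold h. unfold Rminus. rewrite exp_plus, exp_Ropp, !exp_ln by (apply lt_0_INR; lia).
        rewrite S_INR. apply Rmult_le_reg_r with (INR N); [lra|]. rewrite Rmult_assoc, Rinv_l by lra. lra. }
    set (r := / INR (S N)) in *.
    assert (Pr : 0 < r) by (apply Rinv_0_lt_compat, lt_0_INR; lia).
    assert (Pyr : 0 <= (y * r) * (2 - z)) by (apply Rmult_le_pos; [apply Rmult_le_pos|]; lra).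
    apply Rle_trans with (3 / (1 - sg) * y + 2 * y * r); [lra|].
    assert (Q : (1 - sg) * r <= z - 1) by nra.
    assert (Q' : 3 / (1 - sg) * y + 2 * y * r <= 3 / (1 - sg) * y + 3 / (1 - sg) * y * (z - 1)).
    { apply Rplus_le_compat_l.
      apply Rle_trans with (3 / (1 - sg) * y * ((1 - sg) * r)).
      - replace (3 / (1 - sg) * y * ((1 - sg) * r)) with (3 * y * r) by (field; lra). nra.
      - apply Rmult_le_compat_l; [|exact Q]. unfold Rdiv. nra. }
    lra.
Qed.

Lemma dsum_tail_abs f s N n : (forall k, Cmod (f k) <= 1) -> 1 < Re s -> (1 <= N)%nat ->
  Cmod (dsum f s (S N) n) <= / (Re s - 1) * exp ((1 - Re s) * ln (INR N)).
Proof.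
  intros Hf Hs HN. unfold dsum. eapply Rle_trans; [apply Cmod_Csum|].
  eapply Rle_trans; [|apply (power_sum_gt1 (Re s) N n Hs HN)].
  apply Rsum_le. intros k _. rewrite Cmod_mult, Cmod_npow.
  pose proof (exp_pos (- Re s * ln (INR k))). specialize (Hf k). nra.
Qed.

Lemma abs_series_exists f s : (forall k, Cmod (f k) <= 1) -> 1 < Re s ->
  exists l, is_dirichlet_series f s l.
Proof.
  intros Hf Hs.
  apply (dirichlet_series_tail f s (fun N => match N with O => 1 + / (Re s - 1) | _ => / (Re s - 1) * exp ((1 - Re s) * ln (INR N)) end)).
  - intros [|N] n; [|apply dsum_tail_abs; auto; lia].
    destruct n as [|n].
    + unfold dsum. simpl. rewrite Cmod_0. pose proof (Rinv_0_lt_compat (Re s - 1) ltac:(lra)). lra.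
    + change (S n) with (1 + n)%nat. rewrite dsum_app. eapply Rle_trans; [apply Cmod_triangle|].
      apply Rplus_le_compat.
      * unfold dsum. cbn [seq Csum fold_right]. rewrite npow_1, Cplus_0_r, Cmult_1_r. apply Hf.
      * eapply Rle_trans; [apply (dsum_tail_abs f s 1 n); auto|].
        simpl INR. rewrite ln_1, Rmult_0_r, exp_0. lra.
  - intros eps He.
    destruct (exp_neg_ln_lim (Re s - 1) (/ (Re s - 1)) ltac:(lra)) with (eps := eps) as [N HN];
      [left; apply Rinv_0_lt_compat; lra|exact He|].
    exists (S N). specialize (HN N ltac:(lia)).
    replace (1 - Re s) with (- (Re s - 1)) by ring. exact HN.
Qed.

(** * Zeros on the line Re s = 1 *)

Definition Cprod {A : Type} (f : A -> C) (l : list A) : C :=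
  fold_right (fun a s => (f a * s)%C) (RtoC 1) l.

Lemma Cprod_app {A : Type} (f : A -> C) l m : Cprod f (l ++ m) = (Cprod f l * Cprod f m)%C.
Proof. induction l as [|a l IH]; simpl; [ring|rewrite IH; ring]. Qed.

Definition is_prime (p : nat) : bool := if prime_dec (Z.of_nat p) then true else false.

Lemma is_prime_spec p : is_prime p = true <-> prime (Z.of_nat p).
Proof. unfold is_prime. destruct (prime_dec (Z.of_nat p)); split; intros; congruence || tauto. Qed.

Definition primes_upto (N : nat) : list nat := filter is_prime (seq 1 N).

Lemma primes_upto_S N :
  primes_upto (S N) = primes_upto N ++ (if is_prime (S N) then (S N :: nil) else nil).
Proof. unfold primes_upto. rewrite seq_S, filter_app. reflexivity. Qed.

Lemma In_primes_upto p N : List.In p (primes_upto N) <-> prime (Z.of_nat p) /\ (p <= N)%nat.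
Proof.
  unfold primes_upto. rewrite filter_In, in_seq, is_prime_spec. split; intros [H1 H2]; split; try lia; auto.
  apply prime_ge_2 in H1. lia.
Qed.

Lemma prime_divide_nat p m n : prime (Z.of_nat p) -> Nat.divide p (m * n) -> Nat.divide p m \/ Nat.divide p n.
Proof.
  intros Hp [k Hk].
  assert (D : (Z.of_nat p | Z.of_nat m * Z.of_nat n)%Z) by (exists (Z.of_nat k); lia).
  assert (P : (0 < Z.of_nat p)%Z) by (apply prime_ge_2 in Hp; lia).
  apply prime_mult in D; [|exact Hp].
  destruct D as [[x Hx]|[x Hx]]; [left|right]; exists (Z.to_nat x); nia.
Qed.

Lemma prime_divide_prime_nat p r : prime (Z.of_nat p) -> prime (Z.of_nat r) -> Nat.divide p r -> p = r.
Proof.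
  intros Hp Hr [k Hk]. apply Nat2Z.inj. apply prime_div_prime; auto. exists (Z.of_nat k). lia.
Qed.

Lemma prime_divisor_exists n : (2 <= n)%nat -> exists p, prime (Z.of_nat p) /\ Nat.divide p n.
Proof.
  induction n as [n IH] using lt_wf_ind. intros Hn.
  destruct (prime_dec (Z.of_nat n)) as [P|P].
  - exists n. split; [exact P|apply Nat.divide_refl].
  - destruct (not_prime_divide (Z.of_nat n) ltac:(lia) P) as [d [Hd [k Hk]]].
    destruct (IH (Z.to_nat d) ltac:(lia) ltac:(lia)) as [p [Hp [x Hx]]].
    exists p. split; [exact Hp|]. exists (Z.to_nat k * x)%nat. nia.
Qed.

Lemma gcd_lt_prime q x : prime (Z.of_nat q) -> (0 < x < q)%nat -> Nat.gcd x q = 1%nat.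
Proof.
  intros Hp Hx. destruct (Nat.eq_dec (Nat.gcd x q) 1) as [|N]; [assumption|exfalso].
  destruct (prime_divisor_exists (Nat.gcd x q)) as [r [Hr Dr]].
  { assert (Nat.gcd x q <> 0)%nat by (intro Z; apply Nat.gcd_eq_0 in Z; lia). lia. }
  assert (Dq : Nat.divide r q) by (eapply Nat.divide_trans; [exact Dr|apply Nat.gcd_divide_r]).
  apply prime_divide_prime_nat in Dq; auto. subst r.
  assert (Dx : Nat.divide q x) by (eapply Nat.divide_trans; [exact Dr|apply Nat.gcd_divide_l]).
  apply Nat.divide_pos_le in Dx; lia.
Qed.

(* The coefficients of the Dirichlet series of chi with the Euler factors at the
   primes up to N removed. *)
Fixpoint sieve (chi : nat -> C) (N n : nat) : C :=
  match N with
  | O => chi n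
  | S M => if andb (is_prime (S M)) (n mod S M =? 0)%nat then RtoC 0 else sieve chi M n
  end.

Lemma sieve_Cmod q chi N n : (0 < q)%nat -> dirichlet_character q chi -> Cmod (sieve chi N n) <= 1.
Proof.
  intros Hq H. induction N as [|N IH].
  - apply (char_Cmod_le_1 q); assumption.
  - simpl sieve. destruct (andb (is_prime (S N)) _); [rewrite Cmod_0; lra|exact IH].
Qed.

Lemma sieve_1 q chi N : dirichlet_character q chi -> sieve chi N 1 = RtoC 1.
Proof.
  intros H. induction N as [|N IH]; [exact (char_1 q chi H)|].
  cbn [sieve]. destruct (is_prime (S N)) eqn:E; [|exact IH].
  apply is_prime_spec in E. apply prime_ge_2 in E.
  rewrite Nat.mod_small by lia. exact IH.
Qed.

Lemma sieve_divisible chi N n p : prime (Z.of_nat p) -> (p <= N)%nat -> Nat.divide p n ->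
  sieve chi N n = RtoC 0.
Proof.
  intros Hp HN Hd. induction N as [|N IH]; [apply prime_ge_2 in Hp; lia|].
  cbn [sieve]. destruct (Nat.eq_dec p (S N)) as [->|Hne].
  - rewrite (proj2 (is_prime_spec (S N)) Hp). apply Nat.Lcm0.mod_divide in Hd. rewrite Hd. reflexivity.
  - rewrite IH by lia. destruct (andb _ _); reflexivity.
Qed.

Lemma sieve_small chi N n : (2 <= n <= N)%nat -> sieve chi N n = RtoC 0.
Proof.
  intros Hn. destruct (prime_divisor_exists n ltac:(lia)) as [p [Hp Hd]].
  apply (sieve_divisible chi N n p Hp); [|exact Hd].
  apply Nat.divide_pos_le in Hd; lia.
Qed.

Lemma sieve_prime_mul q chi N p n : dirichlet_character q chi -> prime (Z.of_nat p) -> (N < p)%nat ->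
  sieve chi N (p * n) = (chi p * sieve chi N n)%C.
Proof.
  intros H Hp HN. induction N as [|N IH]; [apply H|].
  cbn [sieve]. destruct (is_prime (S N)) eqn:E; cbn [andb]; [|apply IH; lia].
  apply is_prime_spec in E.
  destruct (Nat.eqb_spec ((p * n) mod S N) 0) as [D|D]; destruct (Nat.eqb_spec (n mod S N) 0) as [D'|D'].
  - ring.
  - exfalso. apply D'. apply Nat.Lcm0.mod_divide in D. apply Nat.Lcm0.mod_divide.
    destruct (prime_divide_nat _ _ _ E D) as [D1|D1]; [|exact D1].
    apply prime_divide_prime_nat in D1; auto. lia.
  - exfalso. apply D. apply Nat.Lcm0.mod_divide in D'. apply Nat.Lcm0.mod_divide. now apply Nat.divide_mul_r.
  - apply IH. lia.
Qed.

Lemma Csum_multiples (f : nat -> C) (p n : nat) : (0 < p)%nat ->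
  Csum (fun k => if (k mod p =? 0)%nat then f k else RtoC 0) (seq 1 n) =
  Csum (fun j => f (p * j)%nat) (seq 1 (n / p)).
Proof.
  intros Hp. induction n as [|n IH].
  - rewrite Nat.Div0.div_0_l. reflexivity.
  - rewrite Csum_seq_S, IH. change (1 + n)%nat with (S n).
    destruct (Nat.eqb_spec (S n mod p) 0) as [D|D].
    + apply Nat.Lcm0.mod_divide in D as [k Hk]. rewrite Hk, Nat.div_mul by lia.
      destruct k as [|k]; [lia|].
      replace (n / p)%nat with k.
      * rewrite Csum_seq_S. f_equal. f_equal. lia.
      * apply (Nat.div_unique n p k (p - 1)); nia.
    + replace (S n / p)%nat with (n / p)%nat; [ring|].
      pose proof (Nat.div_mod (S n) p ltac:(lia)) as E1. pose proof (Nat.mod_upper_bound (S n) p ltac:(lia)).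
      symmetry. apply (Nat.div_unique n p (S n / p) (S n mod p - 1)); lia.
Qed.

Definition euler (chi : nat -> C) (s : C) (N : nat) : C :=
  Cprod (fun p => 1 - chi p * npow p s)%C (primes_upto N).

(** Sieving by the next prime p subtracts from the partial sum of length n the multiples of p, that
    is chi(p) p^(-s) times the partial sum of length n/p. In the limit this is multiplication by the
    Euler factor at p. *)
Lemma sieve_series q chi s l N : (0 < q)%nat -> dirichlet_character q chi ->
  is_dirichlet_series chi s l -> is_dirichlet_series (sieve chi N) s (l * euler chi s N).
Proof.
  intros Hq H Hl. induction N as [|N IH].
  - unfold euler. simpl. rewrite Cmult_1_r. exact Hl.
  - unfold euler. rewrite primes_upto_S, Cprod_app. fold (euler chi s N).
    destruct (is_prime (S N)) eqn:E.
    + pose proof (proj1 (is_prime_spec (S N)) E) as Hp. set (p := S N) in *.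
      set (T := (l * euler chi s N)%C) in *.
      assert (ES : forall n, dsum (sieve chi p) s 1 n =
        (dsum (sieve chi N) s 1 n - chi p * npow p s * dsum (sieve chi N) s 1 (n / p))%C).
      { intros n. unfold dsum. rewrite <- Csum_scal.
        rewrite (Csum_ext (fun a => chi p * npow p s * _)%C
          (fun j => sieve chi N (p * j) * npow (p * j) s)%C).
        - rewrite <- (Csum_multiples (fun k => sieve chi N k * npow k s)%C p n) by lia.
          rewrite <- Csum_minus. apply Csum_ext. intros k _.
          unfold p at 1. cbn [sieve]. fold p. rewrite E. cbn [andb].
          destruct (k mod p =? 0)%nat; ring.
        - intros j Hj. apply in_seq in Hj.
          rewrite (sieve_prime_mul q), npow_mult by (auto; lia). ring. }
      cbn [Cprod fold_right]. rewrite Cmult_1_r.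
      replace (l * (euler chi s N * (1 - chi p * npow p s)))%C with (T - chi p * npow p s * T)%C by (unfold T; ring).
      apply cvg_is_dirichlet_series. intros eps He.
      set (c := (chi p * npow p s)%C) in *. pose proof (Cmod_ge_0 c) as Hc.
      destruct (is_dirichlet_series_cvg _ _ _ IH (eps / (2 * (Cmod c + 1)))) as [M HM].
      { apply Rdiv_lt_0_compat; lra. }
      exists (p * M)%nat. intros n Hn. rewrite ES.
      assert (Hn1 : (M <= n)%nat) by nia.
      assert (Hn2 : (M <= n / p)%nat) by (apply Nat.div_le_lower_bound; lia).
      pose proof (HM n Hn1) as A1. pose proof (HM _ Hn2) as A2.
      set (d1 := dsum (sieve chi N) s 1 n) in *. set (d2 := dsum (sieve chi N) s 1 (n / p)) in *.
      replace (d1 - c * d2 - (T - c * T))%C with ((d1 - T) + - (c * (d2 - T)))%C by ring.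
      eapply Rle_trans; [apply Cmod_triangle|]. rewrite Cmod_opp, Cmod_mult.
      assert (Cmod c * Cmod (d2 - T) <= Cmod c * (eps / (2 * (Cmod c + 1)))) by (apply Rmult_le_compat_l; assumption).
      assert (Q : eps / (2 * (Cmod c + 1)) * (1 + Cmod c) = eps / 2) by (field; lra). lra.
    + cbn [Cprod fold_right]. rewrite Cmult_1_r.
      apply cvg_is_dirichlet_series. intros eps He.
      destruct (is_dirichlet_series_cvg _ _ _ IH eps He) as [M HM]. exists M. intros n Hn.
      replace (dsum (sieve chi (S N)) s 1 n) with (dsum (sieve chi N) s 1 n); [auto|].
      unfold dsum. apply Csum_ext. intros k _. cbn [sieve]. rewrite E. reflexivity.
Qed.

(** After sieving by the primes up to N only n = 1 and indices n > N survive, so the difference from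
    1 is the tail of an absolutely convergent series. *)
Lemma euler_product q chi s l N : (0 < q)%nat -> dirichlet_character q chi ->
  is_dirichlet_series chi s l -> 1 < Re s -> (1 <= N)%nat ->
  Cmod (l * euler chi s N - 1) <= / (Re s - 1) * exp ((1 - Re s) * ln (INR N)).
Proof.
  intros Hq H Hl Hs HN.
  pose proof (dirichlet_series_tail_le (sieve chi N) s _ N _ (sieve_series q chi s l N Hq H Hl)
    (fun n => dsum_tail_abs _ s N n (fun k => sieve_Cmod q chi N k Hq H) Hs HN)) as T.
  replace (dsum (sieve chi N) s 1 N) with (RtoC 1) in T; [exact T|].
  destruct N as [|N]; [lia|]. symmetry.
  change (S N) with (1 + N)%nat at 2. rewrite dsum_app. unfold dsum.
  rewrite (Csum_zero _ (seq (1 + 1) N)).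
  - cbn [seq Csum fold_right]. rewrite (sieve_1 q), npow_1 by assumption. ring.
  - intros k Hk. apply in_seq in Hk. rewrite sieve_small by lia. ring.
Qed.

Lemma euler_product_lim q chi s l : (0 < q)%nat -> dirichlet_character q chi ->
  is_dirichlet_series chi s l -> 1 < Re s ->
  forall eps, 0 < eps -> exists N0, forall N, (N0 <= N)%nat -> Cmod (l * euler chi s N - 1) <= eps.
Proof.
  intros Hq H Hl Hs eps He.
  destruct (exp_neg_ln_lim (Re s - 1) (/ (Re s - 1)) ltac:(lra)) with (eps := eps) as [N0 HN0];
    [left; apply Rinv_0_lt_compat; lra|exact He|].
  exists (S N0). intros [|N] HN; [lia|]. specialize (HN0 N ltac:(lia)).
  eapply Rle_trans; [apply (euler_product q); auto; lia|].
  replace (1 - Re s) with (- (Re s - 1)) by ring. exact HN0.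
Qed.

Lemma dirichlet_series_nonzero q chi s l : (0 < q)%nat -> dirichlet_character q chi ->
  is_dirichlet_series chi s l -> 1 < Re s -> l <> RtoC 0.
Proof.
  intros Hq H Hl Hs Z. destruct (euler_product_lim q chi s l Hq H Hl Hs (1/2) ltac:(lra)) as [N HN].
  specialize (HN N (Nat.le_refl _)). rewrite Z in HN.
  replace (0 * euler chi s N - 1)%C with (- (1))%C in HN by ring.
  rewrite Cmod_opp, Cmod_1 in HN. lra.
Qed.

(** Taking logarithms, the k-th terms combine to a negative multiple of 3 + 4 cos x + cos 2x = 2 (1
    + cos x)^2, with cos x = Re z^k. *)
Lemma mertens_factor (r : R) (z : C) : 0 <= r < 1 -> Cmod z = 1 ->
  Cmod (1 - RtoC r) ^ 3 * Cmod (1 - RtoC r * z) ^ 4 * Cmod (1 - RtoC r * (z * z)) <= 1.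
Proof.
  intros Hr Hz.
  assert (M : forall w, Cmod w = 1 -> Cmod (RtoC r * w) = r).
  { intros w Hw. rewrite Cmod_mult, Hw, Cmod_R, Rabs_right; lra. }
  assert (P : forall w, Cmod w = 1 -> 0 < Cmod (1 - RtoC r * w)).
  { intros w Hw. apply Cmod_gt_0. intro Z. pose proof (M w Hw) as E.
    replace (RtoC r * w)%C with (1 - (1 - RtoC r * w))%C in E by ring. rewrite Z in E.
    replace (1 - 0)%C with (RtoC 1) in E by ring. rewrite Cmod_1 in E. lra. }
  assert (Hzz : Cmod (z * z) = 1) by (rewrite Cmod_mult, Hz; ring).
  replace (RtoC r) with (RtoC r * 1)%C at 1 by ring.
  pose proof (P 1%C Cmod_1) as P1. pose proof (P z Hz) as P2. pose proof (P _ Hzz) as P3.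
  assert (L : 3 * ln (Cmod (1 - RtoC r * 1)) + 4 * ln (Cmod (1 - RtoC r * z)) + ln (Cmod (1 - RtoC r * (z * z))) <= 0).
  { apply le_epsilon. intros eps He.
    (* The truncation errors are counted with weights 3, 4 and 1, so each may be eps/8. *)
    destruct (pow_lt_1_zero r ltac:(rewrite Rabs_right; lra) (eps * (1 - r) / 8)) as [n Hn].
    { apply Rdiv_lt_0_compat; nra. }
    specialize (Hn (S n) ltac:(lia)). rewrite Rabs_right in Hn by (apply Rle_ge, pow_le; lra).
    assert (X : forall w, Cmod w = 1 -> ln (Cmod (1 - RtoC r * w)) <=
      - Rsum (fun k => r ^ S k / INR (S k) * Re (w ^ S k)%C) (seq 0 n) + eps / 8).
    { intros w Hw. pose proof (ln_Cmod_expansion (RtoC r * w) n) as T. rewrite M in T by exact Hw.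
      specialize (T ltac:(lra)). rewrite Re_Csum in T.
      rewrite (Rsum_ext _ (fun k => r ^ S k / INR (S k) * Re (w ^ S k)%C)) in T.
      - assert (r ^ S n / (1 - r) <= eps / 8).
        { apply Rmult_le_reg_r with (1 - r); [lra|]. unfold Rdiv at 1. rewrite Rmult_assoc, Rinv_l by lra. lra. }
        apply Rabs_le_between in T. lra.
      - intros k _. rewrite Cpow_mult_l, <- Re_scal. f_equal.
        rewrite RtoC_div, RtoC_pow by (apply not_0_INR; lia). unfold Cdiv. ring. }
    pose proof (X 1%C Cmod_1) as X1. pose proof (X z Hz) as X2. pose proof (X _ Hzz) as X3.
    assert (Q : 0 <= Rsum (fun k => 3 * (r ^ S k / INR (S k) * Re (1 ^ S k)%C) + 4 * (r ^ S k / INR (S k) * Re (z ^ S k)%C)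
       + r ^ S k / INR (S k) * Re ((z * z) ^ S k)%C) (seq 0 n)).
    { apply Rsum_nonneg. intros k _.
      rewrite Cpow_1_l, Cpow_mult_l.
      assert (E : Re (z ^ S k * z ^ S k)%C = 2 * (Re (z ^ S k)%C * Re (z ^ S k)%C) - 1).
      { assert (Y : Cmod (z ^ S k) = 1) by (rewrite Cmod_pow, Hz; apply pow1).
        pose proof (Cmod_sqr (z ^ S k)%C) as Sq. rewrite Y in Sq.
        clear - Sq. revert Sq. generalize (z ^ S k)%C. intros y Sq. unfold Re, Im in *. simpl. lra. }
      rewrite E. simpl (Re 1%C).
      assert (0 <= r ^ S k / INR (S k)).
      { apply Rdiv_le_0_compat; [apply pow_le; lra|apply lt_0_INR; lia]. }
      set (c := Re (z ^ S k)%C) in *. set (a := r ^ S k / INR (S k)) in *.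
      replace (3 * (a * 1) + 4 * (a * c) + a * (2 * (c * c) - 1)) with (a * (2 * ((1 + c) * (1 + c)))) by ring.
      apply Rmult_le_pos; [assumption|]. pose proof (Rle_0_sqr (1 + c)) as Sq. unfold Rsqr in Sq. lra. }
    rewrite !Rsum_plus, !Rsum_scal in Q. lra. }
  rewrite <- (exp_ln (Cmod (1 - RtoC r * 1))), <- (exp_ln (Cmod (1 - RtoC r * z))),
    <- (exp_ln (Cmod (1 - RtoC r * (z * z)))) by assumption.
  rewrite !exp_pow_INR, <- !exp_plus. apply Rle_trans with (exp 0); [|rewrite exp_0; lra].
  apply exp_le_compat. simpl INR. lra.
Qed.

Lemma pow34_nonneg (a b c : R) : 0 <= a -> 0 <= b -> 0 <= c -> 0 <= a ^ 3 * b ^ 4 * c.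
Proof.
  intros. apply Rmult_le_pos; [|assumption]. apply Rmult_le_pos; apply pow_le; assumption.
Qed.

Lemma Cmod_le_abs (a b : R) : Cmod (a, b) <= Rabs a + Rabs b.
Proof.
  replace ((a, b) : C) with (RtoC a + Ci * RtoC b)%C by (apply injective_projections; simpl; ring).
  eapply Rle_trans; [apply Cmod_triangle|]. rewrite Cmod_mult, Cmod_Ci, !Cmod_R. lra.
Qed.

Lemma npow_im (p : nat) (x t : R) : npow p (x, t) = (RtoC (exp (- x * ln (INR p))) * npow p (0, t))%C.
Proof.
  unfold npow. rewrite <- Cexp_RtoC, <- Cexp_add. f_equal.
  apply injective_projections; simpl; ring.
Qed.

Lemma npow_im_twice (p : nat) (t : R) : npow p (0, 2 * t) = (npow p (0, t) * npow p (0, t))%C.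
Proof.
  unfold npow. rewrite <- Cexp_add. f_equal. apply injective_projections; simpl; ring.
Qed.

Lemma mertens_euler q chi (x t : R) (N : nat) : (2 <= q)%nat -> dirichlet_character q chi -> 0 < x ->
  Cmod (euler (principal_character q) (x, 0) N) ^ 3 * Cmod (euler chi (x, t) N) ^ 4 *
    Cmod (euler (character_mul chi chi) (x, 2 * t) N) <= 1.
Proof.
  intros Hq H Hx. unfold euler.
  assert (HP : forall p, List.In p (primes_upto N) -> prime (Z.of_nat p)) by (intros p Hp; now apply In_primes_upto in Hp).
  induction (primes_upto N) as [|p l IH].
  - simpl. rewrite Cmod_1. lra.
  - cbn [Cprod fold_right]. rewrite !Cmod_mult.
    specialize (IH (fun p Hp => HP p (or_intror Hp))).
    assert (F : Cmod (1 - principal_character q p * npow p (x, 0)) ^ 3 * Cmod (1 - chi p * npow p (x, t)) ^ 4 *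
       Cmod (1 - character_mul chi chi p * npow p (x, 2 * t)) <= 1).
    { rewrite (npow_im p x 0), (npow_im p x t), (npow_im p x (2 * t)), npow_im_twice.
      assert (P0 : npow p (0, 0) = RtoC 1).
      { unfold npow. rewrite <- Cexp_0. f_equal. apply injective_projections; simpl; ring. }
      rewrite P0. set (u := npow p (0, t)).
      assert (Hu : Cmod u = 1) by (unfold u; rewrite Cmod_npow; simpl; rewrite Ropp_0, Rmult_0_l; apply exp_0).
      set (r := exp (- x * ln (INR p))).
      assert (Hp : prime (Z.of_nat p)) by (apply HP; now left).
      assert (Hr : 0 <= r < 1).
      { unfold r. split; [left; apply exp_pos|]. rewrite <- exp_0. apply exp_increasing.
        apply prime_ge_2 in Hp.
        assert (0 < ln (INR p)) by (rewrite <- ln_1; apply ln_increasing; [lra|]; change 1 with (INR 1); apply lt_INR; lia).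
        nra. }
      unfold character_mul, principal_character.
      destruct (Nat.eqb_spec (Nat.gcd p q) 1) as [G|G].
      - replace (1 * (RtoC r * 1))%C with (RtoC r) by ring.
        replace (chi p * (RtoC r * u))%C with (RtoC r * (chi p * u))%C by ring.
        replace (chi p * chi p * (RtoC r * (u * u)))%C with (RtoC r * ((chi p * u) * (chi p * u)))%C by ring.
        apply mertens_factor; [exact Hr|].
        rewrite Cmod_mult, Hu, (char_Cmod_1 q) by assumption. ring.
      - rewrite (char_nonunit q chi p H G).
        match goal with |- Cmod ?a ^ 3 * Cmod ?b ^ 4 * Cmod ?c <= 1 =>
          replace a with (RtoC 1) by ring; replace b with (RtoC 1) by ring; replace c with (RtoC 1) by ring end.
        rewrite Cmod_1. lra. }
    rewrite !Rpow_mult_distr.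
    set (a1 := Cmod (1 - principal_character q p * npow p (x, 0)) ^ 3) in *.
    set (b1 := Cmod (1 - chi p * npow p (x, t)) ^ 4) in *.
    set (c1 := Cmod (1 - character_mul chi chi p * npow p (x, 2 * t))) in *.
    match goal with |- a1 * ?A * (b1 * ?B) * (c1 * ?D) <= 1 =>
      replace (a1 * A * (b1 * B) * (c1 * D)) with ((a1 * b1 * c1) * (A * B * D)) by ring;
      assert (0 <= A * B * D) by (apply pow34_nonneg; apply Cmod_ge_0) end.
    assert (0 <= a1 * b1 * c1) by (apply pow34_nonneg; apply Cmod_ge_0).
    apply Rle_trans with (1 * 1); [|lra]. apply Rmult_le_compat; assumption.
Qed.

Lemma harmonic_sum_le N : (1 <= N)%nat -> Rsum (fun k => / INR k) (seq 1 N) <= 1 + ln (INR N).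
Proof.
  induction N as [|N IH]; intros HN; [lia|].
  destruct N as [|N]; [simpl; rewrite ln_1; lra|].
  rewrite Rsum_seq_S. specialize (IH ltac:(lia)). pose proof (ln_step_lower (S N) ltac:(lia)).
  change (1 + S N)%nat with (S (S N)). lra.
Qed.

(* Comparing both values with the partial sums of length N = 1 / (distance). *)
Lemma Lfun_near_line q chi (t : R) (N : nat) : (2 <= q)%nat -> dirichlet_character q chi ->
  chi <> principal_character q -> (1 <= N)%nat -> Lfun chi (1, t) = RtoC 0 ->
  Cmod (Lfun chi (1 + / INR N, t)) <=
    (2 * (INR q * (3 + Rabs t)) + 1) * (1 + ln (INR N)) ^ 2 * / INR N.
Proof.
  intros Hq H Hne HN HZ.
  assert (PN : 1 <= INR N) by (change 1 with (INR 1); apply le_INR; lia).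
  set (eta := / INR N).
  assert (He : 0 < eta <= 1).
  { unfold eta. split; [apply Rinv_0_lt_compat; lra|]. rewrite <- Rinv_1. apply Rinv_le_contravar; lra. }
  assert (Hln : 0 <= ln (INR N)) by (rewrite <- ln_1; apply ln_le; lra).
  assert (T : forall x, 1 <= x <= 2 -> Cmod (Lfun chi (x, t) - dsum chi (x, t) 1 N) <= INR q * (3 + Rabs t) * eta).
  { intros x Hx. eapply Rle_trans; [apply (Lfun_tail q); auto; simpl; lra|]. simpl (Re (x, t)).
    pose proof (pos_INR q). pose proof (Rabs_pos t).
    pose proof (Cmod_le_abs x t) as B. rewrite (Rabs_right x) in B by lra.
    assert (B' : Cmod (x, t) / x <= 2 + Rabs t).
    { apply Rmult_le_reg_r with x; [lra|]. unfold Rdiv. rewrite Rmult_assoc, Rinv_l by lra. nra. }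
    assert (E : exp (- x * ln (INR (S N))) <= eta).
    { unfold eta. rewrite <- (exp_ln (INR N)) by lra. rewrite <- exp_Ropp. apply exp_le_compat.
      assert (ln (INR N) <= ln (INR (S N))) by (apply ln_le; [lra|apply le_INR; lia]). nra. }
    assert (0 <= Cmod (x, t) / x) by (apply Rdiv_le_0_compat; [apply Cmod_ge_0|lra]).
    apply Rmult_le_compat; [|left; apply exp_pos| |exact E].
    - apply Rmult_le_pos; lra.
    - apply Rmult_le_compat_l; lra. }
  (* Termwise, 1/k - k^(-1-eta) <= eta log k / k, and the harmonic sum supplies the factor 1 + log
     N. *)
  assert (D : Cmod (dsum chi (1 + eta, t) 1 N - dsum chi (1, t) 1 N) <= (1 + ln (INR N)) * (eta * ln (INR N))).
  { unfold dsum. rewrite <- Csum_minus. eapply Rle_trans; [apply Cmod_Csum|].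
    apply Rle_trans with (Rsum (fun k => (eta * ln (INR N)) * / INR k) (seq 1 N)).
    - apply Rsum_le. intros k Hk. apply in_seq in Hk.
      rewrite (npow_im k (1 + eta) t), (npow_im k 1 t). set (u := npow k (0, t)).
      assert (Hu : Cmod u = 1) by (unfold u; rewrite Cmod_npow; simpl; rewrite Ropp_0, Rmult_0_l; apply exp_0).
      match goal with |- Cmod (?c * (RtoC ?a * u) - ?c * (RtoC ?b * u)) <= _ =>
        replace (c * (RtoC a * u) - c * (RtoC b * u))%C with (c * (RtoC (a - b) * u))%C by (rewrite RtoC_minus; ring) end.
      rewrite !Cmod_mult, Hu, Cmod_R, Rmult_1_r.
      assert (Pk : 1 <= INR k) by (change 1 with (INR 1); apply le_INR; lia).
      assert (Lk : 0 <= ln (INR k) <= ln (INR N)).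
      { split; [rewrite <- ln_1; apply ln_le; lra|apply ln_le; [lra|apply le_INR; lia]]. }
      replace (exp (- (1 + eta) * ln (INR k))) with (/ INR k * exp (- (eta * ln (INR k)))).
      2:{ rewrite <- (exp_ln (INR k)) at 1 by lra. rewrite <- exp_Ropp, <- exp_plus. f_equal. ring. }
      replace (exp (- (1) * ln (INR k))) with (/ INR k).
      2:{ rewrite <- (exp_ln (INR k)) at 1 by lra. rewrite <- exp_Ropp. f_equal. ring. }
      pose proof (exp_ineq1_le (- (eta * ln (INR k)))) as X.
      assert (Y : exp (- (eta * ln (INR k))) <= 1) by (rewrite <- exp_0; apply exp_le_compat; nra).
      set (e := exp (- (eta * ln (INR k)))) in *.
      assert (Pi : 0 < / INR k) by (apply Rinv_0_lt_compat; lra).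
      assert (A : Rabs (/ INR k * e - / INR k) <= eta * ln (INR N) * / INR k).
      { assert (I1 : / INR k * e <= / INR k * 1) by (apply Rmult_le_compat_l; lra).
        rewrite Rabs_left1 by lra.
        assert (I2 : / INR k * (1 - eta * ln (INR k)) <= / INR k * e) by (apply Rmult_le_compat_l; lra).
        assert (eta * ln (INR k) <= eta * ln (INR N)) by (apply Rmult_le_compat_l; lra).
        assert (I3 : / INR k * (eta * ln (INR k)) <= / INR k * (eta * ln (INR N))) by (apply Rmult_le_compat_l; lra).
        lra. }
      pose proof (char_Cmod_le_1 q chi k ltac:(lia) H). pose proof (Cmod_ge_0 (chi k)).
      pose proof (Rabs_pos (/ INR k * e - / INR k)).
      apply Rle_trans with (1 * Rabs (/ INR k * e - / INR k)); [apply Rmult_le_compat_r; assumption|lra].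
    - rewrite Rsum_scal. pose proof (harmonic_sum_le N HN).
      rewrite (Rmult_comm (1 + ln (INR N))). apply Rmult_le_compat_l; [nra|assumption]. }
  pose proof (T 1 ltac:(lra)) as T1. pose proof (T (1 + eta) ltac:(lra)) as T2.
  rewrite HZ in T1.
  set (d1 := dsum chi (1, t) 1 N) in *. set (d2 := dsum chi (1 + eta, t) 1 N) in *.
  set (L2 := Lfun chi (1 + eta, t)) in *.
  replace L2 with ((L2 - d2) + ((d2 - d1) + - (0 - d1)))%C by ring.
  eapply Rle_trans; [apply Cmod_triangle|].
  pose proof (Cmod_triangle (d2 - d1) (- (0 - d1))) as T3. rewrite Cmod_opp in T3.
  set (c := INR q * (3 + Rabs t)) in *.
  assert (0 <= c) by (apply Rmult_le_pos; [apply pos_INR|pose proof (Rabs_pos t); lra]).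
  set (y := ln (INR N)) in *.
  apply Rle_trans with (2 * c * eta + (1 + y) * (eta * y)); [lra|].
  replace ((2 * c + 1) * (1 + y) ^ 2 * eta) with (eta * ((2 * c + 1) * ((1 + y) * (1 + y)))) by ring.
  replace (2 * c * eta + (1 + y) * (eta * y)) with (eta * (2 * c + (1 + y) * y)) by ring.
  apply Rmult_le_compat_l; nra.
Qed.

(** Each value times its Euler product tends to 1, so [mertens_euler] is inverted. The constant
    comes from (15/16)^8 >= 1/2, where 8 = 3 + 4 + 1. *)
Lemma mertens_inequality q chi (x t : R) l0 l1 l2 : (2 <= q)%nat -> dirichlet_character q chi -> 1 < x ->
  is_dirichlet_series (principal_character q) (x, 0) l0 ->
  is_dirichlet_series chi (x, t) l1 ->
  is_dirichlet_series (character_mul chi chi) (x, 2 * t) l2 ->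
  1 / 2 <= Cmod l0 ^ 3 * Cmod l1 ^ 4 * Cmod l2.
Proof.
  intros Hq H Hx H0 H1 H2.
  assert (Hq0 : (0 < q)%nat) by lia.
  destruct (euler_product_lim q _ _ _ Hq0 (principal_is_character q) H0 Hx (1/16) ltac:(lra)) as [N0 HN0].
  destruct (euler_product_lim q _ _ _ Hq0 H H1 Hx (1/16) ltac:(lra)) as [N1 HN1].
  destruct (euler_product_lim q _ _ _ Hq0 (character_mul_is_character q chi chi H H) H2 Hx (1/16) ltac:(lra)) as [N2 HN2].
  set (N := (N0 + N1 + N2)%nat).
  assert (Low : forall l e : C, Cmod (l * e - 1) <= 1 / 16 -> 15 / 16 <= Cmod l * Cmod e).
  { intros l e E. rewrite <- Cmod_mult. pose proof (Cmod_triangle (l * e) (- (l * e - 1))) as T.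
    replace (l * e + - (l * e - 1))%C with (RtoC 1) in T by ring. rewrite Cmod_opp, Cmod_1 in T. lra. }
  pose proof (Low _ _ (HN0 N ltac:(lia))) as L0. pose proof (Low _ _ (HN1 N ltac:(lia))) as L1.
  pose proof (Low _ _ (HN2 N ltac:(lia))) as L2.
  pose proof (mertens_euler q chi x t N Hq H ltac:(lra)) as ME.
  set (e0 := Cmod (euler (principal_character q) (x, 0) N)) in *.
  set (e1 := Cmod (euler chi (x, t) N)) in *.
  set (e2 := Cmod (euler (character_mul chi chi) (x, 2 * t) N)) in *.
  assert (P0 : (15/16) ^ 3 <= (Cmod l0 * e0) ^ 3) by (apply pow_incr; lra).
  assert (P1 : (15/16) ^ 4 <= (Cmod l1 * e1) ^ 4) by (apply pow_incr; lra).
  assert (Q : (15/16) ^ 3 * (15/16) ^ 4 * (15/16) <= (Cmod l0 * e0) ^ 3 * (Cmod l1 * e1) ^ 4 * (Cmod l2 * e2)).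
  { apply Rmult_le_compat; [lra|lra| |exact L2]. apply Rmult_le_compat; lra. }
  rewrite !Rpow_mult_distr in Q.
  replace (Cmod l0 ^ 3 * e0 ^ 3 * (Cmod l1 ^ 4 * e1 ^ 4) * (Cmod l2 * e2)) with
    ((Cmod l0 ^ 3 * Cmod l1 ^ 4 * Cmod l2) * (e0 ^ 3 * e1 ^ 4 * e2)) in Q by ring.
  assert (0 <= Cmod l0 ^ 3 * Cmod l1 ^ 4 * Cmod l2).
  { apply pow34_nonneg; apply Cmod_ge_0. }
  nra.
Qed.

(** At distance eta to the right of a zero 1 + i t, the fourth power of |L(s, chi)| is of order
    eta^4 up to logarithms, against a third power of 2/eta from the principal character and a
    bounded factor from the non-principal chi^2. For small eta this contradicts the lower bound
    1/2. *)
Lemma Lfun_nonzero_line q chi (t : R) : (2 <= q)%nat -> dirichlet_character q chi ->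
  character_mul chi chi <> principal_character q -> Lfun chi (1, t) <> RtoC 0.
Proof.
  intros Hq H Hne HZ.
  assert (Hne1 : chi <> principal_character q).
  { intro E. apply Hne. rewrite E. apply character_mul_principal_l, principal_is_character. }
  pose proof (character_mul_is_character q chi chi H H) as H2.
  set (c1 := 2 * (INR q * (3 + Rabs t)) + 1).
  set (c2 := INR q * (3 + 2 * Rabs t)).
  pose proof (Rabs_pos t) as Pt. pose proof (pos_INR q) as Pq.
  assert (Hc1 : 1 <= c1) by (unfold c1; nra).
  assert (Hc2 : 0 <= c2) by (unfold c2; nra).
  (* With eta = 1/N and N = x^16 one has 1 + log N <= 17 x, so logarithms disappear: N^3 (x^2/N)^4 =
     x^(-8), and the lower bound 1/2 would bound x^8 by a constant. *)
  assert (K : forall x : nat, (1 <= x)%nat -> INR x ^ 8 <= 16 * (c1 ^ 4 * 17 ^ 8 * c2) ).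
  { intros x Hx. set (N := (x ^ 16)%nat).
    assert (Px : 1 <= INR x) by (change 1 with (INR 1); apply le_INR; lia).
    assert (EN : INR N = INR x ^ 16) by (unfold N; apply pow_INR).
    assert (PN : 1 <= INR N) by (rewrite EN; rewrite <- (pow1 16); apply pow_incr; lra).
    assert (HN : (1 <= N)%nat) by (apply INR_le; exact PN).
    pose proof (Lfun_near_line q chi t N Hq H Hne1 HN HZ) as B1. fold c1 in B1.
    set (eta := / INR N) in *.
    assert (He : 0 < eta <= 1).
    { unfold eta. split; [apply Rinv_0_lt_compat; lra|]. rewrite <- Rinv_1. apply Rinv_le_contravar; lra. }
    destruct (abs_series_exists (principal_character q) (1 + eta, 0)) as [l0 Hl0].
    { intros k. apply (char_Cmod_le_1 q); [lia|apply principal_is_character]. }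
    { simpl. lra. }
    pose proof (mertens_inequality q chi (1 + eta) t l0 _ _ Hq H ltac:(lra) Hl0
      (Lfun_series q chi (1 + eta, t) Hq H Hne1 ltac:(simpl; lra))
      (Lfun_series q (character_mul chi chi) (1 + eta, 2 * t) Hq H2 Hne ltac:(simpl; lra))) as M.
    assert (B0 : Cmod l0 <= 2 * INR N).
    { pose proof (dirichlet_series_tail_le _ _ _ 1 _ Hl0 (fun n => dsum_tail_abs (principal_character q) (1 + eta, 0) 1 n
        (fun k => char_Cmod_le_1 q _ k ltac:(lia) (principal_is_character q)) ltac:(simpl; lra) (Nat.le_refl 1))) as T.
      simpl (Re (_, _)) in T. replace (1 + eta - 1) with eta in T by ring. simpl INR in T. rewrite ln_1, Rmult_0_r, exp_0 in T.
      unfold dsum in T. cbn [seq Csum fold_right] in T.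
      rewrite npow_1, (char_1 q _ (principal_is_character q)) in T.
      unfold eta in T. rewrite Rinv_inv in T.
      replace (1 * 1 + 0)%C with (RtoC 1) in T by ring.
      pose proof (Cmod_triangle (l0 - 1) 1) as T2. replace (l0 - 1 + 1)%C with l0 in T2 by ring.
      rewrite Cmod_1 in T2. lra. }
    assert (B2 : Cmod (Lfun (character_mul chi chi) (1 + eta, 2 * t)) <= c2).
    { eapply Rle_trans; [apply (Lfun_bound q); auto; simpl; lra|]. simpl (Re (_, _)).
      unfold c2. apply Rmult_le_compat_l; [exact Pq|].
      pose proof (Cmod_le_abs (1 + eta) (2 * t)) as B. rewrite (Rabs_right (1 + eta)), Rabs_mult, (Rabs_right 2) in B by lra.
      assert (Cmod (1 + eta, 2 * t) / (1 + eta) <= 2 + 2 * Rabs t); [|lra].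
      apply Rmult_le_reg_r with (1 + eta); [lra|]. unfold Rdiv. rewrite Rmult_assoc, Rinv_l by lra. nra. }
    assert (Bl : 1 + ln (INR N) <= 17 * INR x).
    { rewrite EN, ln_pow by lra. simpl (INR 16).
      pose proof (exp_ineq1_le (ln (INR x))) as X. rewrite exp_ln in X by lra. lra. }
    assert (Hln : 0 <= ln (INR N)) by (rewrite <- ln_1; apply ln_le; lra).
    assert (B1' : Cmod (Lfun chi (1 + eta, t)) <= c1 * (17 * INR x) ^ 2 * eta).
    { eapply Rle_trans; [exact B1|]. apply Rmult_le_compat_r; [lra|]. apply Rmult_le_compat_l; [lra|].
      apply pow_incr. lra. }
    assert (F : 1 / 2 <= (2 * INR N) ^ 3 * (c1 * (17 * INR x) ^ 2 * eta) ^ 4 * c2).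
    { eapply Rle_trans; [exact M|].
      pose proof (Cmod_ge_0 l0) as Z0. pose proof (Cmod_ge_0 (Lfun chi (1 + eta, t))) as Z1.
      assert (I0 : Cmod l0 ^ 3 <= (2 * INR N) ^ 3) by (apply pow_incr; lra).
      assert (I1 : Cmod (Lfun chi (1 + eta, t)) ^ 4 <= (c1 * (17 * INR x) ^ 2 * eta) ^ 4) by (apply pow_incr; lra).
      assert (J0 : 0 <= Cmod l0 ^ 3) by (apply pow_le; lra).
      assert (J1 : 0 <= Cmod (Lfun chi (1 + eta, t)) ^ 4) by (apply pow_le; lra).
      apply Rmult_le_compat; [apply Rmult_le_pos; assumption|apply Cmod_ge_0| |exact B2].
      apply Rmult_le_compat; assumption. }
    replace ((2 * INR N) ^ 3 * (c1 * (17 * INR x) ^ 2 * eta) ^ 4 * c2) with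
      (8 * (c1 ^ 4 * 17 ^ 8 * c2) * / (INR x ^ 8)) in F.
    2:{ unfold eta. rewrite EN. field. lra. }
    assert (P8 : 0 < INR x ^ 8) by (apply pow_lt; lra).
    apply Rmult_le_compat_r with (r := INR x ^ 8) in F; [|lra].
    rewrite Rmult_assoc, Rinv_l in F by lra. lra. }
  destruct (INR_unbounded (16 * (c1 ^ 4 * 17 ^ 8 * c2) + 1)) as [x Hx].
  assert (0 <= 16 * (c1 ^ 4 * 17 ^ 8 * c2)).
  { apply Rmult_le_pos; [lra|]. apply Rmult_le_pos; [|exact Hc2]. apply Rmult_le_pos; apply pow_le; lra. }
  assert (Hx1 : (1 <= x)%nat) by (apply INR_le; simpl INR; lra).
  specialize (K x Hx1).
  assert (INR x <= INR x ^ 8).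
  { rewrite <- (pow_1 (INR x)) at 1. apply Rle_pow; [lra|lia]. }
  lra.
Qed.

(** * The logarithm of L under GRH *)

Lemma approximable_ext F G rho : (forall z, Cmod z <= rho -> F z = G z) ->
  polynomially_approximable F rho -> polynomially_approximable G rho.
Proof.
  intros E H eps He. destruct (H eps He) as [n [b Hb]]. exists n, b. intros z Hz.
  rewrite <- E by exact Hz. now apply Hb.
Qed.

Lemma approximable_limit F rho :
  (forall eps, 0 < eps -> exists G, polynomially_approximable G rho /\
     forall z, Cmod z <= rho -> Cmod (F z - G z) <= eps) ->
  polynomially_approximable F rho.
Proof.
  intros H eps He. destruct (H (eps / 2) ltac:(lra)) as [G [HG HFG]].
  destruct (HG (eps / 2) ltac:(lra)) as [n [b Hb]]. exists n, b. intros z Hz.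
  specialize (HFG z Hz). specialize (Hb z Hz).
  set (P := Csum _ _) in *.
  replace (F z - P)%C with ((F z - G z) + (G z - P))%C by ring.
  eapply Rle_trans; [apply Cmod_triangle|lra].
Qed.

Lemma polynomial_pad (b : nat -> C) (n m : nat) (z : C) : (n <= m)%nat ->
  Csum (fun k => (if (k <? n)%nat then b k else RtoC 0) * z ^ k)%C (seq 0 m) =
  Csum (fun k => b k * z ^ k)%C (seq 0 n).
Proof.
  intros L. replace m with (n + (m - n))%nat by lia. rewrite seq_app, Csum_app.
  rewrite (Csum_zero _ (seq (0 + n) _)).
  - rewrite Cplus_0_r. apply Csum_ext. intros k Hk. apply in_seq in Hk.
    destruct (Nat.ltb_spec k n); [reflexivity|lia].
  - intros k Hk. apply in_seq in Hk. destruct (Nat.ltb_spec k n); [lia|ring].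
Qed.

Lemma approximable_plus F G rho : polynomially_approximable F rho -> polynomially_approximable G rho ->
  polynomially_approximable (fun z => F z + G z)%C rho.
Proof.
  intros HF HG eps He.
  destruct (HF (eps / 2) ltac:(lra)) as [n [b Hb]]. destruct (HG (eps / 2) ltac:(lra)) as [m [c Hc]].
  exists (n + m)%nat, (fun k => (if (k <? n)%nat then b k else RtoC 0) + (if (k <? m)%nat then c k else RtoC 0))%C.
  intros z Hz. specialize (Hb z Hz). specialize (Hc z Hz).
  rewrite (Csum_ext _ (fun k => (if (k <? n)%nat then b k else RtoC 0) * z ^ k +
    (if (k <? m)%nat then c k else RtoC 0) * z ^ k)%C) by (intros; ring).
  rewrite Csum_plus, !polynomial_pad by lia.
  set (P := Csum (fun k => b k * z ^ k)%C (seq 0 n)) in *. set (Q := Csum (fun k => c k * z ^ k)%C (seq 0 m)) in *.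
  replace (F z + G z - (P + Q))%C with ((F z - P) + (G z - Q))%C by ring.
  eapply Rle_trans; [apply Cmod_triangle|]. lra.
Qed.

Lemma approximable_Cexp (a b : C) rho : 0 <= rho ->
  polynomially_approximable (fun z => a * Cexp (b * z))%C rho.
Proof.
  intros Hr eps He.
  destruct (pow_fact_lim_0 (Cmod b * rho) (Cmod a * exp (Cmod b * rho)) eps) as [n Hn];
    [pose proof (Cmod_ge_0 b); nra|pose proof (Cmod_ge_0 a); pose proof (exp_pos (Cmod b * rho)); nra|exact He|].
  specialize (Hn n (Nat.le_refl _)).
  exists n, (fun k => a * (b ^ k / RtoC (INR (fact k))))%C. intros z Hz.
  rewrite (Csum_ext _ (fun k => a * ((b * z) ^ k / RtoC (INR (fact k))))%C).
  2:{ intros k _. rewrite Cpow_mult_l. unfold Cdiv. ring. }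
  rewrite Csum_scal. fold (exp_poly n (b * z)).
  replace (a * Cexp (b * z) - a * exp_poly n (b * z))%C with (a * (Cexp (b * z) - exp_poly n (b * z)))%C by ring.
  rewrite Cmod_mult. eapply Rle_trans; [|exact Hn].
  eapply Rle_trans; [apply Rmult_le_compat_l; [apply Cmod_ge_0|exact (Cexp_taylor_le b z n rho Hz)]|].
  right. ring.
Qed.

Lemma approximable_Csum {A : Type} (F : A -> C -> C) (l : list A) rho :
  (forall a, List.In a l -> polynomially_approximable (F a) rho) ->
  polynomially_approximable (fun z => Csum (fun a => F a z) l) rho.
Proof.
  induction l as [|a l IH]; intros H.
  - intros eps He. exists 0%nat, (fun _ => RtoC 0). intros z _. simpl.
    replace (0 - 0)%C with (RtoC 0) by ring. rewrite Cmod_0. lra.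
  - apply (approximable_plus (F a) (fun z => Csum (fun a => F a z) l)); auto using in_eq, in_cons.
Qed.

Lemma npow_2_minus n z : npow n (2 - z) = (RtoC (exp (- 2 * ln (INR n))) * Cexp (RtoC (ln (INR n)) * z))%C.
Proof.
  unfold npow. rewrite <- Cexp_RtoC, <- Cexp_add. f_equal. apply injective_projections; simpl; ring.
Qed.

Lemma Re_2_minus z rho : Cmod z <= rho -> 2 - rho <= Re (2 - z)%C.
Proof. intros H. rewrite Re_minus. simpl (Re 2). pose proof (Re_le_Cmod z). lra. Qed.

Lemma Cmod_2_minus z rho : Cmod z <= rho -> Cmod (2 - z) <= 2 + rho.
Proof.
  intros H. eapply Rle_trans; [apply Cmod_triangle|]. rewrite Cmod_opp, Cmod_R, Rabs_right by lra. lra.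
Qed.

Section NonprincipalL.
Variables (q : nat) (chi : nat -> C).
Hypotheses (Hq : (2 <= q)%nat) (H : dirichlet_character q chi) (Hne : chi <> principal_character q).

(** The partial sums are finite combinations of exponentials in z. For |z| <= rho < 3/2 one has Re(2
    - z) > 1/2 and |2 - z| < 7/2, so the tail is uniformly small; the quotient 7 plus 1 gives the 8,
    here and in [Lfun_disc_bound]. *)
Lemma Lfun_approximable rho : 0 <= rho < 3 / 2 ->
  polynomially_approximable (fun z => Lfun chi (2 - z)) rho.
Proof.
  intros Hr. apply approximable_limit. intros eps He.
  destruct (exp_neg_ln_lim (1/2) (INR q * 8) ltac:(lra)) with (eps := eps) as [N HN];
    [pose proof (pos_INR q); lra|exact He|].
  specialize (HN N (Nat.le_refl _)).
  exists (fun z => dsum chi (2 - z) 1 N). split.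
  - apply (approximable_ext (fun z => Csum (fun n => (chi n * RtoC (exp (- 2 * ln (INR n)))) * Cexp (RtoC (ln (INR n)) * z))%C (seq 1 N))).
    + intros z _. apply Csum_ext. intros n _. rewrite npow_2_minus. ring.
    + apply (approximable_Csum (fun n z => (chi n * RtoC (exp (- 2 * ln (INR n)))) * Cexp (RtoC (ln (INR n)) * z))%C).
      intros n _. apply approximable_Cexp. lra.
  - intros z Hz. pose proof (Re_2_minus z rho Hz). pose proof (Cmod_2_minus z rho Hz).
    eapply Rle_trans; [apply (Lfun_tail q); auto; lra|].
    eapply Rle_trans; [|exact HN].
    assert (Hs : 0 < Re (2 - z)%C) by lra.
    assert (Cmod (2 - z) / Re (2 - z)%C <= 7).
    { apply Rmult_le_reg_r with (Re (2 - z)%C); [lra|]. unfold Rdiv. rewrite Rmult_assoc, Rinv_l by lra. lra. }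
    pose proof (pos_INR q) as Pq.
    assert (0 <= Cmod (2 - z) / Re (2 - z)%C) by (apply Rdiv_le_0_compat; [apply Cmod_ge_0|lra]).
    apply Rmult_le_compat; [|left; apply exp_pos| |].
    + apply Rmult_le_pos; lra.
    + apply Rmult_le_compat_l; lra.
    + apply exp_le_compat.
      assert (0 <= ln (INR (S N))).
      { rewrite <- ln_1. apply ln_le; [lra|]. change 1 with (INR 1). apply le_INR. lia. }
      nra.
Qed.

Lemma Lfun_disc_bound rho z : 0 <= rho < 3 / 2 -> Cmod z <= rho -> Cmod (Lfun chi (2 - z)) <= 8 * INR q.
Proof.
  intros Hr Hz. pose proof (Re_2_minus z rho Hz). pose proof (Cmod_2_minus z rho Hz).
  eapply Rle_trans; [apply (Lfun_bound q); auto; lra|].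
  rewrite (Rmult_comm 8). apply Rmult_le_compat_l; [apply pos_INR|].
  assert (Cmod (2 - z) / Re (2 - z)%C <= 7); [|lra].
  apply Rmult_le_reg_r with (Re (2 - z)%C); [lra|]. unfold Rdiv. rewrite Rmult_assoc, Rinv_l by lra. lra.
Qed.

(** The term n = 2 has modulus at most 1/4 and those with n >= 3 add up to at most 1/2, which leaves
    1/4 of the first term. *)
Lemma Lfun_at_2 : 1 / 4 <= Cmod (Lfun chi 2).
Proof.
  pose proof (dirichlet_series_tail_le chi 2 _ 2 _ (Lfun_series q chi 2 Hq H Hne ltac:(simpl; lra))
    (fun n => dsum_tail_abs chi 2 2 n (fun k => char_Cmod_le_1 q chi k ltac:(lia) H) ltac:(simpl; lra) ltac:(lia))) as T.
  simpl (Re 2) in T. replace (1 - 2) with (- (1)) in T by ring. replace (/ (2 - 1)) with 1 in T by field.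
  replace (exp (- (1) * ln (INR 2))) with (/ 2) in T.
  2:{ replace (- (1) * ln (INR 2)) with (- ln (INR 2)) by ring. rewrite exp_Ropp, exp_ln; simpl; lra. }
  unfold dsum in T. cbn [seq Csum fold_right] in T. rewrite npow_1, (char_1 q chi H) in T.
  assert (E : Cmod (chi 2%nat * npow 2 2) <= 1 / 4).
  { rewrite Cmod_mult, Cmod_npow. simpl (Re 2).
    replace (exp (- (2) * ln (INR 2))) with (1 / 4).
    - pose proof (char_Cmod_le_1 q chi 2 ltac:(lia) H). lra.
    - replace (- (2) * ln (INR 2)) with (- (ln (INR 2) + ln (INR 2))) by ring.
      rewrite exp_Ropp, exp_plus, exp_ln by (simpl; lra). simpl. field. }
  set (c := (chi 2%nat * npow 2 2)%C) in *. set (l := Lfun chi 2) in *.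
  pose proof (Cmod_triangle l (- (l - (1 * 1 + (c + 0))) + - c)) as T1.
  replace (l + (- (l - (1 * 1 + (c + 0))) + - c))%C with (RtoC 1) in T1 by ring.
  pose proof (Cmod_triangle (- (l - (1 * 1 + (c + 0)))) (- c)) as T2.
  rewrite !Cmod_opp in *. rewrite Cmod_1 in T1. lra.
Qed.

Lemma Lfun_zero_free : GRH -> character_mul chi chi <> principal_character q ->
  forall z, Cmod z < 3 / 2 -> Lfun chi (2 - z) <> RtoC 0.
Proof.
  intros G Hsq z Hz Z. pose proof (Re_2_minus z (Cmod z) (Rle_refl _)) as Hs.
  set (s := (2 - z)%C) in *.
  destruct (Rtotal_order (Re s) 1) as [L|[E|L]].
  - pose proof (G q chi (Lfun chi) ltac:(lia) H (Lfun_is_L_function q chi Hq H Hne) s ltac:(lra) Z). lra.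
  - apply (Lfun_nonzero_line q chi (Im s) Hq H Hsq). rewrite <- Z. f_equal.
    rewrite <- E. destruct s; reflexivity.
  - apply (dirichlet_series_nonzero q chi s (Lfun chi s)); auto; [lia|].
    apply (Lfun_series q); auto; lra.
Qed.

(** The real part of the logarithm of the Euler product over p <= N, with each series for -log(1 -
    w) cut after M terms. *)
Definition log_poly (N M : nat) (z : C) : R :=
  Rsum (fun p => Rsum (fun m => Re ((chi p * npow p (2 - z)) ^ m / RtoC (INR m))%C) (seq 1 M)) (primes_upto N).

Lemma euler_factor_small p z : prime (Z.of_nat p) -> Cmod z <= 1 / 2 -> Cmod (chi p * npow p (2 - z)) <= 1 / 2.
Proof.
  intros Hp Hz. rewrite Cmod_mult, Cmod_npow. pose proof (Re_2_minus z _ Hz) as Hs.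
  pose proof (char_Cmod_le_1 q chi p ltac:(lia) H). pose proof (Cmod_ge_0 (chi p)).
  assert (P2 : 2 <= INR p) by (apply prime_ge_2 in Hp; change 2 with (INR 2); apply le_INR; lia).
  assert (E : exp (- Re (2 - z)%C * ln (INR p)) <= 1 / 2).
  { apply Rle_trans with (exp (- ln 2)).
    - apply exp_le_compat. assert (ln 2 <= ln (INR p)) by (apply ln_le; lra).
      assert (0 < ln 2) by (rewrite <- ln_1; apply ln_increasing; lra). nra.
    - rewrite exp_Ropp, exp_ln; lra. }
  pose proof (exp_pos (- Re (2 - z)%C * ln (INR p))). nra.
Qed.

(** Here Re s >= 3/2, so each p^(-s) has modulus at most 1/2. [M0] depends on N because the errors
    2^(-M) are summed over up to N primes. *)
Lemma log_poly_close eps : 0 < eps -> exists N0, forall N, (N0 <= N)%nat -> exists M0, forall M, (M0 <= M)%nat ->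
  forall z, Cmod z <= 1 / 2 -> Rabs (log_poly N M z - ln (Cmod (Lfun chi (2 - z)))) <= eps.
Proof.
  intros He.
  destruct (exp_neg_ln_lim (1/2) 2 ltac:(lra) ltac:(lra) (Rmin (1/2) (eps / 4))) as [N0 HN0];
    [apply Rmin_glb_lt; lra|].
  exists (S N0). intros N HN.
  destruct (pow_lim_0 (1/2) (INR N) (eps / 2) ltac:(lra) (pos_INR N) ltac:(lra)) as [M0 HM0].
  exists M0. intros M HM z Hz.
  pose proof (Re_2_minus z _ Hz) as Hs. set (s := (2 - z)%C) in *.
  assert (HE : Cmod (Lfun chi s * euler chi s N - 1) <= Rmin (1/2) (eps / 4)).
  { eapply Rle_trans; [apply (euler_product q); [lia|exact H|apply (Lfun_series q); auto; lra|lra|lia]|].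
    destruct N as [|N]; [lia|]. specialize (HN0 N ltac:(lia)). eapply Rle_trans; [|exact HN0].
    apply Rmult_le_compat; [left; apply Rinv_0_lt_compat; lra|left; apply exp_pos| |].
    - replace 2 with (/ (1 / 2)) by field. apply Rinv_le_contravar; lra.
    - apply exp_le_compat. assert (0 <= ln (INR (S N))).
      { rewrite <- ln_1. apply ln_le; [lra|]. change 1 with (INR 1). apply le_INR. lia. } nra. }
  pose proof (Rmin_l (1/2) (eps / 4)) as M1. pose proof (Rmin_r (1/2) (eps / 4)) as M2.
  set (L := Lfun chi s) in *. set (E := euler chi s N) in *.
  assert (A0 : Rabs (Cmod (L * E) - 1) <= Cmod (L * E - 1)).
  { pose proof (Cmod_triangle (L * E - 1) 1) as T1. replace (L * E - 1 + 1)%C with (L * E)%C in T1 by ring.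
    pose proof (Cmod_triangle (L * E) (- (L * E - 1))) as T2. replace (L * E + - (L * E - 1))%C with (RtoC 1) in T2 by ring.
    rewrite Cmod_opp in T2. rewrite Cmod_1 in *. apply Rabs_le. lra. }
  assert (A1 : 1 / 2 <= Cmod (L * E)) by (apply Rabs_le_between in A0; lra).
  pose proof (ln_dist_le (Cmod (L * E)) 1 (1/2) ltac:(lra) A1 ltac:(lra)) as A2. rewrite ln_1 in A2.
  assert (A3 : Rabs (ln (Cmod (L * E)) - 0) <= eps / 2) by lra.
  assert (PE : 0 < Cmod E /\ 0 < Cmod L).
  { rewrite Cmod_mult in A1. pose proof (Cmod_ge_0 E) as [PE|PE]; pose proof (Cmod_ge_0 L) as [PL|PL];
      [split; assumption|rewrite <- PL in A1; lra|rewrite <- PE in A1; lra|rewrite <- PL in A1; lra]. }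
  rewrite Cmod_mult, ln_mult in A3 by tauto.
  assert (A4 : forall l, (forall p, List.In p l -> prime (Z.of_nat p)) ->
     Rabs (ln (Cmod (Cprod (fun p => 1 - chi p * npow p s)%C l)) +
       Rsum (fun p => Rsum (fun m => Re ((chi p * npow p s) ^ m / RtoC (INR m))%C) (seq 1 M)) l)
     <= INR (length l) * (1 / 2) ^ M).
  { induction l as [|p l IH]; intros Hl.
    - simpl. rewrite Cmod_1, ln_1, Rplus_0_l, Rabs_R0. lra.
    - specialize (IH (fun p Hp => Hl p (or_intror Hp))).
      assert (Hp : prime (Z.of_nat p)) by (apply Hl; now left).
      pose proof (euler_factor_small p z Hp Hz) as W. fold s in W.
      assert (NZ : forall p', prime (Z.of_nat p') -> 0 < Cmod (1 - chi p' * npow p' s)).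
      { intros p' Hp'. pose proof (euler_factor_small p' z Hp' Hz) as W'. fold s in W'.
        pose proof (Cmod_triangle (1 - chi p' * npow p' s) (chi p' * npow p' s)) as T.
        replace (1 - chi p' * npow p' s + chi p' * npow p' s)%C with (RtoC 1) in T by ring.
        rewrite Cmod_1 in T. lra. }
      assert (NZl : 0 < Cmod (Cprod (fun p => 1 - chi p * npow p s)%C l)).
      { clear - Hl NZ. induction l as [|p' l IH]; simpl; [rewrite Cmod_1; lra|].
        rewrite Cmod_mult. apply Rmult_lt_0_compat.
        - apply NZ. apply Hl. right. now left.
        - apply IH. intros x [<-|Hx]; apply Hl; [now left|right; now right]. }
      cbn [Cprod Rsum fold_right]. fold (Rsum (fun p => Rsum (fun m => Re ((chi p * npow p s) ^ m / RtoC (INR m))%C) (seq 1 M)) l).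
      fold (Cprod (fun p => 1 - chi p * npow p s)%C l).
      rewrite Cmod_mult, ln_mult by auto.
      pose proof (ln_Cmod_expansion (chi p * npow p s) M ltac:(lra)) as X.
      assert (EX : Rsum (fun m => Re ((chi p * npow p s) ^ m / RtoC (INR m))%C) (seq 1 M) =
        Re (Csum (fun k => (chi p * npow p s) ^ S k / RtoC (INR (S k)))%C (seq 0 M))).
      { rewrite Re_Csum, (Rsum_seq_from _ 1). reflexivity. }
      rewrite EX. set (w := (chi p * npow p s)%C) in *.
      assert (Y : Cmod w ^ S M / (1 - Cmod w) <= (1 / 2) ^ M).
      { pose proof (Cmod_ge_0 w). apply Rmult_le_reg_r with (1 - Cmod w); [lra|].
        unfold Rdiv at 1. rewrite Rmult_assoc, Rinv_l, Rmult_1_r by lra. simpl.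
        assert (Cmod w ^ M <= (1/2) ^ M) by (apply pow_incr; lra).
        assert (0 <= Cmod w ^ M) by (apply pow_le; lra). nra. }
      change (length (p :: l)) with (S (length l)). rewrite S_INR.
      apply Rabs_le_between in X, IH. apply Rabs_le. lra. }
  specialize (A4 (primes_upto N) (fun p Hp => proj1 (proj1 (In_primes_upto p N) Hp))).
  fold (euler chi s N) in A4. fold E in A4.
  assert (EL : Rsum (fun p => Rsum (fun m => Re ((chi p * npow p s) ^ m / RtoC (INR m))%C) (seq 1 M)) (primes_upto N) =
    log_poly N M z) by reflexivity.
  rewrite EL in A4.
  assert (LenN : INR (length (primes_upto N)) <= INR N).
  { apply le_INR. unfold primes_upto. eapply Nat.le_trans; [apply filter_length_le|]. rewrite length_seq. lia. }
  specialize (HM0 M HM).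
  assert (0 <= (1/2) ^ M) by (apply pow_le; lra).
  assert (INR (length (primes_upto N)) * (1 / 2) ^ M <= eps / 2) by nra.
  apply Rabs_le_between in A3, A4. apply Rabs_le. lra.
Qed.

End NonprincipalL.

(** * The Taylor polynomial of log L(2 - z, chi) *)

Definition exp_trunc (K : nat) (x : R) : R := Rsum (fun k => x ^ k / INR (fact k)) (seq 0 K).

(** The coefficient of chi(p^m). It comes from p^(-m(2-z)) = p^(-2m) exp(z m log p), with the
    exponential cut at degree K and z = t. *)
Definition pp_coef (K : nat) (t : R) (p m : nat) : R :=
  exp (- 2 * (INR m * ln (INR p))) / INR m * exp_trunc K (t * (INR m * ln (INR p))).

(* The Taylor polynomial of degree < K at z = 0 of log L(2 - z, chi), evaluated at t. *)
Definition log_char_poly (K : nat) (t : R) (N M : nat) (chi : nat -> C) : C :=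
  Csum (fun p => Csum (fun m => RtoC (pp_coef K t p m) * chi (p ^ m)%nat)%C (seq 1 M)) (primes_upto N).

Definition log_poly_coef (chi : nat -> C) (N M k : nat) : C :=
  Csum (fun p => Csum (fun m => chi (p ^ m)%nat * RtoC (exp (- 2 * (INR m * ln (INR p))) / INR m) *
    (RtoC (INR m * ln (INR p)) ^ k / RtoC (INR (fact k))))%C (seq 1 M)) (primes_upto N).

Lemma harm_exp_log_poly q chi N M rho : dirichlet_character q chi -> 0 <= rho ->
  harm_exp (log_poly chi N M) (log_poly_coef chi N M) rho.
Proof.
  intros H Hr.
  apply (harm_exp_Rsum (fun p z => Rsum (fun m => Re ((chi p * npow p (2 - z)) ^ m / RtoC (INR m))%C) (seq 1 M))).
  intros p _.
  apply (harm_exp_Rsum (fun m z => Re ((chi p * npow p (2 - z)) ^ m / RtoC (INR m))%C)).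
  intros m Hm. apply in_seq in Hm.
  apply (harm_exp_ext (fun z => Re (chi (p ^ m)%nat * RtoC (exp (- 2 * (INR m * ln (INR p))) / INR m) *
    Cexp (RtoC (INR m * ln (INR p)) * z))%C)); [|now apply harm_exp_Cexp].
  intros z _. f_equal. rewrite npow_2_minus, !Cpow_mult_l, (char_pow q), Cexp_pow, <- RtoC_pow, exp_pow_INR by assumption.
  rewrite RtoC_div by (apply not_0_INR; lia). rewrite RtoC_mult.
  replace (INR m * (- 2 * ln (INR p))) with (- 2 * (INR m * ln (INR p))) by ring.
  replace (RtoC (INR m) * (RtoC (ln (INR p)) * z))%C with (RtoC (INR m) * RtoC (ln (INR p)) * z)%C by ring.
  unfold Cdiv. ring.
Qed.

Lemma log_poly_coef_sum chi N M K t :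
  Csum (fun k => log_poly_coef chi N M k * RtoC t ^ k)%C (seq 0 K) = log_char_poly K t N M chi.
Proof.
  unfold log_char_poly, log_poly_coef.
  rewrite (Csum_ext _ (fun k => Csum (fun p => Csum (fun m => RtoC (exp (- 2 * (INR m * ln (INR p))) / INR m) * chi (p ^ m)%nat *
     RtoC ((t * (INR m * ln (INR p))) ^ k / INR (fact k)))%C (seq 1 M)) (primes_upto N))).
  - rewrite Csum_swap. apply Csum_ext. intros p _. rewrite Csum_swap. apply Csum_ext. intros m _.
    rewrite Csum_scal, Csum_RtoC. unfold pp_coef, exp_trunc. rewrite RtoC_mult. ring.
  - intros k _. rewrite Cmult_comm, <- Csum_scal. apply Csum_ext. intros p _.
    rewrite <- Csum_scal. apply Csum_ext. intros m _.
    generalize (RtoC (exp (- 2 * (INR m * ln (INR p))) / INR m)). intros c.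
    generalize (INR m * ln (INR p)). intros y.
    rewrite RtoC_div, RtoC_pow, RtoC_mult, Cpow_mult_l by apply INR_fact_neq_0. unfold Cdiv. ring.
Qed.

Lemma ln_2_le_1 : 0 < ln 2 <= 1.
Proof.
  split; [rewrite <- ln_1; apply ln_increasing; lra|].
  pose proof (exp_ineq1_le (ln 2)) as E. rewrite exp_ln in E by lra. lra.
Qed.

(** The truncated Euler product is understood for |z| <= 1/2, while t > 1. Its Taylor coefficients
    are carried to [t] through the zero-free disc of radius [rho], taken halfway between [t] and
    3/2. *)
Lemma grh_log_lower sigma q chi K : 1 / 2 < sigma < 1 -> (2 <= q)%nat -> dirichlet_character q chi ->
  character_mul chi chi <> principal_character q -> GRH -> (1 <= K)%nat ->
  let t := 2 - sigma in let rho := (t + 3 / 2) / 2 in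
  exists N0, forall N, (N0 <= N)%nat -> exists M0, forall M, (M0 <= M)%nat ->
    Re (log_char_poly K t N M chi) <=
      ln (Cmod (Lfun chi (RtoC sigma))) + 2 * (ln (INR q) + 8) * ((t / rho) ^ K / (1 - t / rho)) + 1.
Proof.
  intros Hs Hq H Hsq G HK t rho.
  assert (Hne : chi <> principal_character q).
  { intro E. apply Hsq. rewrite E. apply character_mul_principal_l, principal_is_character. }
  assert (Ht : 1 < t < 3 / 2) by (unfold t; lra).
  assert (Hrho : t < rho < 3 / 2) by (unfold rho; lra).
  set (Sm := Rsum (fun k => (t / (1 / 2)) ^ k) (seq 0 K)).
  assert (HSm : 0 <= Sm) by (apply Rsum_nonneg; intros k _; apply pow_le; lra).
  (* Chosen so that the two errors depending on [eps] add up to exactly 1. *)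
  set (eps := / (2 + 8 * Sm)).
  assert (He : 0 < eps) by (apply Rinv_0_lt_compat; lra).
  assert (He1 : 2 * eps + 8 * eps * Sm = 1) by (unfold eps; field; lra).
  destruct (log_poly_close q chi Hq H Hne eps He) as [N0 HN0].
  exists N0. intros N HN. destruct (HN0 N HN) as [M0 HM0]. exists M0. intros M HM.
  pose proof (ln_modulus_truncation (fun z => Lfun chi (2 - z)) (log_poly chi N M) (log_poly_coef chi N M)
    rho (1/2) (8 * INR q) t eps K ltac:(lra) ltac:(lra) He HK
    (Lfun_approximable q chi Hq H Hne rho ltac:(lra))
    (fun z Hz => Lfun_zero_free q chi Hq H Hne G Hsq z ltac:(lra))
    (fun z Hz => Lfun_disc_bound q chi Hq H Hne rho z ltac:(lra) Hz)
    (harm_exp_log_poly q chi N M (1/2) H ltac:(lra)) (HM0 M HM)) as T.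
  cbv beta in T. rewrite log_poly_coef_sum in T. fold Sm in T.
  replace (2 - RtoC t)%C with (RtoC sigma) in T by (unfold t; rewrite RtoC_minus; ring).
  replace (2 - RtoC 0)%C with (RtoC 2) in T by ring.
  assert (Hlam : 0 <= t / rho < 1).
  { split; [apply Rdiv_le_0_compat; lra|]. apply Rmult_lt_reg_r with rho; [lra|].
    unfold Rdiv. rewrite Rmult_assoc, Rinv_l; lra. }
  assert (HX : 0 <= (t / rho) ^ K / (1 - t / rho)).
  { apply Rdiv_le_0_compat; [apply pow_le; lra|lra]. }
  set (X := (t / rho) ^ K / (1 - t / rho)) in *.
  assert (Pq : 2 <= INR q) by (change 2 with (INR 2); apply le_INR; lia).
  pose proof ln_2_le_1 as L2.
  assert (HB : ln (8 * INR q) <= 3 + ln (INR q)).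
  { rewrite ln_mult by lra. replace 8 with (2 * 2 * 2) by ring. rewrite !ln_mult by lra. lra. }
  assert (H2 : - 2 <= ln (Cmod (Lfun chi 2))).
  { apply Rle_trans with (ln (/ (2 * 2))).
    - rewrite ln_Rinv, ln_mult by lra. lra.
    - apply ln_le; [lra|]. pose proof (Lfun_at_2 q chi Hq H Hne). lra. }
  assert (He2 : eps <= 1 / 2) by nra.
  (* The 8 has room to spare: 3 for log 8, 2 for -log |L(2, chi)| and 1 for 2 eps. *)
  assert (Y : 2 * (ln (8 * INR q) - ln (Cmod (Lfun chi 2)) + 2 * eps) * X <= 2 * (ln (INR q) + 8) * X).
  { apply Rmult_le_compat_r; [exact HX|]. lra. }
  apply Rabs_le_between in T. lra.
Qed.

(** * Positivity and resonance *)

Lemma NoDup_incl_perm {A : Type} (l1 l2 : list A) : NoDup l1 -> incl l1 l2 ->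
  exists l, Permutation l2 (l1 ++ l).
Proof.
  revert l2. induction l1 as [|a l1 IH]; intros l2 Hn Hi.
  - exists l2. apply Permutation_refl.
  - inversion Hn as [|? ? Ha Hn']. subst.
    destruct (in_split a l2 (Hi a (or_introl eq_refl))) as [m1 [m2 ->]].
    destruct (IH (m1 ++ m2) Hn') as [l Hl].
    { intros x Hx. specialize (Hi x (or_intror Hx)). apply in_app_iff in Hi. apply in_app_iff.
      destruct Hi as [Hi|[->|Hi]]; [now left|contradiction|now right]. }
    exists l. simpl. apply Permutation_sym, Permutation_cons_app, Permutation_sym, Hl.
Qed.

Lemma Cprod_perm {A : Type} (f : A -> C) l m : Permutation l m -> Cprod f l = Cprod f m.
Proof. induction 1; simpl; try congruence; ring. Qed.

Lemma Cprod_map {A B : Type} (g : A -> B) (f : B -> C) l :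
  Cprod f (map g l) = Cprod (fun a => f (g a)) l.
Proof. induction l as [|a l IH]; simpl; [|rewrite IH]; reflexivity. Qed.

Lemma Cprod_scal {A : Type} (c : C) (f : A -> C) l :
  Cprod (fun a => c * f a)%C l = (c ^ length l * Cprod f l)%C.
Proof. induction l as [|a l IH]; simpl; [ring|rewrite IH; ring]. Qed.

Lemma Cprod_nonzero {A : Type} (f : A -> C) l :
  (forall a, List.In a l -> f a <> RtoC 0) -> Cprod f l <> RtoC 0.
Proof.
  induction l as [|a l IH]; intros Hf; simpl.
  - intro E. apply RtoC_inj in E. lra.
  - apply Cmult_neq_0; auto using in_eq, in_cons.
Qed.

Lemma cardinal_list {U : Type} (X : Ensemble U) n : cardinal U X n ->
  exists l, NoDup l /\ length l = n /\ forall x, List.In x l <-> Ensembles.In U X x.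
Proof.
  induction 1 as [|A n HA [l [Hn [Hl Hi]]] x Hx].
  - exists nil. split; [constructor|split; [reflexivity|]]. intros x. split; [contradiction|intros []].
  - exists (x :: l). split; [constructor; [rewrite Hi; exact Hx|exact Hn]|].
    split; [simpl; congruence|]. intros y. simpl. rewrite Hi. unfold Add. split.
    + intros [->|Hy]; [right; constructor|left; exact Hy].
    + intros [z Hz|z Hz]; [now right|left]. now inversion Hz.
Qed.

(* Nonnegative combinations of the evaluations chi |-> chi n: sums over X of such
   functions are nonnegative. *)
Inductive pos_type (X : Ensemble (nat -> C)) : ((nat -> C) -> C) -> Prop :=
| pos_eval n : pos_type X (fun chi => chi n)
| pos_add f g : pos_type X f -> pos_type X g -> pos_type X (fun chi => f chi + g chi)%C
| pos_scal r f : 0 <= r -> pos_type X f -> pos_type X (fun chi => RtoC r * f chi)%C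
| pos_ext f g : pos_type X f -> (forall chi, X chi -> f chi = g chi) -> pos_type X g.

Section Resonance.
Variables (q : nat) (X : Ensemble (nat -> C)) (l : list (nat -> C)).
Hypotheses (Hq : (2 <= q)%nat) (HX : character_subgroup q X)
  (Hnd : NoDup l) (Hl : forall chi, List.In chi l <-> X chi).

Lemma X_character chi : X chi -> dirichlet_character q chi.
Proof. intros H. now apply (proj1 HX). Qed.

(** Rests on chi(n) chi(m) = chi(n m). With [pos_conj] it brings products such as f conj(g) under
    the positivity principle. *)
Lemma pos_mul f g : pos_type X f -> pos_type X g -> pos_type X (fun chi => f chi * g chi)%C.
Proof.
  intros Hf Hg. induction Hf as [n|f1 f2 _ IH1 _ IH2|r f Hr _ IH|f1 f2 _ IH E].
  - induction Hg as [m|g1 g2 _ IH1 _ IH2|r g Hr _ IH|g1 g2 _ IH E].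
    + apply (pos_ext X (fun chi => chi (n * m)%nat)); [apply pos_eval|].
      intros chi Hc. apply X_character in Hc. apply Hc.
    + eapply pos_ext; [exact (pos_add X _ _ IH1 IH2)|]. intros chi _. simpl. ring.
    + eapply pos_ext; [exact (pos_scal X r _ Hr IH)|]. intros chi _. simpl. ring.
    + eapply pos_ext; [exact IH|]. intros chi Hc. simpl. now rewrite E.
  - eapply pos_ext; [exact (pos_add X _ _ IH1 IH2)|]. intros chi _. simpl. ring.
  - eapply pos_ext; [exact (pos_scal X r _ Hr IH)|]. intros chi _. simpl. ring.
  - eapply pos_ext; [exact IH|]. intros chi Hc. simpl. now rewrite E.
Qed.

Lemma pos_conj f : pos_type X f -> pos_type X (fun chi => Cconj (f chi)).
Proof.
  induction 1 as [n|f1 f2 _ IH1 _ IH2|r f Hr _ IH|f1 f2 _ IH E].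
  - destruct (char_conj q n Hq) as [n' Hn'].
    apply (pos_ext X (fun chi => chi n')); [apply pos_eval|].
    intros chi Hc. symmetry. apply Hn'. now apply X_character.
  - eapply pos_ext; [exact (pos_add X _ _ IH1 IH2)|]. intros chi _. simpl. now rewrite Cplus_conj.
  - eapply pos_ext; [exact (pos_scal X r _ Hr IH)|]. intros chi _. simpl. rewrite Cmult_conj.
    f_equal. apply injective_projections; simpl; ring.
  - eapply pos_ext; [exact IH|]. intros chi Hc. simpl. now rewrite E.
Qed.

Lemma pos_const r : 0 <= r -> pos_type X (fun _ => RtoC r).
Proof.
  intros Hr. eapply pos_ext; [exact (pos_scal X r _ Hr (pos_eval X 1))|].
  intros chi Hc. simpl. rewrite (char_1 q) by (now apply X_character). ring.
Qed.

Lemma pos_Csum {A : Type} (f : A -> (nat -> C) -> C) (s : list A) :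
  (forall a, List.In a s -> pos_type X (f a)) -> pos_type X (fun chi => Csum (fun a => f a chi) s).
Proof.
  induction s as [|a s IH]; intros H.
  - apply pos_const. lra.
  - apply (pos_add X (f a)); auto using in_eq, in_cons.
Qed.

Lemma X_mul_permutation chi : X chi -> Permutation (map (character_mul chi) l) l.
Proof.
  intros Hc. apply NoDup_Permutation_bis.
  - apply FinFun.Injective_map_NoDup_in; [|exact Hnd].
    intros a b Ha Hb E. apply Hl, X_character in Ha. apply Hl, X_character in Hb.
    apply functional_extensionality. intros n.
    apply (f_equal (fun f => f n)) in E. unfold character_mul in E.
    destruct (Nat.eq_dec (Nat.gcd n q) 1) as [G|G].
    + assert (N : chi n <> RtoC 0) by (apply (X_character chi Hc); exact G).
      rewrite <- (Cmult_1_l (a n)), <- (Cmult_1_l (b n)), <- (Cinv_l (chi n) N), <- !Cmult_assoc, E. reflexivity.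
    + rewrite (char_nonunit q a), (char_nonunit q b); auto.
  - rewrite length_map. lia.
  - intros x Hx. apply in_map_iff in Hx as [a [<- Ha]]. apply Hl. apply HX; [exact Hc|now apply Hl].
Qed.

(** Orthogonality: the sum is |X| if every character of X is 1 at n, and 0 otherwise. Only its sign
    is kept, so the classes n with sum |X| are never counted. *)
Lemma X_sum_eval n : (exists r, 0 <= r /\ Csum (fun chi => chi n) l = RtoC r).
Proof.
  destruct (Nat.eq_dec (Nat.gcd n q) 1) as [G|G].
  - destruct (classic (exists chi, X chi /\ chi n <> RtoC 1)) as [[chi [Hc N]]|N].
    + exists 0. split; [lra|].
      assert (E : Csum (fun psi => psi n) l = (chi n * Csum (fun psi => psi n) l)%C).
      { rewrite <- (Csum_perm _ _ _ (X_mul_permutation chi Hc)) at 1.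
        rewrite Csum_map, <- Csum_scal. reflexivity. }
      assert (Z : ((chi n - 1) * Csum (fun psi => psi n) l)%C = RtoC 0).
      { transitivity (chi n * Csum (fun psi => psi n) l - Csum (fun psi => psi n) l)%C; [ring|rewrite <- E; ring]. }
      apply Cmod_eq_0. apply (f_equal Cmod) in Z. rewrite Cmod_mult, Cmod_0 in Z.
      apply Rmult_integral in Z as [Z|Z]; [|exact Z]. exfalso. apply N.
      apply Cmod_eq_0 in Z. rewrite <- (Cplus_0_r 1), <- Z. ring.
    + exists (INR (length l)). split; [apply pos_INR|].
      rewrite (Csum_ext _ (fun _ => RtoC 1)).
      * rewrite (Csum_RtoC (fun _ => 1)), Rsum_const. f_equal. ring.
      * intros chi Hc. apply Hl in Hc. apply NNPP. intro E. apply N. exists chi. auto.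
  - exists 0. split; [lra|]. apply Csum_zero. intros chi Hc. apply Hl, X_character in Hc.
    now apply (char_nonunit q).
Qed.

Lemma pos_sum f : pos_type X f -> 0 <= Re (Csum f l).
Proof.
  induction 1 as [n|f1 f2 _ IH1 _ IH2|r f Hr _ IH|f1 f2 _ IH E].
  - destruct (X_sum_eval n) as [r [Hr ->]]. exact Hr.
  - rewrite Csum_plus, Re_plus. lra.
  - rewrite Csum_scal, Re_scal. nra.
  - rewrite (Csum_ext f2 f1); [exact IH|]. intros a Ha. symmetry. apply E. now apply Hl.
Qed.

Lemma X_principal : X (principal_character q).
Proof. apply HX. Qed.

Lemma pos_bound f chi : pos_type X f -> X chi -> Cmod (f chi) <= Re (f (principal_character q)).
Proof.
  intros Hf Hc. induction Hf as [n|f1 f2 _ IH1 _ IH2|r f Hr _ IH|f1 f2 _ IH E].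
  - unfold principal_character. destruct (Nat.eqb_spec (Nat.gcd n q) 1) as [G|G].
    + simpl. apply (char_Cmod_le_1 q); [lia|now apply X_character].
    + rewrite (char_nonunit q chi n (X_character chi Hc) G), Cmod_0. simpl. lra.
  - rewrite Re_plus. eapply Rle_trans; [apply Cmod_triangle|lra].
  - rewrite Re_scal, Cmod_mult, Cmod_R, Rabs_right by lra. apply Rmult_le_compat_l; assumption.
  - rewrite <- !E by (exact Hc || apply X_principal). exact IH.
Qed.

Lemma X_length_pos : (1 <= length l)%nat.
Proof.
  pose proof (proj2 (Hl _) X_principal) as H. destruct l; [contradiction|simpl; lia].
Qed.

(** Sum chi(n) over X and over n < q. Summing over n first leaves only the principal character,
    hence at most q; summing over X first gives nonnegative terms, of which n = 1 contributes
    |X|. *)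
Lemma X_length_le_q : (length l <= q)%nat.
Proof.
  apply INR_le.
  assert (P : Re (Csum (fun n => Csum (fun chi => chi n) l) (seq 0 q)) <= INR q).
  { rewrite Csum_swap.
    destruct (in_split _ _ (proj2 (Hl _) X_principal)) as [l1 [l2 E]]. rewrite E.
    rewrite Csum_app. simpl Csum at 2. fold (Csum (fun a => Csum a (seq 0 q)) l2).
    assert (NZ : forall chi, List.In chi (l1 ++ l2) -> Csum chi (seq 0 q) = RtoC 0).
    { intros chi Hc. apply char_sum_zero; [exact Hq| |].
      - apply X_character, Hl. rewrite E. apply in_app_iff in Hc. apply in_app_iff. simpl. tauto.
      - intros ->. rewrite E in Hnd. apply NoDup_remove_2 in Hnd. contradiction. }
    change (Re (Csum (fun chi => Csum chi (seq 0 q)) l1 + (Csum (principal_character q) (seq 0 q) + Csum (fun chi => Csum chi (seq 0 q)) l2))%C <= INR q).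
    rewrite (Csum_zero _ l1), (Csum_zero _ l2) by (intros a Ha; apply NZ, in_app_iff; auto).
    rewrite Cplus_0_l, Cplus_0_r, Re_Csum.
    eapply Rle_trans; [apply (Rsum_le_const _ 1)|rewrite length_seq; lra].
    intros n _. unfold principal_character. destruct (Nat.eqb _ _); simpl; lra. }
  eapply Rle_trans; [|exact P]. rewrite Re_Csum.
  assert (E1 : INR (length l) = Re (Csum (fun chi : nat -> C => chi 1%nat) l)).
  { rewrite (Csum_ext _ (fun _ => RtoC 1)).
    - rewrite (Csum_RtoC (fun _ => 1)), Rsum_const. simpl. ring.
    - intros chi Hc. apply Hl, X_character in Hc. apply (char_1 q chi Hc). }
  rewrite E1.
  replace (seq 0 q) with (0%nat :: 1%nat :: seq 2 (q - 2)).
  - simpl Rsum. fold (Rsum (fun n => Re (Csum (fun chi : nat -> C => chi n) l)) (seq 2 (q - 2))).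
    pose proof (pos_sum _ (pos_eval X 0)).
    assert (0 <= Rsum (fun n => Re (Csum (fun chi : nat -> C => chi n) l)) (seq 2 (q - 2))).
    { apply Rsum_nonneg. intros n _. apply (pos_sum (fun chi => chi n)), pos_eval. }
    lra.
  - replace q with (S (S (q - 2))) at 2 by lia. reflexivity.
Qed.

(** Multiplication by chi permutes X, so the product of all psi(n) is multiplied by chi(n)^|X| and
    yet unchanged. *)
Lemma X_exponent chi n : X chi -> Nat.gcd n q = 1%nat -> (chi n ^ length l)%C = RtoC 1.
Proof.
  intros Hc Hn.
  assert (NZ : Cprod (fun psi => psi n) l <> RtoC 0).
  { apply Cprod_nonzero. intros psi Hp. apply Hl, X_character in Hp. now apply Hp. }
  pose proof (Cprod_perm (fun psi => psi n) _ _ (X_mul_permutation chi Hc)) as E.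
  rewrite Cprod_map in E. unfold character_mul in E. rewrite Cprod_scal in E.
  set (P := Cprod (fun psi : nat -> C => psi n) l) in *.
  rewrite <- (Cmult_1_r (_ ^ _)), <- (Cinv_r P NZ), Cmult_assoc, E. reflexivity.
Qed.

(** * The resonator weight and its positivity *)

Definition geom (n : nat) (chi : nat -> C) : C := (/ (1 - chi n / 2))%C.

Lemma half_denominator (z : C) : Cmod z <= 1 -> 1 / 2 <= Cmod (1 - z / 2).
Proof.
  intros Hz. pose proof (Cmod_triangle (1 - z / 2) (z / 2)) as T.
  replace (1 - z / 2 + z / 2)%C with (RtoC 1) in T by ring.
  assert (N2 : RtoC 2 <> RtoC 0) by (intro E; apply RtoC_inj in E; lra).
  rewrite (Cmod_div z 2 N2), Cmod_1, (Cmod_R 2), (Rabs_right 2) in T by lra. lra.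
Qed.

Lemma half_denominator_nz (z : C) : Cmod z <= 1 -> (1 - z / 2)%C <> RtoC 0.
Proof. intros Hz E. pose proof (half_denominator z Hz) as P. rewrite E, Cmod_0 in P. lra. Qed.

Lemma X_Cmod_le_1 chi n : X chi -> Cmod (chi n) <= 1.
Proof. intros H. apply (char_Cmod_le_1 q); [lia|now apply X_character]. Qed.

(* chi n is a root of unity of order dividing |X|, so the geometric series folds up
   into a finite sum. *)
Lemma pos_geom n : Nat.gcd n q = 1%nat -> pos_type X (geom n).
Proof.
  intros Hn. set (H := length l). pose proof X_length_pos as H1. fold H in H1.
  assert (P2 : (1 / 2) ^ H < 1).
  { apply pow_lt_1_compat; [lra|lia]. }
  apply (pos_ext X (fun chi => RtoC (/ (1 - (1 / 2) ^ H)) * Csum (fun j => RtoC ((1 / 2) ^ j) * chi (n ^ j)%nat) (seq 0 H))%C).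
  - apply pos_scal; [left; apply Rinv_0_lt_compat; lra|].
    apply (pos_Csum (fun j chi => RtoC ((1 / 2) ^ j) * chi (n ^ j)%nat)%C). intros j _.
    apply (pos_scal X _ (fun chi => chi (n ^ j)%nat)); [apply pow_le; lra|apply pos_eval].
  - intros chi Hc. unfold geom. pose proof (half_denominator_nz _ (X_Cmod_le_1 chi n Hc)) as NZ.
    rewrite (Csum_ext _ (fun j => (chi n / 2) ^ j)%C).
    + pose proof (geometric_sum (chi n / 2) H) as G.
      assert (E : ((chi n / 2) ^ H)%C = RtoC ((1 / 2) ^ H)).
      { pose proof (X_exponent chi n Hc Hn) as XE. fold H in XE.
        unfold Cdiv. rewrite Cpow_mult_l, XE, RtoC_pow, Cmult_1_l. f_equal.
        unfold Rdiv. rewrite Rmult_1_l, RtoC_inv by lra. reflexivity. }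
      rewrite E in G.
      assert (NZ2 : RtoC (1 - (1/2) ^ H) <> RtoC 0) by (intro Z; apply RtoC_inj in Z; lra).
      rewrite RtoC_inv by lra.
      replace (Csum (fun j => (chi n / 2) ^ j)%C (seq 0 H)) with (RtoC (1 - (1/2) ^ H) * / (1 - chi n / 2))%C.
      * rewrite Cmult_assoc, Cinv_l by exact NZ2. ring.
      * rewrite RtoC_minus. replace (1 - RtoC ((1 / 2) ^ H))%C with
          ((1 - chi n / 2) * Csum (fun j => (chi n / 2) ^ j)%C (seq 0 H))%C.
        -- field. intro Z. apply NZ. rewrite <- Cmult_1_l at 1. 
           replace (1 - chi n / 2)%C with ((2 - chi n) / 2)%C by field. rewrite Z. field.
        -- transitivity (- ((chi n / 2 - 1) * Csum (fun j => (chi n / 2) ^ j)%C (seq 0 H)))%C; [ring|].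
           rewrite G. ring.
    + intros j _. rewrite (char_pow q) by (now apply X_character). unfold Cdiv. rewrite Cpow_mult_l.
      rewrite RtoC_pow. unfold Rdiv. rewrite Rmult_1_l, RtoC_inv by lra. ring.
Qed.

Definition weight (S : list nat) (chi : nat -> C) : R :=
  fold_right (fun p s => / (Cmod (1 - chi p / 2) ^ 2) * s) 1 S.

Lemma weight_factor p chi : X chi ->
  RtoC (/ (Cmod (1 - chi p / 2) ^ 2)) = (geom p chi * Cconj (geom p chi))%C.
Proof.
  intros Hc. unfold geom. rewrite <- Cmod2_conj, Cmod_inv by (now apply half_denominator_nz, X_Cmod_le_1).
  f_equal. rewrite pow_inv. reflexivity.
Qed.

Lemma weight_pos S chi : X chi -> 0 < weight S chi <= 4 ^ length S.
Proof.
  intros Hc. induction S as [|p S IH]; simpl; [lra|].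
  pose proof (half_denominator _ (X_Cmod_le_1 chi p Hc)) as D.
  set (d := Cmod (1 - chi p / 2)) in *.
  assert (P : 0 < / (d * (d * 1)) <= 4).
  { split; [apply Rinv_0_lt_compat; nra|]. replace 4 with (/ (1 / 4)) by field.
    apply Rinv_le_contravar; nra. }
  split; [apply Rmult_lt_0_compat; lra|]. apply Rmult_le_compat; lra.
Qed.

Lemma pos_weight_factor p : Nat.gcd p q = 1%nat ->
  pos_type X (fun chi => RtoC (/ (Cmod (1 - chi p / 2) ^ 2))).
Proof.
  intros Hp. pose proof (pos_geom p Hp) as G.
  apply (pos_ext X _ _ (pos_mul _ _ G (pos_conj _ G))).
  intros chi Hc. symmetry. now apply weight_factor.
Qed.

Lemma pos_weight S : (forall p, List.In p S -> Nat.gcd p q = 1%nat) ->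
  pos_type X (fun chi => RtoC (weight S chi)).
Proof.
  induction S as [|p S IH]; intros HS.
  - apply (pos_ext X _ _ (pos_const 1 ltac:(lra))). reflexivity.
  - apply (pos_ext X _ _ (pos_mul _ _ (pos_weight_factor p (HS p (or_introl eq_refl)))
      (IH (fun r Hr => HS r (or_intror Hr))))).
    intros chi _. simpl weight. now rewrite <- RtoC_mult.
Qed.

(** With g = [geom p] and w the weight of the remaining primes, |g|^2 w - 1 = |g|^2 (w - 1) + (g -
    1) conj g + (conj g - 1), and g - 1 = chi(p) g / 2. It makes the total weight at least |X|,
    against which all errors are measured. *)
Lemma pos_weight_minus_1 S : (forall p, List.In p S -> Nat.gcd p q = 1%nat) ->
  pos_type X (fun chi => RtoC (weight S chi) - 1)%C.
Proof.
  induction S as [|p S IH]; intros HS.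
  - apply (pos_ext X _ _ (pos_const 0 ltac:(lra))). intros chi _. simpl. ring.
  - specialize (IH (fun r Hr => HS r (or_intror Hr))).
    pose proof (HS p (or_introl eq_refl)) as Hp.
    pose proof (pos_geom p Hp) as G. pose proof (pos_conj _ G) as G'.
    assert (G1 : pos_type X (fun chi => geom p chi - 1)%C).
    { apply (pos_ext X _ _ (pos_scal X (/ 2) _ ltac:(lra) (pos_mul _ _ (pos_eval X p) G))).
      intros chi Hc. unfold geom. rewrite RtoC_inv by lra.
      pose proof (half_denominator_nz _ (X_Cmod_le_1 chi p Hc)) as NZ.
      transitivity (/ (1 - chi p / 2) * (1 - (1 - chi p / 2)))%C; [unfold Cdiv; ring|].
      transitivity (/ (1 - chi p / 2) - (/ (1 - chi p / 2)) * (1 - chi p / 2))%C; [ring|].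
      rewrite Cinv_l by exact NZ. reflexivity. }
    assert (G2 : pos_type X (fun chi => Cconj (geom p chi) - 1)%C).
    { apply (pos_ext X _ _ (pos_conj _ G1)). intros chi _. rewrite Cminus_conj. f_equal.
      apply injective_projections; simpl; ring. }
    apply (pos_ext X _ _ (pos_add X _ _ (pos_mul _ _ (pos_weight_factor p Hp) IH)
       (pos_add X _ _ (pos_mul _ _ G1 G') G2))).
    intros chi Hc. simpl weight. rewrite RtoC_mult. 
    change (Cmod (1 - chi p / 2) * (Cmod (1 - chi p / 2) * 1)) with (Cmod (1 - chi p / 2) ^ 2).
    rewrite (weight_factor p chi Hc). ring.
Qed.

(* With z = chi p on the unit circle, z |1 - z/2|^-2 - |1 - z/2|^-2 / 2 = z / (1 - z/2). *)
Lemma pos_weight_eval S p : (forall r, List.In r S -> Nat.gcd r q = 1%nat) -> List.In p S ->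
  pos_type X (fun chi => chi p * RtoC (weight S chi) - RtoC (1 / 2) * RtoC (weight S chi))%C.
Proof.
  induction S as [|r S IH]; intros HS Hp; [contradiction|].
  assert (HS' : forall r, List.In r S -> Nat.gcd r q = 1%nat) by (intros; apply HS; now right).
  destruct (Nat.eq_dec r p) as [->|N].
  - assert (Gp : Nat.gcd p q = 1%nat) by (apply HS; now left).
    apply (pos_ext X _ _ (pos_mul _ _ (pos_mul _ _ (pos_eval X p) (pos_geom p Gp)) (pos_weight S HS'))).
    intros chi Hc. simpl weight. rewrite RtoC_mult.
    change (Cmod (1 - chi p / 2) * (Cmod (1 - chi p / 2) * 1)) with (Cmod (1 - chi p / 2) ^ 2).
    rewrite (weight_factor p chi Hc). set (w := RtoC (weight S chi)).
    pose proof (half_denominator_nz _ (X_Cmod_le_1 chi p Hc)) as NZ.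
    assert (U : (chi p * Cconj (chi p))%C = RtoC 1).
    { rewrite <- Cmod2_conj, (char_Cmod_1 q chi p Hq (X_character chi Hc) Gp). f_equal. ring. }
    assert (E : ((chi p - 1 / 2) = chi p * Cconj (1 - chi p / 2))%C).
    { rewrite Cminus_conj, Cdiv_conj by (intro E; apply RtoC_inj in E; lra).
      replace (Cconj 1) with (RtoC 1) by (apply injective_projections; simpl; ring).
      replace (Cconj 2) with (RtoC 2) by (apply injective_projections; simpl; ring).
      transitivity (chi p - chi p * Cconj (chi p) / 2)%C; [rewrite U; reflexivity|unfold Cdiv; ring]. }
    assert (E2 : (Cconj (1 - chi p / 2) * Cconj (geom p chi))%C = RtoC 1).
    { rewrite <- Cmult_conj. unfold geom. rewrite Cinv_r by exact NZ. apply injective_projections; simpl; ring. }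
    transitivity ((chi p - 1 / 2) * (geom p chi * Cconj (geom p chi)) * w)%C.
    + rewrite E. transitivity (chi p * geom p chi * w * (Cconj (1 - chi p / 2) * Cconj (geom p chi)))%C; [rewrite E2|]; ring.
    + rewrite RtoC_div by lra. ring.
  - destruct Hp as [Hp|Hp]; [contradiction|].
    apply (pos_ext X _ _ (pos_mul _ _ (pos_weight_factor r (HS r (or_introl eq_refl))) (IH HS' Hp))).
    intros chi Hc. simpl weight. rewrite RtoC_mult. simpl. ring.
Qed.

(** One prime at a time: chi(p m) w - 2^(-k-1) w equals chi(p) (chi(m) w - 2^(-k) w) + 2^(-k)
    (chi(p) w - w/2). *)
Lemma pos_weight_eval_prod S ps : (forall r, List.In r S -> Nat.gcd r q = 1%nat) -> incl ps S ->
  pos_type X (fun chi => chi (fold_right Nat.mul 1%nat ps) * RtoC (weight S chi)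
    - RtoC ((1 / 2) ^ length ps) * RtoC (weight S chi))%C.
Proof.
  intros HS. induction ps as [|p ps IH]; intros Hi.
  - apply (pos_ext X _ _ (pos_const 0 ltac:(lra))). intros chi Hc. simpl.
    rewrite (char_1 q) by (now apply X_character). ring.
  - assert (Hi' : incl ps S) by (intros x Hx; apply Hi; now right).
    apply (pos_ext X _ _ (pos_add X _ _ (pos_mul _ _ (pos_eval X p) (IH Hi'))
      (pos_scal X ((1/2) ^ length ps) _ ltac:(apply pow_le; lra) (pos_weight_eval S p HS (Hi p (or_introl eq_refl)))))).
    intros chi Hc. cbn [fold_right length]. destruct (X_character chi Hc) as [_ [Hm _]]. rewrite Hm.
    rewrite <- tech_pow_Rmult, RtoC_mult. ring.
Qed.

Lemma weight_sum_ge S : (forall r, List.In r S -> Nat.gcd r q = 1%nat) ->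
  INR (length l) <= Rsum (weight S) l.
Proof.
  intros HS. pose proof (pos_sum _ (pos_weight_minus_1 S HS)) as P.
  rewrite Csum_minus, Re_minus, (Csum_RtoC (weight S)), (Csum_RtoC (fun _ => 1)), Rsum_const in P.
  simpl Re in P. lra.
Qed.

Lemma resonance (f : (nat -> C) -> C) (S : list nat) (Q : R) (lg lb : list (nat -> C)) :
  (forall r, List.In r S -> Nat.gcd r q = 1%nat) ->
  pos_type X f ->
  pos_type X (fun chi => f chi * RtoC (weight S chi) - RtoC Q * RtoC (weight S chi))%C ->
  Permutation l (lg ++ lb) ->
  Q * Rsum (weight S) l - INR (length lb) * (4 ^ length S * Re (f (principal_character q))) <=
    Rsum (fun chi => weight S chi * Re (f chi)) lg.
Proof.
  intros HS Hf HQ HP.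
  pose proof (pos_sum _ HQ) as P. rewrite Csum_minus, Csum_scal, (Csum_RtoC (weight S)), Re_minus in P.
  rewrite <- RtoC_mult in P. simpl (Re (RtoC _)) in P.
  rewrite Re_Csum, (Rsum_ext _ (fun chi => weight S chi * Re (f chi))) in P
    by (intros a _; rewrite Cmult_comm, Re_scal; reflexivity).
  rewrite (Rsum_perm (fun chi => weight S chi * Re (f chi)) _ _ HP), Rsum_app in P.
  assert (B : Rsum (fun chi => weight S chi * Re (f chi)) lb <= INR (length lb) * (4 ^ length S * Re (f (principal_character q)))).
  { apply Rsum_le_const. intros chi Hc.
    assert (Xc : X chi) by (apply Hl; apply (Permutation_in _ (Permutation_sym HP)), in_app_iff; now right).
    pose proof (weight_pos S chi Xc). pose proof (pos_bound f chi Hf Xc). pose proof (Re_le_Cmod (f chi)).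
    pose proof (Cmod_ge_0 (f chi)).
    apply Rle_trans with (weight S chi * Re (f (principal_character q))).
    - apply Rmult_le_compat_l; lra.
    - apply Rmult_le_compat_r; lra. }
  lra.
Qed.

End Resonance.

Lemma Rsum_incl {A : Type} (F : A -> R) (l1 l2 : list A) : NoDup l1 -> incl l1 l2 ->
  (forall a, List.In a l2 -> 0 <= F a) -> Rsum F l1 <= Rsum F l2.
Proof.
  intros Hn Hi HF. destruct (NoDup_incl_perm l1 l2 Hn Hi) as [m Hm].
  rewrite (Rsum_perm F _ _ Hm), Rsum_app.
  assert (0 <= Rsum F m); [|lra].
  apply Rsum_nonneg. intros a Ha. apply HF, (Permutation_in _ (Permutation_sym Hm)), in_app_iff. now right.
Qed.

(* Both characters equal 1 on the squares, which make up half of the residues, whereas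
   orthogonality gives (1 + chi)(1 + psi) the mean value 1. *)
Lemma real_character_unique q chi psi : prime (Z.of_nat q) -> (5 <= q)%nat ->
  dirichlet_character q chi -> dirichlet_character q psi ->
  character_mul chi chi = principal_character q -> character_mul psi psi = principal_character q ->
  chi <> principal_character q -> psi <> principal_character q -> chi = psi.
Proof.
  intros Hp Hq Hc Hpsi Sc Sp Nc Np. apply NNPP. intro Nne.
  (* Both squares being principal, chi psi principal would give chi = psi. *)
  assert (Npc : character_mul chi psi <> principal_character q).
  { intro E. apply Nne. rewrite <- (character_mul_principal_l q chi Hc), <- Sp.
    rewrite <- (character_mul_principal_l q psi Hpsi) at 3. rewrite <- E.
    apply functional_extensionality. intros n. unfold character_mul. ring. }
  assert (V : forall x n, dirichlet_character q x -> character_mul x x = principal_character q ->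
     Nat.gcd n q = 1%nat -> x n = RtoC 1 \/ x n = RtoC (- 1)).
  { intros x n _ Sx G. apply (f_equal (fun f => f n)) in Sx. unfold character_mul, principal_character in Sx.
    rewrite G in Sx. simpl in Sx.
    assert (Z : ((x n - 1) * (x n + 1))%C = RtoC 0) by (transitivity (x n * x n - 1)%C; [ring|rewrite Sx; ring]).
    apply (f_equal Cmod) in Z. rewrite Cmod_mult, Cmod_0 in Z.
    apply Rmult_integral in Z as [Z|Z]; apply Cmod_eq_0 in Z; [left|right].
    - transitivity (x n - 1 + 1)%C; [ring|rewrite Z; ring].
    - transitivity (x n + 1 - 1)%C; [ring|rewrite Z]. apply injective_projections; simpl; ring. }
  set (F := fun n => Re ((principal_character q n + chi n) * (principal_character q n + psi n))%C).
  assert (Fpos : forall n, 0 <= F n).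
  { intros n. unfold F. destruct (Nat.eq_dec (Nat.gcd n q) 1) as [G|G].
    - unfold principal_character. rewrite G. simpl (Nat.eqb 1 1).
      destruct (V chi n Hc Sc G) as [-> | ->], (V psi n Hpsi Sp G) as [-> | ->]; simpl; lra.
    - rewrite (char_nonunit q chi n Hc G), (char_nonunit q psi n Hpsi G).
      rewrite (char_nonunit q _ n (principal_is_character q) G). simpl. lra. }
  assert (Fsum : Rsum F (seq 0 q) <= INR q).
  { unfold F. rewrite <- Re_Csum.
    rewrite (Csum_ext _ (fun n => principal_character q n + (chi n + (psi n + character_mul chi psi n)))%C).
    - rewrite !Csum_plus, (char_sum_zero q chi), (char_sum_zero q psi), (char_sum_zero q (character_mul chi psi));
        auto using character_mul_is_character; try lia.
      rewrite !Cplus_0_r, Re_Csum. eapply Rle_trans; [apply (Rsum_le_const _ 1)|rewrite length_seq; lra].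
      intros n _. unfold principal_character. destruct (Nat.eqb _ _); simpl; lra.
    - intros n _. unfold character_mul, principal_character. destruct (Nat.eqb_spec (Nat.gcd n q) 1) as [G|G]; [ring|].
      rewrite (char_nonunit q chi n Hc G), (char_nonunit q psi n Hpsi G). ring. }
  (* The squares of 1, ..., h are distinct modulo q and each contributes 4 to the sum of [F], which
     is at most q; but 4h > q for q >= 5. *)
  set (h := ((q - 1) / 2)%nat).
  assert (Hh : (2 * h <= q - 1 < 2 * h + 2)%nat).
  { unfold h. pose proof (Nat.div_mod (q - 1) 2 ltac:(lia)). pose proof (Nat.mod_upper_bound (q - 1) 2 ltac:(lia)). lia. }
  assert (Hcop : forall x, (0 < x < q)%nat -> Nat.gcd x q = 1%nat) by (intros x Hx; now apply gcd_lt_prime).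
  assert (Inj : forall x y, (1 <= x < y)%nat -> (y <= h)%nat -> ((x * x) mod q)%nat <> ((y * y) mod q)%nat).
  { intros x y Hxy Hy E.
    assert (D : Nat.divide q ((y - x) * (y + x))).
    { exists ((y * y) / q - (x * x) / q)%nat.
      pose proof (Nat.div_mod (x * x) q ltac:(lia)). pose proof (Nat.div_mod (y * y) q ltac:(lia)).
      rewrite Nat.mul_sub_distr_r. nia. }
    apply prime_divide_nat in D; [|exact Hp].
    destruct D as [D|D]; apply Nat.divide_pos_le in D; lia. }
  assert (Low : INR h * 4 <= Rsum F (seq 0 q)).
  { apply Rle_trans with (Rsum F (map (fun x => (x * x) mod q)%nat (seq 1 h))).
    - rewrite Rsum_map. rewrite <- (length_seq h 1) at 1. apply Rsum_ge_const.
      intros x Hx. apply in_seq in Hx. unfold F.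
      assert (SQ : forall y, dirichlet_character q y -> character_mul y y = principal_character q -> y ((x * x) mod q)%nat = RtoC 1).
      { intros y Hy Sy. rewrite (char_mod q y (x * x) ltac:(lia) Hy). destruct Hy as [_ [Hm _]]. rewrite Hm.
        apply (f_equal (fun f => f x)) in Sy. unfold character_mul in Sy. rewrite Sy.
        unfold principal_character. rewrite Hcop by lia. reflexivity. }
      rewrite (SQ chi Hc Sc), (SQ psi Hpsi Sp), (SQ _ (principal_is_character q)
        (character_mul_principal_l q _ (principal_is_character q))). simpl. lra.
    - apply Rsum_incl; [| |intros; apply Fpos].
      + apply FinFun.Injective_map_NoDup_in; [|apply seq_NoDup].
        intros x y Hx Hy E. apply in_seq in Hx, Hy.
        destruct (Nat.lt_trichotomy x y) as [L|[L|L]]; [exfalso|exact L|exfalso].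
        * apply (Inj x y); auto; lia.
        * apply (Inj y x); auto; lia.
      + intros z Hz. apply in_map_iff in Hz as [x [<- _]]. apply in_seq.
        pose proof (Nat.mod_upper_bound (x * x) q). lia. }
  assert (INR h * 4 <= INR q) by lra.
  assert (Hb : (h * 4 <= q)%nat) by (apply INR_le; rewrite mult_INR; simpl (INR 4); lra).
  lia.
Qed.

(** * Unconditional large values *)

Definition rpow_neg (sigma : R) (n : nat) : R := exp (- sigma * ln (INR n)).

Lemma npow_real sigma n : npow n (RtoC sigma) = RtoC (rpow_neg sigma n).
Proof.
  unfold npow, rpow_neg. rewrite <- Cexp_RtoC. f_equal. rewrite RtoC_mult, RtoC_opp. ring.
Qed.

Lemma rpow_neg_pos sigma n : 0 < rpow_neg sigma n.
Proof. apply exp_pos. Qed.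

Lemma rpow_neg_mult sigma m n : (0 < m)%nat -> (0 < n)%nat ->
  rpow_neg sigma (m * n) = rpow_neg sigma m * rpow_neg sigma n.
Proof.
  intros Hm Hn. unfold rpow_neg. rewrite mult_INR, ln_mult by (apply lt_0_INR; assumption).
  rewrite <- exp_plus. f_equal. ring.
Qed.

Lemma rpow_neg_decr sigma m n : 0 <= sigma -> (0 < m <= n)%nat -> rpow_neg sigma n <= rpow_neg sigma m.
Proof.
  intros Hs Hm. apply exp_le_compat.
  assert (ln (INR m) <= ln (INR n)) by (apply ln_le; [apply lt_0_INR; lia|apply le_INR; lia]). nra.
Qed.

Fixpoint block_products (Bs : list (list nat)) : list nat :=
  match Bs with
  | nil => 1%nat :: nil
  | B :: Bs' => flat_map (fun p => map (Nat.mul p) (block_products Bs')) B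
  end.

Lemma block_products_spec Bs k : List.In k (block_products Bs) ->
  exists ps, incl ps (concat Bs) /\ length ps = length Bs /\ k = fold_right Nat.mul 1%nat ps.
Proof.
  revert k. induction Bs as [|B Bs IH]; intros k Hk; simpl in Hk.
  - destruct Hk as [<-|[]]. exists nil. repeat split. intros x [].
  - apply in_flat_map in Hk as [p [Hp Hk]]. apply in_map_iff in Hk as [k' [<- Hk']].
    destruct (IH k' Hk') as [ps [H1 [H2 ->]]]. exists (p :: ps). split; [|split; [simpl; congruence|reflexivity]].
    intros x [<-|Hx]; simpl; apply in_app_iff; [now left|right; now apply H1].
Qed.

Lemma product_prime_divisor p ps : prime (Z.of_nat p) -> (forall r, List.In r ps -> prime (Z.of_nat r)) ->
  Nat.divide p (fold_right Nat.mul 1%nat ps) -> List.In p ps.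
Proof.
  intros Hp. induction ps as [|r ps IH]; intros Hps Hd; simpl in *.
  - apply Nat.divide_1_r in Hd. subst. apply prime_ge_2 in Hp. lia.
  - apply prime_divide_nat in Hd; [|exact Hp]. destruct Hd as [Hd|Hd]; [left|right].
    + symmetry. apply prime_divide_prime_nat; auto.
    + apply IH; auto.
Qed.

Lemma product_pos ps : (forall r, List.In r ps -> prime (Z.of_nat r)) -> (0 < fold_right Nat.mul 1%nat ps)%nat.
Proof.
  induction ps as [|r ps IH]; intros Hps; simpl; [lia|].
  specialize (IH (fun x Hx => Hps x (or_intror Hx))). pose proof (prime_ge_2 _ (Hps r (or_introl eq_refl))). nia.
Qed.

(** The blocks are disjoint, so the prime taken from the first one is determined by the product: it
    cannot divide a product of primes from the later blocks. *)
Lemma block_products_NoDup Bs : NoDup (concat Bs) -> (forall r, List.In r (concat Bs) -> prime (Z.of_nat r)) ->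
  NoDup (block_products Bs).
Proof.
  induction Bs as [|B Bs IH]; intros Hn Hp; simpl.
  - constructor; [intros []|constructor].
  - simpl in Hn, Hp.
    assert (HnB : NoDup (concat Bs)) by (apply NoDup_app_remove_l in Hn; exact Hn).
    specialize (IH HnB (fun r Hr => Hp r (in_or_app _ _ _ (or_intror Hr)))).
    assert (Dv : forall p p' k k', List.In p B -> List.In p' B -> List.In k (block_products Bs) ->
       List.In k' (block_products Bs) -> (p * k = p' * k')%nat -> p = p').
    { intros p p' k k' HpB Hp'B Hk Hk' E.
      assert (Pp : prime (Z.of_nat p)) by (apply Hp, in_or_app; now left).
      assert (Pp' : prime (Z.of_nat p')) by (apply Hp, in_or_app; now left).
      assert (D : Nat.divide p (p' * k')) by (exists k; lia).
      apply prime_divide_nat in D; [|exact Pp]. destruct D as [D|D].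
      - now apply prime_divide_prime_nat.
      - exfalso. destruct (block_products_spec Bs k' Hk') as [ps [H1 [_ ->]]].
        apply product_prime_divisor in D; [|exact Pp|intros r Hr; apply Hp, in_or_app; right; now apply H1].
        apply H1 in D. apply (in_split p B) in HpB as [b1 [b2 ->]].
        rewrite <- app_assoc in Hn. simpl in Hn. apply NoDup_remove_2 in Hn. apply Hn.
        apply in_or_app. right. apply in_or_app. now right. }
    assert (HnB' : NoDup B) by (apply NoDup_app_remove_r in Hn; exact Hn).
    assert (HpB : forall p, List.In p B -> prime (Z.of_nat p)) by (intros p Hp'; apply Hp, in_or_app; now left).
    clear Hn Hp. induction B as [|p B IHB]; simpl; [constructor|].
    inversion HnB' as [|? ? Hnp HnB'']. subst.
    apply NoDup_app.
    + apply FinFun.Injective_map_NoDup_in; [|exact IH].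
      intros x y _ _ E. pose proof (prime_ge_2 _ (HpB p (or_introl eq_refl))). nia.
    + apply IHB; [|exact HnB''|].
      * intros p1 p2 k k' H1 H2. apply Dv; now right.
      * intros r Hr. apply HpB. now right.
    + intros k Hk Hk'. apply in_map_iff in Hk as [x [<- Hx]].
      apply in_flat_map in Hk' as [p' [Hp' Hk']]. apply in_map_iff in Hk' as [y [E Hy]].
      assert (p' = p) by (apply (Dv p' p y x); auto; [now right|now left]).
      subst. contradiction.
Qed.

Lemma block_products_sum g Bs : (forall m n, (0 < m)%nat -> (0 < n)%nat -> g (m * n)%nat = g m * g n) -> g 1%nat = 1 ->
  (forall r, List.In r (concat Bs) -> prime (Z.of_nat r)) ->
  Rsum g (block_products Bs) = fold_right (fun B s => Rsum g B * s) 1 Bs.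
Proof.
  intros Hg H1. induction Bs as [|B Bs IH]; intros Hp; simpl.
  - rewrite H1. ring.
  - rewrite <- IH by (intros r Hr; apply Hp; simpl; apply in_or_app; now right).
    assert (HpB : forall p, List.In p B -> prime (Z.of_nat p)) by (intros p Hp'; apply Hp; simpl; apply in_or_app; now left).
    assert (HpBs : forall p, List.In p (concat Bs) -> prime (Z.of_nat p)) by (intros p Hp'; apply Hp; simpl; apply in_or_app; now right).
    clear IH Hp. induction B as [|p B IHB]; simpl; [ring|].
    rewrite Rsum_app, IHB by (intros r Hr; apply HpB; now right).
    rewrite Rsum_map.
    rewrite (Rsum_ext _ (fun k => g p * g k)).
    + rewrite Rsum_scal. ring.
    + intros k Hk. apply Hg.
      * pose proof (prime_ge_2 _ (HpB p (or_introl eq_refl))). lia.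
      * destruct (block_products_spec Bs k Hk) as [ps [Hi [_ ->]]]. apply product_pos. intros r Hr. now apply HpBs, Hi.
Qed.

Lemma fold_product_ge (u : list nat -> R) (Bs : list (list nat)) c : 0 <= c ->
  (forall B, List.In B Bs -> c <= u B) -> c ^ length Bs <= fold_right (fun B s => u B * s) 1 Bs.
Proof.
  intros Hc. induction Bs as [|B Bs IH]; intros H; simpl; [lra|].
  apply Rmult_le_compat; [exact Hc|apply pow_le; exact Hc|apply H; now left|apply IH; intros; apply H; now right].
Qed.

Lemma large_value_exists {A : Type} (w v : A -> R) (l lg lb : list A) (P : R) :
  Permutation l (lg ++ lb) -> l <> nil -> (forall a, List.In a l -> 0 < w a) -> 0 < P ->
  P * Rsum w l <= Rsum (fun a => w a * v a) lg -> exists a, List.In a lg /\ P <= v a.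
Proof.
  intros HP Hne Hw HPp HS. apply NNPP. intro N.
  assert (B : forall a, List.In a lg -> v a < P).
  { intros a Ha. apply Rnot_le_lt. intro L. apply N. exists a. auto. }
  assert (Hwg : forall a, List.In a (lg ++ lb) -> 0 < w a).
  { intros a Ha. apply Hw. apply (Permutation_in _ (Permutation_sym HP) Ha). }
  rewrite (Rsum_perm w _ _ HP), Rsum_app in HS.
  assert (Pb : 0 <= Rsum w lb) by (apply Rsum_nonneg; intros a Ha; left; apply Hwg, in_or_app; now right).
  destruct lg as [|a lg].
  - simpl in *. destruct lb as [|a lb].
    + apply Permutation_sym, Permutation_nil in HP. contradiction.
    + simpl in HS. pose proof (Hwg a (or_introl eq_refl)).
      assert (0 <= Rsum w lb) by (apply Rsum_nonneg; intros x Hx; left; apply Hwg; now right). nra.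
  - simpl in HS. pose proof (Hwg a (or_introl eq_refl)) as Wa. pose proof (B a (or_introl eq_refl)) as Ba.
    assert (R1 : Rsum (fun a => w a * v a) lg <= P * Rsum w lg).
    { rewrite <- Rsum_scal. apply Rsum_le. intros x Hx.
      pose proof (Hwg x (or_intror (in_or_app _ _ _ (or_introl Hx)))). pose proof (B x (or_intror Hx)). nra. }
    assert (w a * v a < P * w a) by nra. nra.
Qed.

Section Unconditional.
Variables (q : nat) (X : Ensemble (nat -> C)) (l : list (nat -> C)) (sigma : R).
Hypotheses (Hq : (2 <= q)%nat) (HX : character_subgroup q X)
  (Hnd : NoDup l) (Hl : forall chi, List.In chi l <-> X chi) (Hsig : 0 < sigma < 1).

(* The coefficients of sum_{N < n <= M} chi(n) n^(-sigma), collected modulo q; the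
   subtracted constants do not contribute for non-principal chi. *)
Definition residue_coef (N' n a : nat) : R :=
  Rsum (fun b => rpow_neg sigma (b * q + a) - rpow_neg sigma (S b * q)) (seq N' n).

Lemma residue_coef_bounds N' n a : (1 <= N')%nat -> (1 <= a <= q)%nat ->
  0 <= residue_coef N' n a <= rpow_neg sigma (N' * q).
Proof.
  intros HN Ha. unfold residue_coef. split.
  - apply Rsum_nonneg. intros b Hb. apply in_seq in Hb.
    assert (rpow_neg sigma (S b * q) <= rpow_neg sigma (b * q + a)) by (apply rpow_neg_decr; [lra|nia]). lra.
  - apply Rle_trans with (Rsum (fun b => rpow_neg sigma (b * q) - rpow_neg sigma (S b * q)) (seq N' n)).
    + apply Rsum_le. intros b Hb. apply in_seq in Hb.
      assert (rpow_neg sigma (b * q + a) <= rpow_neg sigma (b * q)) by (apply rpow_neg_decr; [lra|nia]). lra.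
    + rewrite (Rsum_telescope (fun b => rpow_neg sigma (b * q))).
      pose proof (rpow_neg_pos sigma ((N' + n) * q)). lra.
Qed.

Lemma residue_sum_tail chi N' n : dirichlet_character q chi -> chi <> principal_character q ->
  Csum (fun a => RtoC (residue_coef N' n a) * chi a)%C (seq 1 q) = dsum chi (RtoC sigma) (S (N' * q)) (n * q).
Proof.
  intros H Hne. induction n as [|n IH].
  - unfold residue_coef. simpl. rewrite Csum_zero by (intros; ring). reflexivity.
  - replace (S n * q)%nat with (n * q + q)%nat by lia. rewrite dsum_app, <- IH. unfold dsum.
    replace (S (N' * q) + n * q)%nat with ((N' + n) * q + 1)%nat by lia.
    rewrite Csum_seq_shift.
    rewrite (Csum_ext (fun a => RtoC (residue_coef N' (S n) a) * chi a)%C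
      (fun a => RtoC (residue_coef N' n a) * chi a +
        (chi ((N' + n) * q + a)%nat * npow ((N' + n) * q + a) (RtoC sigma)
         - RtoC (rpow_neg sigma (S (N' + n) * q)) * chi a))%C).
    + rewrite Csum_plus, Csum_minus, Csum_scal, (char_sum_period q chi 1), (char_sum_zero q chi) by assumption. ring.
    + intros a _. unfold residue_coef. rewrite Rsum_seq_S, npow_real.
      replace ((N' + n) * q + a)%nat with (a + (N' + n) * q)%nat by lia.
      rewrite char_add_mul by assumption. rewrite RtoC_plus, RtoC_minus. ring.
Qed.

(** The tail is f(chi), with coefficients between 0 and V, and s is the sum over all residues with
    coefficients 1. So f and V s - f are both of positive type, and V^2 |s|^2 - |f|^2 = V s conj(V s
    - f) + (V s - f) conj f has a nonnegative sum over X. But s vanishes except at the principal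
    character, where |s| <= q. *)
Lemma tail_mean_square N' n lg lb : (1 <= N')%nat -> Permutation l (lg ++ lb) ->
  (forall chi, List.In chi lg -> chi <> principal_character q) ->
  Rsum (fun chi => Cmod (dsum chi (RtoC sigma) (S (N' * q)) (n * q)) ^ 2) lg <=
    (rpow_neg sigma (N' * q) * INR q) ^ 2.
Proof.
  intros HN HP Hnp. set (V := rpow_neg sigma (N' * q)).
  assert (HV : 0 < V) by apply rpow_neg_pos.
  set (f := fun chi : nat -> C => Csum (fun a => RtoC (residue_coef N' n a) * chi a)%C (seq 1 q)).
  set (s := fun chi : nat -> C => Csum chi (seq 1 q)).
  assert (Pf : pos_type X f).
  { apply (pos_Csum q X HX (fun a chi => RtoC (residue_coef N' n a) * chi a)%C).
    intros a Ha. apply in_seq in Ha. apply (pos_scal X _ (fun chi => chi a)); [|apply pos_eval].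
    apply residue_coef_bounds; lia. }
  assert (Pg : pos_type X (fun chi => RtoC V * s chi - f chi)%C).
  { apply (pos_ext X (fun chi => Csum (fun a => RtoC (V - residue_coef N' n a) * chi a)%C (seq 1 q))).
    - apply (pos_Csum q X HX (fun a chi => RtoC (V - residue_coef N' n a) * chi a)%C).
      intros a Ha. apply in_seq in Ha. apply (pos_scal X _ (fun chi => chi a)); [|apply pos_eval].
      pose proof (residue_coef_bounds N' n a HN ltac:(lia)). unfold V. lra.
    - intros chi _. unfold s, f. rewrite <- Csum_scal, <- Csum_minus. apply Csum_ext. intros a _.
      rewrite RtoC_minus. ring. }
  assert (Ps : pos_type X s).
  { apply (pos_Csum q X HX (fun a chi => chi a)). intros a _. apply (pos_eval X). }
  pose proof (pos_sum q X l Hq HX Hnd Hl _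
    (pos_add X _ _ (pos_mul q X HX _ _ (pos_scal X V _ ltac:(lra) Ps) (pos_conj q X Hq HX _ Pg))
      (pos_mul q X HX _ _ Pg (pos_conj q X Hq HX _ Pf)))) as P.
  cbv beta in P.
  rewrite (Csum_ext _ (fun chi => RtoC (V ^ 2 * Cmod (s chi) ^ 2) - RtoC (Cmod (f chi) ^ 2))%C) in P.
  2:{ intros chi _. rewrite RtoC_mult, !Cmod2_conj, Cminus_conj, Cmult_conj.
      replace (Cconj (RtoC V)) with (RtoC V) by (apply injective_projections; simpl; ring).
      rewrite RtoC_pow. ring. }
  rewrite Csum_minus, (Csum_RtoC (fun chi => V ^ 2 * Cmod (s chi) ^ 2)), (Csum_RtoC (fun chi => Cmod (f chi) ^ 2)), Re_minus in P.
  rewrite !Re_RtoC, Rsum_scal in P.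
  assert (S1 : Rsum (fun chi => Cmod (s chi) ^ 2) l <= INR q ^ 2).
  { destruct (in_split _ _ (proj2 (Hl _) (X_principal q X HX))) as [l1 [l2 E]].
    assert (Z : forall m, incl m (l1 ++ l2) -> Rsum (fun chi => Cmod (s chi) ^ 2) m = 0).
    { intros m Hm. rewrite (Rsum_ext _ (fun _ => 0)); [rewrite Rsum_const; ring|].
      intros chi Hc. apply Hm in Hc.
      assert (Hc' : X chi) by (apply Hl; rewrite E; apply in_app_iff in Hc; apply in_app_iff; simpl; tauto).
      unfold s. rewrite char_sum_period, char_sum_zero; [rewrite Cmod_0; ring|exact Hq| | |exact Hq|];
        try (now apply (X_character q X HX)).
      intros ->. rewrite E in Hnd. apply NoDup_remove_2 in Hnd. contradiction. }
    rewrite E, Rsum_app. simpl Rsum at 2. fold (Rsum (fun chi => Cmod (s chi) ^ 2) l2).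
    change (Rsum (fun chi => Cmod (s chi) ^ 2) l1 + (Cmod (s (principal_character q)) ^ 2 + Rsum (fun chi => Cmod (s chi) ^ 2) l2) <= INR q ^ 2).
    rewrite !Z by (intros x Hx; apply in_app_iff; auto).
    assert (Cmod (s (principal_character q)) <= INR q).
    { unfold s. eapply Rle_trans; [apply Cmod_Csum|].
      eapply Rle_trans; [apply (Rsum_le_const _ 1)|rewrite length_seq; lra].
      intros a _. apply (char_Cmod_le_1 q); [lia|apply principal_is_character]. }
    assert (Cmod (s (principal_character q)) ^ 2 <= INR q ^ 2) by (apply pow_incr; split; [apply Cmod_ge_0|assumption]).
    lra. }
  assert (S2 : Rsum (fun chi => Cmod (f chi) ^ 2) lg <= Rsum (fun chi => Cmod (f chi) ^ 2) l).
  { rewrite (Rsum_perm _ _ _ HP), Rsum_app.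
    assert (0 <= Rsum (fun chi => Cmod (f chi) ^ 2) lb) by (apply Rsum_nonneg; intros; apply pow_le, Cmod_ge_0). lra. }
  rewrite (Rsum_ext _ (fun chi => Cmod (f chi) ^ 2)).
  - rewrite Rpow_mult_distr. assert (0 <= V ^ 2) by (apply pow_le; lra).
    assert (V ^ 2 * Rsum (fun chi => Cmod (s chi) ^ 2) l <= V ^ 2 * INR q ^ 2) by (apply Rmult_le_compat_l; assumption).
    lra.
  - intros chi Hc. unfold f. rewrite residue_sum_tail; [reflexivity| |now apply Hnp].
    apply (X_character q X HX), Hl, (Permutation_in _ (Permutation_sym HP)), in_app_iff. now left.
Qed.

(** The terms k in [block_products Bs] are moved into the weight at cost 2^(-j), j the number of
    blocks; the other terms of the partial sum are merely kept as nonnegative combinations, and so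
    is the surplus over Q. *)
Lemma pos_dirichlet_polynomial (S : list nat) (Bs : list (list nat)) (N : nat) (Q : R) :
  (forall r, List.In r S -> Nat.gcd r q = 1%nat) -> (forall r, List.In r S -> prime (Z.of_nat r)) ->
  incl (concat Bs) S -> NoDup (concat Bs) ->
  (forall k, List.In k (block_products Bs) -> (k <= N)%nat) ->
  Q <= (1 / 2) ^ length Bs * Rsum (rpow_neg sigma) (block_products Bs) ->
  pos_type X (fun chi => dsum chi (RtoC sigma) 1 N * RtoC (weight S chi) - RtoC Q * RtoC (weight S chi))%C.
Proof.
  intros HS HSp Hi HnB Hk HQ.
  assert (Hp : forall r, List.In r (concat Bs) -> prime (Z.of_nat r)) by (intros r Hr; now apply HSp, Hi).
  pose proof (block_products_NoDup Bs HnB Hp) as HnK. set (K := block_products Bs) in *.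
  assert (HK : incl K (seq 1 N)).
  { intros k Hk'. apply in_seq. specialize (Hk k Hk').
    destruct (block_products_spec Bs k Hk') as [ps [H1 [_ E]]].
    assert (0 < k)%nat by (rewrite E; apply product_pos; intros r Hr; now apply Hp, H1). lia. }
  destruct (NoDup_incl_perm K (seq 1 N) HnK HK) as [rest HR].
  pose proof (pos_weight q X l Hq HX Hnd Hl S HS) as PW.
  assert (P1 : pos_type X (fun chi => Csum (fun k => RtoC (rpow_neg sigma k) *
     (chi k * RtoC (weight S chi) - RtoC ((1 / 2) ^ length Bs) * RtoC (weight S chi)))%C K)).
  { apply (pos_Csum q X HX (fun k chi => RtoC (rpow_neg sigma k) *
     (chi k * RtoC (weight S chi) - RtoC ((1 / 2) ^ length Bs) * RtoC (weight S chi)))%C).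
    intros k Hk'. apply pos_scal; [left; apply rpow_neg_pos|].
    destruct (block_products_spec Bs k Hk') as [ps [H1 [H2 ->]]]. rewrite <- H2.
    apply (pos_weight_eval_prod q X l Hq HX Hnd Hl S ps HS). intros x Hx. now apply Hi, H1. }
  assert (P2 : pos_type X (fun chi => Csum (fun k => RtoC (rpow_neg sigma k) * chi k)%C rest)).
  { apply (pos_Csum q X HX (fun k chi => RtoC (rpow_neg sigma k) * chi k)%C).
    intros k _. apply (pos_scal X _ (fun chi => chi k)); [left; apply rpow_neg_pos|apply pos_eval]. }
  apply (pos_ext X _ _ (pos_add X _ _ P1 (pos_add X _ _ (pos_mul q X HX _ _ P2 PW)
    (pos_scal X ((1 / 2) ^ length Bs * Rsum (rpow_neg sigma) K - Q) _ ltac:(lra) PW)))).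
  intros chi _. cbv beta. unfold dsum. rewrite (Csum_perm _ _ _ HR), Csum_app.
  set (w := RtoC (weight S chi)).
  rewrite (Csum_ext (fun k => RtoC (rpow_neg sigma k) * (chi k * w - RtoC ((1 / 2) ^ length Bs) * w))%C
    (fun k => w * (chi k * npow k (RtoC sigma)) - (RtoC ((1 / 2) ^ length Bs) * w) * RtoC (rpow_neg sigma k))%C)
    by (intros k _; rewrite npow_real; ring).
  rewrite Csum_minus, !Csum_scal, Csum_RtoC.
  rewrite (Csum_ext (fun k => RtoC (rpow_neg sigma k) * chi k)%C (fun k => chi k * npow k (RtoC sigma))%C)
    by (intros k _; rewrite npow_real; ring).
  rewrite RtoC_minus, RtoC_mult. ring.
Qed.

Lemma pos_dsum N : pos_type X (fun chi => dsum chi (RtoC sigma) 1 N).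
Proof.
  apply (pos_ext X (fun chi => Csum (fun k => RtoC (rpow_neg sigma k) * chi k)%C (seq 1 N))).
  - apply (pos_Csum q X HX (fun k chi => RtoC (rpow_neg sigma k) * chi k)%C).
    intros k _. apply (pos_scal X _ (fun chi => chi k)); [left; apply rpow_neg_pos|apply pos_eval].
  - intros chi _. apply Csum_ext. intros k _. rewrite npow_real. ring.
Qed.

(** The loss of 4 consists of four errors, each at most the total weight: the principal character
    ([Hmain]), the remainder of L beyond N + n q, and, from |tl| <= 1 + |tl|^2, the constant 1 and
    the mean square ([Htail]). *)
Lemma unconditional_large_value (S : list nat) (Bs : list (list nat)) (N' : nat) (Q : R) :
  (forall r, List.In r S -> Nat.gcd r q = 1%nat) -> (forall r, List.In r S -> prime (Z.of_nat r)) ->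
  incl (concat Bs) S -> NoDup (concat Bs) -> (1 <= N')%nat ->
  (forall k, List.In k (block_products Bs) -> (k <= N' * q)%nat) ->
  4 < Q -> Q <= (1 / 2) ^ length Bs * Rsum (rpow_neg sigma) (block_products Bs) ->
  4 ^ length S * (3 / (1 - sigma) * exp ((1 - sigma) * ln (INR (N' * q)))) <= INR (length l) ->
  4 ^ length S * (rpow_neg sigma (N' * q) * INR q) ^ 2 <= INR (length l) ->
  exists chi, X chi /\ chi <> principal_character q /\ Q - 4 <= Cmod (Lfun chi (RtoC sigma)).
Proof.
  intros HS HSp Hi HnB HN' Hk HQ4 HQ Hmain Htail.
  set (N := (N' * q)%nat) in *.
  destruct (in_split _ _ (proj2 (Hl _) (X_principal q X HX))) as [l1 [l2 E]].
  set (lg := l1 ++ l2). set (lb := principal_character q :: nil).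
  assert (HP : Permutation l (lg ++ lb)).
  { rewrite E. unfold lg, lb. apply Permutation_sym. rewrite <- Permutation_cons_append. apply Permutation_middle. }
  assert (Hnp : forall chi, List.In chi lg -> chi <> principal_character q).
  { intros chi Hc ->. rewrite E in Hnd. apply NoDup_remove_2 in Hnd. contradiction. }
  assert (Hlg : forall chi, List.In chi lg -> X chi).
  { intros chi Hc. apply Hl, (Permutation_in _ (Permutation_sym HP)), in_app_iff. now left. }
  pose proof (resonance q X l Hq HX Hnd Hl (fun chi => dsum chi (RtoC sigma) 1 N) S Q lg lb HS (pos_dsum N)
    (pos_dirichlet_polynomial S Bs N Q HS HSp Hi HnB Hk HQ) HP) as RES.
  pose proof (weight_sum_ge q X l Hq HX Hnd Hl S HS) as WS. set (W := Rsum (weight S) l) in *.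
  cbv beta in RES. simpl (INR (length lb)) in RES.
  assert (HN1 : (1 <= N)%nat) by (unfold N; nia).
  assert (D1 : Re (dsum (principal_character q) (RtoC sigma) 1 N) <= 3 / (1 - sigma) * exp ((1 - sigma) * ln (INR N))).
  { eapply Rle_trans; [apply Re_le_Cmod|]. unfold dsum. eapply Rle_trans; [apply Cmod_Csum|].
    eapply Rle_trans; [|apply (power_sum_lt1 sigma N Hsig HN1)].
    apply Rsum_le. intros k _. rewrite Cmod_mult, npow_real, Cmod_R, Rabs_right by (left; apply rpow_neg_pos).
    pose proof (char_Cmod_le_1 q _ k ltac:(lia) (principal_is_character q)).
    pose proof (rpow_neg_pos sigma k). unfold rpow_neg in *. nra. }
  assert (P4 : 0 < 4 ^ length S) by (apply pow_lt; lra).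
  assert (D2 : 4 ^ length S * Re (dsum (principal_character q) (RtoC sigma) 1 N) <= INR (length l)).
  { eapply Rle_trans; [apply Rmult_le_compat_l; [lra|exact D1]|exact Hmain]. }
  (* The bound in [tail_mean_square] is uniform in n, so n may be taken as large as the fixed
     modulus q requires. *)
  destruct (exp_neg_ln_lim sigma (INR q * 2) ltac:(lra)) with (eps := 1) as [M0 HM0];
    [pose proof (pos_INR q); lra|lra|].
  set (n := M0).
  assert (App : forall chi, List.In chi lg ->
     Re (dsum chi (RtoC sigma) 1 N) <= Cmod (Lfun chi (RtoC sigma)) + 2 + Cmod (dsum chi (RtoC sigma) (Datatypes.S N) (n * q)) ^ 2).
  { intros chi Hc. pose proof (X_character q X HX chi (Hlg chi Hc)) as HC.
    pose proof (Lfun_tail q chi (RtoC sigma) (N + n * q) Hq HC (Hnp chi Hc) ltac:(simpl; lra)) as T.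
    simpl (Re (RtoC sigma)) in T. rewrite Cmod_R, Rabs_right in T by lra.
    replace (sigma / sigma + 1) with 2 in T by (field; lra).
    specialize (HM0 (N + n * q)%nat ltac:(unfold n; nia)).
    rewrite dsum_app in T. change (1 + N)%nat with (Datatypes.S N) in T.
    set (d := dsum chi (RtoC sigma) 1 N) in *. set (tl := dsum chi (RtoC sigma) (Datatypes.S N) (n * q)) in *.
    set (L := Lfun chi (RtoC sigma)) in *.
    pose proof (Cmod_triangle L (- (L - (d + tl)) + - tl)) as T1.
    replace (L + (- (L - (d + tl)) + - tl))%C with d in T1 by ring.
    pose proof (Cmod_triangle (- (L - (d + tl))) (- tl)) as T2. rewrite !Cmod_opp in *.
    pose proof (Re_le_Cmod d). 
    assert (Cmod tl <= 1 + Cmod tl ^ 2) by (pose proof (Rle_0_sqr (Cmod tl - 1)) as Sq; unfold Rsqr in Sq; nra).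
    lra. }
  pose proof (tail_mean_square N' n lg lb HN' HP Hnp) as TMS. fold N in TMS.
  assert (Sg : Rsum (weight S) lg <= W).
  { unfold W. rewrite (Rsum_perm _ _ _ HP), Rsum_app.
    assert (0 <= Rsum (weight S) lb); [|lra]. apply Rsum_nonneg. intros chi Hc. left.
    apply (weight_pos q X Hq HX S chi). apply Hl, (Permutation_in _ (Permutation_sym HP)), in_app_iff. now right. }
  assert (FIN : (Q - 4) * W <= Rsum (fun chi => weight S chi * Cmod (Lfun chi (RtoC sigma))) lg).
  { assert (B : Rsum (fun chi => weight S chi * Re (dsum chi (RtoC sigma) 1 N)) lg <=
      Rsum (fun chi => weight S chi * Cmod (Lfun chi (RtoC sigma)) + (2 * weight S chi +
        4 ^ length S * Cmod (dsum chi (RtoC sigma) (Datatypes.S N) (n * q)) ^ 2)) lg).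
    { apply Rsum_le. intros chi Hc. specialize (App chi Hc).
      pose proof (weight_pos q X Hq HX S chi (Hlg chi Hc)) as [W0 W1].
      assert (Z : 0 <= Cmod (dsum chi (RtoC sigma) (Datatypes.S N) (n * q)) ^ 2) by (apply pow_le, Cmod_ge_0).
      set (z := Cmod (dsum chi (RtoC sigma) (Datatypes.S N) (n * q)) ^ 2) in *.
      apply Rle_trans with (weight S chi * (Cmod (Lfun chi (RtoC sigma)) + 2 + z)); [apply Rmult_le_compat_l; lra|].
      assert (weight S chi * z <= 4 ^ length S * z) by (apply Rmult_le_compat_r; lra). lra. }
    rewrite !Rsum_plus, !Rsum_scal in B.
    assert (4 ^ length S * Rsum (fun chi => Cmod (dsum chi (RtoC sigma) (Datatypes.S N) (n * q)) ^ 2) lg <= INR (length l)).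
    { eapply Rle_trans; [apply Rmult_le_compat_l; [lra|exact TMS]|exact Htail]. }
    lra. }
  destruct (large_value_exists (weight S) (fun chi => Cmod (Lfun chi (RtoC sigma))) l lg lb (Q - 4) HP) as [chi [Hc Hv]].
  - rewrite E. destruct l1; discriminate.
  - intros chi Hc. apply (weight_pos q X Hq HX S chi). now apply Hl.
  - lra.
  - exact FIN.
  - exists chi. split; [now apply Hlg|split; [now apply Hnp|exact Hv]].
Qed.
End Unconditional.

(** * Large values under GRH *)

Lemma exp_trunc_nonneg K x : 0 <= x -> 0 <= exp_trunc K x.
Proof.
  intros Hx. apply Rsum_nonneg. intros k _.
  apply Rdiv_le_0_compat; [apply pow_le; exact Hx|apply lt_0_INR, lt_O_fact].
Qed.

Lemma exp_trunc_le_exp K x : 0 <= x -> exp_trunc K x <= exp x.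
Proof.
  intros Hx. destruct K as [|K].
  - unfold exp_trunc. simpl. left. apply exp_pos.
  - replace (exp_trunc (S K) x) with (sum_f_R0 (fun k => x ^ k / INR (fact k)) K).
    + now apply exp_ge_taylor.
    + unfold exp_trunc. induction K as [|K IH].
      * simpl. field.
      * rewrite Rsum_seq_S. rewrite <- IH. reflexivity.
Qed.

(** The relative remainder x^K/K! is at most exp(2x) 2^(-K), by one term of the series for exp(2x),
    and this is at most 1/2 because 2x <= (K - 1)/2 <= (K - 1) log 2. *)
Lemma exp_trunc_lower K x : 0 <= x -> 4 * x + 1 <= INR K -> exp x / 2 <= exp_trunc K x.
Proof.
  intros Hx HK.
  pose proof (Cexp_taylor (RtoC x) K) as T.
  rewrite Cexp_RtoC, Cmod_R, Rabs_right in T by lra.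
  assert (E : exp_poly K (RtoC x) = RtoC (exp_trunc K x)).
  { unfold exp_poly, exp_trunc. rewrite <- Csum_RtoC. apply Csum_ext. intros k _.
    rewrite RtoC_div, RtoC_pow by apply INR_fact_neq_0. reflexivity. }
  rewrite E, <- RtoC_minus, Cmod_R in T. apply Rabs_le_between in T.
  assert (B : x ^ K / INR (fact K) <= 1 / 2).
  { assert (B1 : (2 * x) ^ K / INR (fact K) <= exp (2 * x)).
    { eapply Rle_trans; [|apply (exp_trunc_le_exp (S K) (2 * x)); lra].
      unfold exp_trunc. rewrite Rsum_seq_S. simpl (0 + K)%nat.
      pose proof (exp_trunc_nonneg K (2 * x) ltac:(lra)) as P. unfold exp_trunc in P. lra. }
    assert (B2 : exp (2 * x) <= 2 ^ K / 2).
    { assert (E2 : 2 ^ K / 2 = exp ((INR K - 1) * ln 2)).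
      { rewrite <- (exp_ln 2) at 1 by lra. rewrite exp_pow_INR. unfold Rdiv.
        rewrite <- (exp_ln 2) at 2 by lra. rewrite <- exp_Ropp, <- exp_plus. f_equal. ring. }
      rewrite E2. apply exp_le_compat.
      assert (1 / 2 <= ln 2).
      { rewrite <- (ln_exp (1/2)). apply ln_le; [apply exp_pos|].
        pose proof exp_le_3. assert (exp (1/2) * exp (1/2) = exp 1) by (rewrite <- exp_plus; f_equal; lra).
        pose proof (exp_pos (1/2)). nra. }
      nra. }
    rewrite Rpow_mult_distr in B1.
    assert (P2 : 0 < 2 ^ K) by (apply pow_lt; lra).
    apply Rmult_le_reg_l with (2 ^ K); [exact P2|]. unfold Rdiv in *. lra. }
  pose proof (exp_pos x). nra.
Qed.

(** Rankin's trick: t^k <= (t/lam)^K lam^k for k < K. With lam < 1 the sum of p^(-2+lam) over the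
    primes converges, whereas the exponent -2 + t, with t > 1, would give a divergent one. *)
Lemma exp_trunc_upper K t lam x : 0 < lam < t -> 0 <= x ->
  exp_trunc K (t * x) <= (t / lam) ^ K * exp (lam * x).
Proof.
  intros Hl Hx.
  assert (R1 : 1 <= t / lam).
  { apply Rmult_le_reg_r with lam; [lra|]. unfold Rdiv. rewrite Rmult_assoc, Rinv_l; lra. }
  apply Rle_trans with ((t / lam) ^ K * exp_trunc K (lam * x)).
  - unfold exp_trunc. rewrite <- Rsum_scal. apply Rsum_le. intros k Hk. apply in_seq in Hk.
    replace (t * x) with ((t / lam) * (lam * x)) by (field; lra).
    rewrite Rpow_mult_distr. unfold Rdiv at 1. rewrite Rmult_assoc.
    apply Rmult_le_compat_r.
    + apply Rdiv_le_0_compat; [apply pow_le; nra|apply lt_0_INR, lt_O_fact].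
    + apply Rle_pow; [exact R1|lia].
  - apply Rmult_le_compat_l; [apply pow_le; lra|]. apply exp_trunc_le_exp. nra.
Qed.

Lemma classical_split {A : Type} (P : A -> Prop) (l : list A) :
  exists lg lb, Permutation l (lg ++ lb) /\ (forall a, List.In a lg -> ~ P a) /\ (forall a, List.In a lb -> P a).
Proof.
  induction l as [|a l [lg [lb [HP [Hg Hb]]]]].
  - exists nil, nil. split; [constructor|split; intros a []].
  - destruct (classic (P a)) as [Ha|Ha].
    + exists lg, (a :: lb). split; [|split; [exact Hg|intros x [<-|Hx]; auto]].
      apply Permutation_cons_app, HP.
    + exists (a :: lg), lb. split; [|split; [intros x [<-|Hx]; auto|exact Hb]].
      simpl. now apply perm_skip.
Qed.

Lemma real_characters_at_most_two q (lb : list (nat -> C)) : prime (Z.of_nat q) -> (5 <= q)%nat -> NoDup lb ->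
  (forall chi, List.In chi lb -> dirichlet_character q chi /\ character_mul chi chi = principal_character q) ->
  (length lb <= 2)%nat.
Proof.
  intros Hp Hq Hn H. destruct lb as [|a [|b [|c lb]]]; simpl; try lia. exfalso.
  destruct (H a ltac:(simpl; tauto)) as [Da Sa]. destruct (H b ltac:(simpl; tauto)) as [Db Sb].
  destruct (H c ltac:(simpl; tauto)) as [Dc Sc].
  inversion Hn as [|? ? Na Hn1]. subst. inversion Hn1 as [|? ? Nb _]. subst. simpl in Na, Nb.
  set (e := principal_character q) in *.
  destruct (classic (a = e)) as [Ea|Ea]; destruct (classic (b = e)) as [Eb|Eb].
  - apply Na. left. congruence.
  - destruct (classic (c = e)) as [Ec|Ec]; [apply Na; right; left; congruence|].
    apply Nb. left. symmetry. now apply (real_character_unique q).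
  - destruct (classic (c = e)) as [Ec|Ec]; [apply Nb; left; congruence|].
    apply Na. right. left. symmetry. now apply (real_character_unique q).
  - apply Na. left. symmetry. now apply (real_character_unique q).
Qed.

(** X is finite, so one cut N, M of the Euler product serves all characters, as the resonance
    argument needs a single f. *)
Lemma uniform_parameters {A : Type} (P : A -> nat -> nat -> Prop) (l : list A) :
  (forall a, List.In a l -> exists N0, forall N, (N0 <= N)%nat -> exists M0, forall M, (M0 <= M)%nat -> P a N M) ->
  exists N0, forall N, (N0 <= N)%nat -> exists M0, forall M, (M0 <= M)%nat -> forall a, List.In a l -> P a N M.
Proof.
  induction l as [|a l IH]; intros H.
  - exists 0%nat. intros N _. exists 0%nat. intros M _ a [].
  - destruct (H a (or_introl eq_refl)) as [N1 H1].
    destruct (IH (fun x Hx => H x (or_intror Hx))) as [N2 H2].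
    exists (N1 + N2)%nat. intros N HN. destruct (H1 N ltac:(lia)) as [M1 H3]. destruct (H2 N ltac:(lia)) as [M2 H4].
    exists (M1 + M2)%nat. intros M HM x [<-|Hx]; [apply H3; lia|apply H4; auto; lia].
Qed.

Section Conditional.
Variables (q : nat) (X : Ensemble (nat -> C)) (l : list (nat -> C)) (t : R) (K : nat).
Hypotheses (Hq : (2 <= q)%nat) (HX : character_subgroup q X)
  (Hnd : NoDup l) (Hl : forall chi, List.In chi l <-> X chi) (Ht : 0 < t).

Lemma pp_coef_nonneg p m : (1 <= p)%nat -> (1 <= m)%nat -> 0 <= pp_coef K t p m.
Proof.
  intros Hp Hm. unfold pp_coef. apply Rmult_le_pos.
  - apply Rdiv_le_0_compat; [left; apply exp_pos|apply lt_0_INR; lia].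
  - apply exp_trunc_nonneg. repeat apply Rmult_le_pos; [lra|apply pos_INR|].
    rewrite <- ln_1. apply ln_le; [lra|]. change 1 with (INR 1). now apply le_INR.
Qed.

Lemma pos_log_char_poly N M : pos_type X (log_char_poly K t N M).
Proof.
  apply (pos_Csum q X HX (fun p chi => Csum (fun m => RtoC (pp_coef K t p m) * chi (p ^ m)%nat)%C (seq 1 M))).
  intros p Hp. apply In_primes_upto in Hp as [Hp _]. apply prime_ge_2 in Hp.
  apply (pos_Csum q X HX (fun m chi => RtoC (pp_coef K t p m) * chi (p ^ m)%nat)%C).
  intros m Hm. apply in_seq in Hm. apply (pos_scal X _ (fun chi => chi (p ^ m)%nat)); [|apply pos_eval].
  apply pp_coef_nonneg; lia.
Qed.

(** Only the terms with p in S and m = 1 are moved into the weight; the higher powers and the other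
    primes are kept as nonnegative combinations. *)
Lemma pos_log_char_poly_weight (S : list nat) N M : (1 <= M)%nat ->
  (forall r, List.In r S -> Nat.gcd r q = 1%nat) -> NoDup S -> incl S (primes_upto N) ->
  pos_type X (fun chi => log_char_poly K t N M chi * RtoC (weight S chi) -
    RtoC (/ 2 * Rsum (fun p => pp_coef K t p 1) S) * RtoC (weight S chi))%C.
Proof.
  intros HM HS HnS Hi. destruct (NoDup_incl_perm S _ HnS Hi) as [rest HR].
  pose proof (pos_weight q X l Hq HX Hnd Hl S HS) as PW.
  assert (Hrest : forall p, List.In p (S ++ rest) -> (1 <= p)%nat).
  { intros p Hp. apply (Permutation_in _ (Permutation_sym HR)), In_primes_upto in Hp as [Hp _]. apply prime_ge_2 in Hp. lia. }
  set (inner := fun (m0 : nat) (n0 : nat) p (chi : nat -> C) => Csum (fun m => RtoC (pp_coef K t p m) * chi (p ^ m)%nat)%C (seq m0 n0)).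
  assert (Pin : forall m0 n0 p, (1 <= m0)%nat -> (1 <= p)%nat -> pos_type X (inner m0 n0 p)).
  { intros m0 n0 p Hm0 Hp. apply (pos_Csum q X HX (fun m chi => RtoC (pp_coef K t p m) * chi (p ^ m)%nat)%C).
    intros m Hm. apply in_seq in Hm. apply (pos_scal X _ (fun chi => chi (p ^ m)%nat)); [|apply pos_eval].
    apply pp_coef_nonneg; lia. }
  assert (P1 : pos_type X (fun chi => Csum (fun p => inner 1%nat M p chi) rest)).
  { apply (pos_Csum q X HX (fun p chi => inner 1%nat M p chi)). intros p Hp. apply Pin; [lia|]. apply Hrest, in_app_iff. now right. }
  assert (P2 : pos_type X (fun chi => Csum (fun p => inner 2%nat (M - 1)%nat p chi) S)).
  { apply (pos_Csum q X HX (fun p chi => inner 2%nat (M - 1)%nat p chi)). intros p Hp. apply Pin; [lia|]. apply Hrest, in_app_iff. now left. }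
  assert (P3 : pos_type X (fun chi => Csum (fun p => RtoC (pp_coef K t p 1) *
     (chi p * RtoC (weight S chi) - RtoC (1 / 2) * RtoC (weight S chi)))%C S)).
  { apply (pos_Csum q X HX (fun p chi => RtoC (pp_coef K t p 1) *
     (chi p * RtoC (weight S chi) - RtoC (1 / 2) * RtoC (weight S chi)))%C).
    intros p Hp. apply pos_scal; [apply pp_coef_nonneg; [apply Hrest, in_app_iff; now left|lia]|].
    apply (pos_weight_eval q X l Hq HX Hnd Hl S p HS Hp). }
  apply (pos_ext X _ _ (pos_add X _ _ (pos_mul q X HX _ _ (pos_add X _ _ P1 P2) PW) P3)).
  intros chi _. cbv beta. unfold log_char_poly. rewrite (Csum_perm _ _ _ HR), Csum_app.
  set (w := RtoC (weight S chi)).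
  change (Csum (fun p => Csum (fun m => RtoC (pp_coef K t p m) * chi (p ^ m)%nat)%C (seq 1 M)) rest) with
    (Csum (fun p => inner 1%nat M p chi) rest).
  rewrite (Csum_ext (fun p => Csum (fun m => RtoC (pp_coef K t p m) * chi (p ^ m)%nat)%C (seq 1 M))
    (fun p => RtoC (pp_coef K t p 1) * chi p + inner 2%nat (M - 1)%nat p chi)%C S).
  2:{ intros p _. replace M with (1 + (M - 1))%nat at 1 by lia. rewrite seq_app, Csum_app. unfold inner.
      simpl (seq 1 1). cbn [Csum fold_right]. rewrite Nat.pow_1_r. simpl (1 + 1)%nat. fold (Csum (fun m => RtoC (pp_coef K t p m) * chi (p ^ m)%nat)%C (seq 2 (M - 1))). ring. }
  rewrite (Csum_ext (fun p => RtoC (pp_coef K t p 1) * (chi p * w - RtoC (1 / 2) * w))%C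
    (fun p => w * (RtoC (pp_coef K t p 1) * chi p) - (RtoC (1 / 2) * w) * RtoC (pp_coef K t p 1))%C)
    by (intros p _; ring).
  rewrite Csum_minus, !Csum_scal, Csum_plus, Csum_RtoC, RtoC_mult.
  replace (RtoC (1 / 2)) with (RtoC (/ 2)) by (f_equal; lra). ring.
Qed.

(** After Rankin's trick the powers of a prime p sum to at most 2 p^(lam-2), as p^(lam-2) <= 1/2,
    and the sum over p is compared with the sum over all integers. The bound is uniform in N and M,
    which are fixed only later. *)
Lemma log_char_poly_principal_le lam N M : 0 < lam < 1 -> lam < t ->
  Re (log_char_poly K t N M (principal_character q)) <= 2 * (t / lam) ^ K * (1 + / (1 - lam)).
Proof.
  intros Hlam Hlt. set (R0 := (t / lam) ^ K).
  assert (HR : 0 <= R0) by (apply pow_le, Rdiv_le_0_compat; lra).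
  assert (Inner : forall p, (2 <= p)%nat ->
     Re (Csum (fun m => RtoC (pp_coef K t p m) * principal_character q (p ^ m)%nat)%C (seq 1 M)) <=
     2 * R0 * exp (- (2 - lam) * ln (INR p))).
  { intros p Hp.
    assert (P2 : 2 <= INR p) by (change 2 with (INR 2); now apply le_INR).
    assert (Lp : 0 < ln (INR p)) by (rewrite <- ln_1; apply ln_increasing; lra).
    set (x := exp (- (2 - lam) * ln (INR p))).
    assert (Hx : 0 < x <= 1 / 2).
    { unfold x. split; [apply exp_pos|]. apply Rle_trans with (exp (- ln 2)).
      - apply exp_le_compat. assert (ln 2 <= ln (INR p)) by (apply ln_le; lra).
        assert (0 < ln 2) by (rewrite <- ln_1; apply ln_increasing; lra). nra.
      - rewrite exp_Ropp, exp_ln; lra. }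
    rewrite Re_Csum.
    apply Rle_trans with (Rsum (fun m => R0 * x ^ m) (seq 1 M)).
    - apply Rsum_le. intros m Hm. apply in_seq in Hm. rewrite Re_scal.
      assert (M1 : 1 <= INR m) by (change 1 with (INR 1); apply le_INR; lia).
      assert (Cp : 0 <= pp_coef K t p m) by (apply pp_coef_nonneg; lia).
      apply Rle_trans with (pp_coef K t p m * 1).
      + apply Rmult_le_compat_l; [exact Cp|]. unfold principal_character. destruct (Nat.eqb _ _); simpl; lra.
      + rewrite Rmult_1_r. unfold pp_coef. set (y := INR m * ln (INR p)).
        assert (Hy : 0 <= y) by (unfold y; nra).
        pose proof (exp_trunc_upper K t lam y ltac:(lra) Hy) as U. fold R0 in U.
        assert (E : x ^ m = exp (- 2 * y) * exp (lam * y)).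
        { unfold x. rewrite exp_pow_INR, <- exp_plus. f_equal. unfold y. ring. }
        rewrite E. pose proof (exp_pos (- 2 * y)) as Pe.
        apply Rle_trans with (exp (- 2 * y) * (R0 * exp (lam * y))); [|right; ring].
        apply Rmult_le_compat; [apply Rdiv_le_0_compat; lra|apply exp_trunc_nonneg; nra| |exact U].
        apply Rmult_le_reg_r with (INR m); [lra|]. unfold Rdiv. rewrite Rmult_assoc, Rinv_l by lra. nra.
    - rewrite Rsum_scal, (Rmult_comm 2 R0), Rmult_assoc. apply Rmult_le_compat_l; [exact HR|].
      assert (G : Rsum (fun m => x ^ m) (seq 1 M) <= x ^ 1 / (1 - x)) by (apply geometric_tail; lra).
      eapply Rle_trans; [exact G|]. rewrite pow_1.
      apply Rmult_le_reg_r with (1 - x); [lra|]. unfold Rdiv. rewrite Rmult_assoc, Rinv_l by lra. nra. }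
  unfold log_char_poly. rewrite Re_Csum.
  apply Rle_trans with (Rsum (fun p => 2 * R0 * exp (- (2 - lam) * ln (INR p))) (primes_upto N)).
  { apply Rsum_le. intros p Hp. apply In_primes_upto in Hp as [Hp _]. apply prime_ge_2 in Hp. apply Inner. lia. }
  rewrite Rsum_scal. apply Rmult_le_compat_l; [lra|].
  apply Rle_trans with (Rsum (fun p => exp (- (2 - lam) * ln (INR p))) (seq 1 N)).
  - apply Rsum_incl; [apply NoDup_filter, seq_NoDup| |intros; left; apply exp_pos].
    intros p Hp. apply filter_In in Hp. tauto.
  - destruct N as [|N]; [simpl; pose proof (Rinv_0_lt_compat (1 - lam) ltac:(lra)); lra|].
    change (S N) with (1 + N)%nat. rewrite seq_app, Rsum_app. apply Rplus_le_compat.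
    + simpl. rewrite ln_1, Rmult_0_r, exp_0. lra.
    + eapply Rle_trans; [apply (power_sum_gt1 (2 - lam) 1 N); [lra|lia]|].
      simpl INR. rewrite ln_1, Rmult_0_r, exp_0. replace (2 - lam - 1) with (1 - lam) by ring. lra.
Qed.
End Conditional.

(** The loss of 3 is made up of 1 for the at most two excluded characters, 1 for the Taylor
    remainder ([Herr]) and 1 for the Euler product approximation in [grh_log_lower]. *)
Lemma conditional_large_value q X l sigma K lam (S : list nat) Q :
  1 / 2 < sigma < 1 -> GRH -> prime (Z.of_nat q) -> (5 <= q)%nat ->
  character_subgroup q X -> NoDup l -> (forall chi, List.In chi l <-> X chi) ->
  (1 <= K)%nat -> 0 < lam < 1 ->
  let t := 2 - sigma in let rho := (t + 3 / 2) / 2 in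
  (forall r, List.In r S -> Nat.gcd r q = 1%nat) -> (forall r, List.In r S -> prime (Z.of_nat r)) -> NoDup S ->
  Q <= / 2 * Rsum (fun p => pp_coef K t p 1) S -> 1 < Q ->
  2 * (4 ^ length S * (2 * (t / lam) ^ K * (1 + / (1 - lam)))) <= INR (length l) ->
  2 * (ln (INR q) + 8) * ((t / rho) ^ K / (1 - t / rho)) <= 1 ->
  exists chi, X chi /\ chi <> principal_character q /\ Q - 3 <= ln (Cmod (Lfun chi (RtoC sigma))).
Proof.
  intros Hs G Hp Hq5 HX Hnd Hl HK Hlam t rho HS HSp HnS HQ HQ1 Hmain Herr.
  assert (Hq : (2 <= q)%nat) by lia.
  assert (Ht : 1 < t < 3 / 2) by (unfold t; lra).
  destruct (classical_split (fun chi => character_mul chi chi = principal_character q) l) as [lg [lb [HP [Hg Hb]]]].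
  assert (Hin : forall chi, List.In chi (lg ++ lb) -> X chi).
  { intros chi Hc. apply Hl, (Permutation_in _ (Permutation_sym HP) Hc). }
  assert (Hlb : (length lb <= 2)%nat).
  { apply (real_characters_at_most_two q); auto.
    - apply (Permutation_NoDup HP), NoDup_app_remove_l in Hnd. exact Hnd.
    - intros chi Hc. split; [|now apply Hb]. apply (X_character q X HX), Hin, in_app_iff. now right. }
  destruct (uniform_parameters (fun chi N M => Re (log_char_poly K t N M chi) <=
      ln (Cmod (Lfun chi (RtoC sigma))) + 2 * (ln (INR q) + 8) * ((t / rho) ^ K / (1 - t / rho)) + 1) lg) as [N0 HN0].
  { intros chi Hc. apply (grh_log_lower sigma q chi K); auto.
    apply (X_character q X HX), Hin, in_app_iff. now left. }
  (* Adding the sum of all elements of S is a simple way to make N at least each of them. *)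
  set (N := (N0 + fold_right Nat.add 0%nat S)%nat).
  destruct (HN0 N ltac:(lia)) as [M0 HM0]. set (M := Datatypes.S M0). specialize (HM0 M ltac:(lia)).
  assert (HSN : incl S (primes_upto N)).
  { intros p Hp'. apply In_primes_upto. split; [now apply HSp|].
    assert (p <= fold_right Nat.add 0%nat S)%nat; [|lia].
    clear - Hp'. induction S as [|r S IH]; [contradiction|]. simpl. destruct Hp' as [->|Hp']; [lia|]. specialize (IH Hp'). lia. }
  set (Q' := / 2 * Rsum (fun p => pp_coef K t p 1) S) in *.
  pose proof (resonance q X l Hq HX Hnd Hl (log_char_poly K t N M) S Q' lg lb HS
    (pos_log_char_poly q X t K Hq HX ltac:(lra) N M)
    (pos_log_char_poly_weight q X l t K Hq HX Hnd Hl ltac:(lra) S N M ltac:(lia) HS HnS HSN) HP) as RES.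
  pose proof (weight_sum_ge q X l Hq HX Hnd Hl S HS) as WS. set (W := Rsum (weight S) l) in *.
  assert (D : INR (length lb) * (4 ^ length S * Re (log_char_poly K t N M (principal_character q))) <= INR (length l)).
  { pose proof (log_char_poly_principal_le q t K Hq ltac:(lra) lam N M Hlam ltac:(lra)) as B.
    assert (P4 : 0 < 4 ^ length S) by (apply pow_lt; lra).
    assert (I2 : INR (length lb) <= 2) by (change 2 with (INR 2); now apply le_INR).
    assert (Pf : 0 <= Re (log_char_poly K t N M (principal_character q))).
    { eapply Rle_trans; [apply Cmod_ge_0|].
      apply (pos_bound q X Hq HX _ _ (pos_log_char_poly q X t K Hq HX ltac:(lra) N M) (X_principal q X HX)). }
    eapply Rle_trans; [|exact Hmain]. apply Rmult_le_compat; [apply pos_INR|apply Rmult_le_pos; lra|exact I2|].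
    apply Rmult_le_compat_l; lra. }
  destruct (large_value_exists (weight S) (fun chi => Re (log_char_poly K t N M chi)) l lg lb (Q - 1) HP) as [chi [Hc Hv]].
  - pose proof (proj2 (Hl _) (X_principal q X HX)) as L. destruct l; [contradiction|discriminate].
  - intros chi Hc. apply (weight_pos q X Hq HX S chi). now apply Hl.
  - lra.
  - fold W. assert (0 <= W) by (pose proof (pos_INR (length l)); lra).
    assert (Q * W <= Q' * W) by (apply Rmult_le_compat_r; lra). lra.
  - assert (Xc : X chi) by (apply Hin, in_app_iff; now left).
    exists chi. split; [exact Xc|split].
    + intros ->. apply (Hg _ Hc). apply character_mul_principal_l, principal_is_character.
    + specialize (HM0 chi Hc). cbv beta in HM0. lra.
Qed.

(** * Choice of parameters *)

Lemma ln_le_self x : 0 < x -> ln x <= x - 1.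
Proof. intros Hx. pose proof (exp_ineq1_le (ln x)) as E. rewrite exp_ln in E by exact Hx. lra. Qed.

Lemma ln_small (A B : R) : 0 < A -> exists x0, 1 <= x0 /\ forall x, x0 <= x -> A * ln x + B <= x.
Proof.
  intros HA. exists (2 * (A * Rabs (ln (2 * A)) + Rabs B) + 1).
  pose proof (Rabs_pos (ln (2 * A))). pose proof (Rabs_pos B).
  split; [nra|]. intros x Hx.
  assert (Px : 0 < x) by nra.
  pose proof (ln_le_self (x / (2 * A)) ltac:(apply Rdiv_lt_0_compat; lra)) as L.
  rewrite ln_div in L by lra.
  pose proof (Rle_abs (ln (2 * A))). pose proof (Rle_abs B).
  assert (E : A * (x / (2 * A)) = x / 2) by (field; lra).
  assert (A * ln x <= A * (x / (2 * A) - 1 + ln (2 * A))) by (apply Rmult_le_compat_l; lra).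
  assert (A * ln (2 * A) <= A * Rabs (ln (2 * A))) by (apply Rmult_le_compat_l; lra).
  lra.
Qed.

Lemma ln_2_ge_half : 1 / 2 <= ln 2.
Proof.
  rewrite <- (ln_exp (1/2)). apply ln_le; [apply exp_pos|].
  pose proof exp_le_3. assert (exp (1/2) * exp (1/2) = exp 1) by (rewrite <- exp_plus; f_equal; lra).
  pose proof (exp_pos (1/2)). nra.
Qed.

(** [many_primes] is applied with N the integer just above h log h. Then 2N <= 3 h log h, and log 2N
    <= 2 log h turns 2^N <= (2N)^count into a count of at least h/4. *)
Lemma prime_set : exists h0, 1 <= h0 /\ forall h, h0 <= h -> forall m, 4 * INR m <= h ->
  exists S, NoDup S /\ length S = m /\
    forall p, List.In p S -> prime (Z.of_nat p) /\ INR p <= 3 * (h * ln h).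
Proof.
  destruct (ln_small 3 0 ltac:(lra)) as [x1 [Hx1 H1]].
  exists (x1 + 9). split; [lra|]. intros h Hh m Hm.
  specialize (H1 h ltac:(lra)).
  assert (Lh : 2 <= ln h).
  { rewrite <- (ln_exp 2). apply ln_le; [apply exp_pos|]. pose proof exp_le_3.
    replace (exp 2) with (exp 1 * exp 1) by (rewrite <- exp_plus; f_equal; lra).
    pose proof (exp_pos 1). nra. }
  destruct (nfloor_ex (h * ln h) ltac:(nra)) as [n [Hn1 Hn2]].
  set (N := Datatypes.S n).
  assert (EN : INR N = INR n + 1) by apply S_INR.
  assert (HN : h * ln h <= INR N <= h * ln h + 1) by lra.
  destruct (Chebyshev.many_primes N ltac:(unfold N; lia)) as [l [Hnd [Hl Hc]]].
  change (forall p, List.In p l -> prime (Z.of_nat p) /\ (p <= 2 * N)%nat) in Hl.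
  change (2 ^ N <= (2 * N) ^ length l)%nat in Hc.
  assert (Hlen : (m <= length l)%nat).
  { apply INR_le. apply le_INR in Hc. rewrite !pow_INR in Hc.
    assert (P2 : INR (2 * N) = 2 * INR N) by (rewrite mult_INR; reflexivity).
    rewrite P2 in Hc. simpl (INR 2) in Hc.
    assert (PN : 0 < INR N) by nra.
    apply ln_le in Hc; [|apply pow_lt; lra]. rewrite !ln_pow in Hc by lra.
    replace (1 + 1) with 2 in Hc by ring.
    assert (L2N : ln (2 * INR N) <= 2 * ln h).
    { replace (2 * ln h) with (ln (h * h)) by (rewrite ln_mult by lra; ring).
      apply ln_le; [lra|]. nra. }
    pose proof ln_2_ge_half. pose proof (pos_INR (length l)).
    assert (C1 : INR N * (1 / 2) <= INR (length l) * (2 * ln h)).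
    { apply Rle_trans with (INR N * ln 2); [apply Rmult_le_compat_l; lra|].
      eapply Rle_trans; [exact Hc|]. apply Rmult_le_compat_l; lra. }
    assert (C2 : h / 4 * (2 * ln h) <= INR (length l) * (2 * ln h)) by nra.
    apply Rmult_le_reg_r in C2; lra. }
  exists (firstn m l). split; [|split].
  - rewrite <- (firstn_skipn m l) in Hnd. now apply NoDup_app_remove_r in Hnd.
  - apply firstn_length_le. exact Hlen.
  - intros p Hp. assert (Hp' : List.In p l) by (rewrite <- (firstn_skipn m l); apply in_or_app; now left).
    destruct (Hl p Hp') as [Pp Bp]. split; [exact Pp|].
    apply le_INR in Bp. rewrite mult_INR in Bp. simpl (INR 2) in Bp. nra.
Qed.

(** This is y^(-sigma) for y = 3 h log h, the bound for the primes from [prime_set]; hence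
    p^(-sigma) >= [yneg sigma h] for them. *)
Definition yneg (sigma h : R) : R := exp (- sigma * ln (3 * (h * ln h))).

(** After logarithms h y^(-sigma) has size (1 - sigma) log h - sigma log log h, which is unbounded.
    The 3 ensures at least three blocks, as [pow_3_minus_4] requires. *)
Lemma yneg_large sigma c0 : 0 < sigma < 1 -> 0 < c0 -> exists h1, forall h, h1 <= h -> 3 <= c0 * h * yneg sigma h.
Proof.
  intros Hs Hc.
  destruct (ln_small (sigma / (1 - sigma)) ((ln (3 / c0) + sigma * ln 3) / (1 - sigma))) as [u0 [Hu0 H]].
  { apply Rdiv_lt_0_compat; lra. }
  exists (exp u0). intros h Hh.
  assert (Ph : 0 < h) by (pose proof (exp_pos u0); lra).
  assert (Lu : u0 <= ln h) by (rewrite <- (ln_exp u0); apply ln_le; [apply exp_pos|exact Hh]).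
  specialize (H (ln h) Lu).
  assert (E : ln (3 / c0) <= ln h - sigma * ln (3 * (h * ln h))).
  { rewrite !ln_mult by (try apply Rmult_lt_0_compat; lra).
    apply Rmult_le_compat_r with (r := 1 - sigma) in H; [|lra].
    replace ((sigma / (1 - sigma) * ln (ln h) + (ln (3 / c0) + sigma * ln 3) / (1 - sigma)) * (1 - sigma)) with
      (sigma * ln (ln h) + (ln (3 / c0) + sigma * ln 3)) in H by (field; lra). lra. }
  apply exp_le_compat in E. rewrite exp_ln in E by (apply Rdiv_lt_0_compat; lra).
  replace (ln h - sigma * ln (3 * (h * ln h))) with (ln h + - sigma * ln (3 * (h * ln h))) in E by ring.
  rewrite exp_plus, exp_ln in E by exact Ph. fold (yneg sigma h) in E.
  apply Rmult_le_compat_l with (r := c0) in E; [|lra].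
  replace (c0 * (3 / c0)) with 3 in E by (field; lra). lra.
Qed.

Lemma main_term_bound sigma h : 0 < sigma < 1 -> 1 < h ->
  Rpower h (1 - sigma) * Rpower (ln h) (- sigma) <= 3 * h * yneg sigma h.
Proof.
  intros Hs Hh. assert (0 < ln h) by (rewrite <- ln_1; apply ln_increasing; lra).
  unfold Rpower, yneg. rewrite <- exp_plus.
  rewrite <- (exp_ln 3) at 1 by lra. rewrite <- (exp_ln h) at 3 by lra. rewrite <- !exp_plus.
  apply exp_le_compat. rewrite !ln_mult by (try apply Rmult_lt_0_compat; lra).
  assert (0 < ln 3) by (rewrite <- ln_1; apply ln_increasing; lra). nra.
Qed.

Fixpoint chunks (j b : nat) (S : list nat) : list (list nat) :=
  match j with
  | O => nil
  | Datatypes.S j' => firstn b S :: chunks j' b (skipn b S)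
  end.

Lemma length_chunks j b S : length (chunks j b S) = j.
Proof. revert S. induction j as [|j IH]; intros S; simpl; [|rewrite IH]; reflexivity. Qed.

Lemma chunks_prefix j b S : exists rest, S = concat (chunks j b S) ++ rest.
Proof.
  revert S. induction j as [|j IH]; intros S; simpl; [now exists S|].
  destruct (IH (skipn b S)) as [rest Hr]. exists rest.
  rewrite <- app_assoc, <- Hr. symmetry. apply firstn_skipn.
Qed.

Lemma chunks_length j b S B : (j * b <= length S)%nat -> List.In B (chunks j b S) -> length B = b.
Proof.
  revert S. induction j as [|j IH]; intros S Hj HB; simpl in *; [contradiction|].
  destruct HB as [<-|HB]; [apply firstn_length_le; lia|].
  apply (IH (skipn b S)); [rewrite length_skipn; lia|exact HB].
Qed.

Lemma product_le_pow ps (y : R) : 1 <= y -> (forall p, List.In p ps -> INR p <= y) ->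
  INR (fold_right Nat.mul 1%nat ps) <= y ^ length ps.
Proof.
  intros Hy. induction ps as [|p ps IH]; intros H; simpl; [lra|].
  rewrite mult_INR. apply Rmult_le_compat; try apply pos_INR; [apply H; now left|apply IH; intros; apply H; now right].
Qed.

Lemma pow_4_le m x : INR m <= x -> 4 ^ m <= exp (2 * x).
Proof.
  intros Hm. apply Rle_trans with (exp (INR m * ln 4)).
  - rewrite <- exp_pow_INR, exp_ln by lra. lra.
  - apply exp_le_compat. pose proof ln_2_le_1.
    replace 4 with (2 * 2) by ring. rewrite ln_mult by lra. pose proof (pos_INR m). nra.
Qed.

Lemma pow_3_minus_4 j : (3 <= j)%nat -> 2 ^ j <= 3 ^ j - 4.
Proof.
  intros Hj. induction j as [|j IH]; [lia|].
  destruct (Nat.eq_dec j 2) as [->|N]; [lra|].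
  specialize (IH ltac:(lia)). simpl. assert (0 < 2 ^ j) by (apply pow_lt; lra). lra.
Qed.

Lemma ln_ge_2 h : 9 <= h -> 2 <= ln h.
Proof.
  intros Hh. rewrite <- (ln_exp 2). apply ln_le; [apply exp_pos|]. pose proof exp_le_3.
  replace (exp 2) with (exp 1 * exp 1) by (rewrite <- exp_plus; f_equal; lra).
  pose proof (exp_pos 1). nra.
Qed.

(* With z = ln y this is y^(-sigma) ln y <= 2, as sigma >= 1/2. *)
Lemma ln_times_power_le sigma z : 1 / 2 <= sigma -> 0 <= z -> z * exp (- sigma * z) <= 2.
Proof.
  intros Hs Hz.
  assert (E : exp (- sigma * z) <= exp (- (z / 2))) by (apply exp_le_compat; nra).
  pose proof (exp_ineq1_le (z / 2)) as I. pose proof (exp_pos (z / 2)) as P.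
  rewrite exp_Ropp in E. apply Rle_trans with (z * / exp (z / 2)); [apply Rmult_le_compat_l; lra|].
  apply Rmult_le_reg_r with (exp (z / 2)); [exact P|]. rewrite Rmult_assoc, Rinv_l by lra. lra.
Qed.

Lemma unconditional_bound sigma delta : 1 / 2 < sigma < 1 -> 0 < delta < 1 ->
  exists T, forall q X l, T <= INR q -> prime (Z.of_nat q) -> character_subgroup q X ->
    NoDup l -> (forall chi, List.In chi l <-> X chi) ->
    Rpower (INR q) ((2 - 2 * sigma) / (2 - sigma) + delta) <= INR (length l) ->
    let h := ln (INR (length l)) in
    9 <= h /\ exists chi, X chi /\ chi <> principal_character q /\
      delta / 64 / 28 * h * yneg sigma h / 2 <= ln (Cmod (Lfun chi (RtoC sigma))).
Proof.
  intros Hs Hd.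
  destruct prime_set as [h0 [Hh0 PS]].
  set (eps := delta / 64).
  assert (He : 0 < eps < 1 / 64) by (unfold eps; lra).
  destruct (yneg_large sigma (eps / 28) ltac:(lra) ltac:(lra)) as [h1 YL].
  destruct (ln_small 2 (ln 3 + 1) ltac:(lra)) as [x2 [Hx2 LS]].
  set (c6 := ln (6 / (1 - sigma))).
  (* As delta log q <= h, the condition S0 <= delta log q meets all thresholds on h at once. *)
  set (S0 := h0 + Rabs h1 + 9 + x2 + 2 * Rabs c6).
  assert (HS0 : 0 <= S0) by (unfold S0; pose proof (Rabs_pos h1); pose proof (Rabs_pos c6); lra).
  exists (exp (S0 / delta)). intros q X l Hq Hp HX Hnd Hl HH h.
  assert (HTq : S0 <= S0 / delta).
  { apply Rmult_le_reg_r with delta; [lra|]. unfold Rdiv. rewrite Rmult_assoc, Rinv_l by lra. nra. }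
  assert (HS9 : h0 + 9 + x2 <= S0 /\ h1 <= S0 /\ 2 * c6 <= S0).
  { unfold S0. pose proof (Rabs_pos h1). pose proof (Rabs_pos c6). pose proof (Rle_abs h1). pose proof (Rle_abs c6). lra. }
  assert (Pq : 10 <= INR q).
  { pose proof (exp_ineq1_le (S0 / delta)). lra. }
  assert (Hq5 : (5 <= q)%nat) by (apply INR_le; simpl INR; lra).
  set (lq := ln (INR q)).
  assert (Hlq : S0 / delta <= lq) by (unfold lq; rewrite <- (ln_exp (S0 / delta)); apply ln_le; [apply exp_pos|exact Hq]).
  assert (Hdlq : S0 <= delta * lq).
  { apply Rmult_le_compat_l with (r := delta) in Hlq; [|lra]. replace (delta * (S0 / delta)) with S0 in Hlq by (field; lra). exact Hlq. }
  (* The partial sum has length about q^g. Its value at the principal character is then about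
     q^((1-sigma) g), the power of q in the hypothesis without delta; delta pays for 4^|S| and the
     constants. *)
  set (g := 2 / (2 - sigma)).
  assert (Hg : g * (2 - sigma) = 2) by (unfold g; field; lra).
  assert (Pg : 1 < g).
  { apply Rmult_lt_reg_r with (2 - sigma); [lra|]. rewrite Hg. lra. }
  replace ((2 - 2 * sigma) / (2 - sigma)) with ((1 - sigma) * g) in HH by (unfold g; field; lra).
  clearbody g.
  unfold Rpower in HH. fold lq in HH.
  assert (Hlen : 0 < INR (length l)) by (eapply Rlt_le_trans; [apply exp_pos|exact HH]).
  assert (Hh : ((1 - sigma) * g + delta) * lq <= h).
  { unfold h. rewrite <- (ln_exp (_ * lq)). apply ln_le; [apply exp_pos|exact HH]. }
  assert (Plq : 0 < lq) by lra.
  assert (Hhd : delta * lq <= h) by (assert (0 <= (1 - sigma) * g * lq) by (apply Rmult_le_pos; [apply Rmult_le_pos|]; lra); lra).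
  assert (Hhq : h <= lq).
  { unfold h, lq. apply ln_le; [exact Hlen|]. apply le_INR. apply (X_length_le_q q X l); auto; lia. }
  assert (Hh9 : 9 <= h) by lra.
  split; [exact Hh9|].
  specialize (YL h ltac:(lra)). specialize (LS lq ltac:(lra)).
  pose proof (ln_ge_2 h Hh9) as Lh.
  set (y := 3 * (h * ln h)). assert (Hy : 27 <= y) by (unfold y; nra).
  assert (Lyq : ln y < lq).
  { unfold y. rewrite !ln_mult by (try apply Rmult_lt_0_compat; lra).
    pose proof (ln_le_self (ln h) ltac:(lra)).
    assert (ln h <= ln lq) by (apply ln_le; lra). lra. }
  assert (Lyp : 0 < ln y) by (rewrite <- ln_1; apply ln_increasing; lra).
  assert (Hyq : y < INR q) by (apply ln_lt_inv; [lra|lra|exact Lyq]).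
  set (Y := yneg sigma h) in *.
  assert (EY : Y = exp (- sigma * ln y)) by reflexivity.
  assert (HY : 0 < Y <= 1).
  { rewrite EY. split; [apply exp_pos|]. rewrite <- exp_0. apply exp_le_compat. nra. }
  destruct (nfloor_ex (eps * h) ltac:(nra)) as [m [Hm1 Hm2]].
  destruct (PS h ltac:(lra) m ltac:(nra)) as [S [HnS [HlS HpS]]].
  assert (HSp : forall r, List.In r S -> prime (Z.of_nat r)) by (intros r Hr; now apply HpS).
  assert (HSy : forall r, List.In r S -> INR r <= y) by (intros r Hr; now apply HpS).
  assert (HSc : forall r, List.In r S -> Nat.gcd r q = 1%nat).
  { intros r Hr. apply gcd_lt_prime; [exact Hp|]. pose proof (prime_ge_2 _ (HSp r Hr)).
    specialize (HSy r Hr). split; [lia|apply INR_lt; lra]. }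
  (* The block length b satisfies 6 <= b Y <= 7, so the sum of p^(-sigma) over a block is at least
     6, and 3 after the cost 1/2. *)
  destruct (nfloor_ex (6 / Y) ltac:(apply Rdiv_le_0_compat; lra)) as [b0 [Hb1 Hb2]].
  set (b := Datatypes.S b0).
  assert (Eb : INR b = INR b0 + 1) by apply S_INR.
  assert (Hb6 : 6 <= INR b * Y).
  { apply Rmult_le_reg_r with (/ Y); [apply Rinv_0_lt_compat; lra|]. rewrite Rmult_assoc, Rinv_r by lra. unfold Rdiv in *. lra. }
  assert (Hb7 : INR b * Y <= 7).
  { assert (INR b0 * Y <= 6 / Y * Y) by (apply Rmult_le_compat_r; lra).
    unfold Rdiv in H. rewrite Rmult_assoc, Rinv_l in H by lra. rewrite Eb. lra. }
  set (j := (m / b)%nat).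
  assert (Hj : (j * b <= m < (j + 1) * b)%nat).
  { unfold j. pose proof (Nat.div_mod m b ltac:(unfold b; lia)). pose proof (Nat.mod_upper_bound m b ltac:(unfold b; lia)). nia. }
  assert (Hj1 : INR j * INR b <= INR m) by (rewrite <- mult_INR; apply le_INR; lia).
  assert (Hj2 : INR m < (INR j + 1) * INR b).
  { replace (INR j + 1) with (INR (j + 1)) by (rewrite plus_INR; reflexivity). rewrite <- mult_INR. apply lt_INR. lia. }
  set (Zv := eps / 28 * h * Y) in *.
  pose proof (pos_INR j) as Pj. pose proof (pos_INR m) as Pm.
  (* From (eps h - 1) Y <= 7 (j + 1) and 28 = 4 * 7 one gets j >= 4 Zv - 8/7, which exceeds Zv
     because Zv >= 3. *)
  assert (HjZ : Zv <= INR j).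
  { assert (I1 : (eps * h - 1) * Y <= INR m * Y) by (apply Rmult_le_compat_r; lra).
    assert (I2 : INR m * Y <= (INR j + 1) * INR b * Y) by (apply Rmult_le_compat_r; lra).
    assert (I3 : (INR j + 1) * (INR b * Y) <= (INR j + 1) * 7) by (apply Rmult_le_compat_l; lra).
    assert (I4 : eps * h * Y = 28 * Zv) by (unfold Zv; field).
    lra. }
  assert (Hj3 : (3 <= j)%nat) by (apply INR_le; simpl (INR 3); lra).
  (* This says y^j <= q, so the block products lie within the partial sum. It holds since j <= eps h
     Y / 6 and Y log y <= 2. *)
  assert (Hjy : INR j * ln y <= lq).
  { pose proof (ln_times_power_le sigma (ln y) ltac:(lra) ltac:(lra)) as I. rewrite <- EY in I.
    assert (I1 : INR j * 6 <= INR j * (INR b * Y)) by (apply Rmult_le_compat_l; lra).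
    assert (I2 : INR j * INR b * Y <= eps * h * Y) by (apply Rmult_le_compat_r; lra).
    assert (I3 : INR j <= eps * h * Y / 6) by lra.
    assert (I4 : INR j * ln y <= eps * h * Y / 6 * ln y) by (apply Rmult_le_compat_r; lra).
    assert (I5 : eps * h * (ln y * Y) <= eps * h * 2) by (apply Rmult_le_compat_l; nra).
    nra. }
  set (Bs := chunks j b S).
  destruct (chunks_prefix j b S) as [rest Hrest]. fold Bs in Hrest.
  assert (HiB : incl (concat Bs) S) by (intros x Hx; rewrite Hrest; apply in_or_app; now left).
  assert (HnB : NoDup (concat Bs)) by (rewrite Hrest in HnS; now apply NoDup_app_remove_r in HnS).
  (* The length is rounded to the multiple N' q of q, as collecting the tail modulo q requires. *)
  destruct (nfloor_ex (exp ((g - 1) * lq)) ltac:(left; apply exp_pos)) as [n0 [Hn1 Hn2]].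
  set (N' := Datatypes.S n0).
  assert (EN' : INR N' = INR n0 + 1) by apply S_INR.
  assert (HN1 : exp ((g - 1) * lq) <= INR N' <= 2 * exp ((g - 1) * lq)).
  { assert (1 <= exp ((g - 1) * lq)).
    { apply Rle_trans with (exp 0); [rewrite exp_0; lra|]. apply exp_le_compat. apply Rmult_le_pos; lra. }
    lra. }
  assert (PN' : 0 < INR N') by (apply lt_0_INR; unfold N'; lia).
  assert (LN : g * lq <= ln (INR (N' * q)) <= g * lq + ln 2).
  { rewrite mult_INR, ln_mult by lra. fold lq. split.
    - assert ((g - 1) * lq <= ln (INR N')).
      { rewrite <- (ln_exp ((g - 1) * lq)). apply ln_le; [apply exp_pos|lra]. } lra.
    - assert (ln (INR N') <= ln 2 + (g - 1) * lq).
      { rewrite <- (ln_exp ((g - 1) * lq)), <- ln_mult by (try apply exp_pos; lra). apply ln_le; lra. } lra. }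
  assert (HN'1 : (1 <= N')%nat) by (unfold N'; lia).
  assert (P4 : 4 ^ length S <= exp (2 * (eps * h))) by (apply pow_4_le; rewrite HlS; exact Hm1).
  assert (P4' : 0 < 4 ^ length S) by (apply pow_lt; lra).
  assert (He2 : 2 * (eps * h) <= delta / 32 * lq).
  { assert (eps * h <= eps * lq) by (apply Rmult_le_compat_l; lra). unfold eps in *. lra. }
  destruct (unconditional_large_value q X l sigma ltac:(lia) HX Hnd Hl ltac:(lra) S Bs N' (3 ^ j)
    HSc HSp HiB HnB HN'1) as [chi [Xc [Nc HL]]].
  - intros k Hk. destruct (block_products_spec Bs k Hk) as [ps [H1 [H2 ->]]].
    apply INR_le. apply Rle_trans with (INR q).
    + eapply Rle_trans; [apply (product_le_pow ps y); [lra|intros p Hp'; apply HSy, HiB, H1, Hp']|].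
      rewrite H2. unfold Bs. rewrite length_chunks. rewrite <- (exp_ln y), exp_pow_INR by lra.
      rewrite <- (exp_ln (INR q)) by lra. apply exp_le_compat. exact Hjy.
    + apply le_INR. nia.
  - pose proof (pow_3_minus_4 j Hj3). assert (0 < 2 ^ j) by (apply pow_lt; lra). lra.
  - rewrite block_products_sum.
    + pose proof (fold_product_ge (Rsum (rpow_neg sigma)) Bs 6 ltac:(lra)) as F.
      unfold Bs in *. rewrite length_chunks in *.
      apply Rle_trans with ((1 / 2) ^ j * 6 ^ j).
      * rewrite <- Rpow_mult_distr. replace (1 / 2 * 6) with 3 by field. lra.
      * apply Rmult_le_compat_l; [apply pow_le; lra|]. apply F. intros B HB.
        assert (LB : length B = b) by (apply (chunks_length j b S B); [rewrite HlS; lia|exact HB]).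
        apply Rle_trans with (INR b * Y); [exact Hb6|]. rewrite <- LB. apply Rsum_ge_const.
        intros p Hp'. unfold rpow_neg. rewrite EY. apply exp_le_compat.
        assert (HpS' : List.In p S) by (apply HiB, in_concat; exists B; auto).
        assert (ln (INR p) <= ln y).
        { apply ln_le; [|now apply HSy]. pose proof (prime_ge_2 _ (HSp p HpS')). apply lt_0_INR. lia. }
        nra.
    + intros a c Ha Hc. now apply rpow_neg_mult.
    + unfold rpow_neg. simpl INR. rewrite ln_1, Rmult_0_r. apply exp_0.
    + intros r Hr. now apply HSp, HiB.
  - eapply Rle_trans; [|exact HH].
    (* The 6 in [c6] is this 3 times the factor 2 lost in rounding N'. *)
    assert (E3 : 3 / (1 - sigma) = exp (c6 - ln 2)).
    { unfold c6, Rminus. rewrite exp_plus, exp_Ropp, !exp_ln by (try apply Rdiv_lt_0_compat; lra). field. lra. }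
    rewrite E3, <- exp_plus.
    eapply Rle_trans; [apply Rmult_le_compat_r; [left; apply exp_pos|exact P4]|].
    rewrite <- exp_plus. apply exp_le_compat.
    assert (I : (1 - sigma) * ln (INR (N' * q)) <= (1 - sigma) * (g * lq + ln 2)) by (apply Rmult_le_compat_l; lra).
    assert (I2 : 0 <= sigma * ln 2) by (pose proof ln_2_le_1; apply Rmult_le_pos; lra).
    lra.
  - eapply Rle_trans; [|exact HH].
    assert (E2 : (rpow_neg sigma (N' * q) * INR q) ^ 2 = exp (2 * (- sigma * ln (INR (N' * q)) + lq))).
    { unfold rpow_neg, lq. rewrite <- (exp_ln (INR q)) at 1 by lra. rewrite <- exp_plus, exp_pow_INR. reflexivity. }
    rewrite E2.
    eapply Rle_trans; [apply Rmult_le_compat_r; [left; apply exp_pos|exact P4]|].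
    rewrite <- exp_plus. apply exp_le_compat.
    (* The exponent 2 - 2 sigma g of the squared tail is compared with (1 - sigma) g: by g (2 -
       sigma) = 2 their difference is -(2 sigma - 1) g, which is where sigma > 1/2 enters. *)
    assert (I : sigma * (g * lq) <= sigma * ln (INR (N' * q))) by (apply Rmult_le_compat_l; lra).
    assert (I2 : 0 <= (2 * sigma - 1) * (g * lq)) by (apply Rmult_le_pos; [lra|apply Rmult_le_pos; lra]).
    assert (I3 : g * (2 - sigma) * lq = 2 * lq) by (rewrite Hg; reflexivity).
    lra.
  - exists chi. split; [exact Xc|split; [exact Nc|]].
    pose proof (pow_3_minus_4 j Hj3).
    apply Rle_trans with (INR j * ln 2).
    + pose proof ln_2_ge_half. fold Zv. nra.
    + rewrite <- ln_pow by lra. apply ln_le; [apply pow_lt; lra|lra].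
Qed.

Lemma conditional_bound sigma delta : 1 / 2 < sigma < 1 -> 0 < delta < 1 -> GRH ->
  exists T, forall q X l, T <= INR q -> prime (Z.of_nat q) -> character_subgroup q X ->
    NoDup l -> (forall chi, List.In chi l <-> X chi) ->
    Rpower (ln (INR q)) ((1 + delta) * b sigma) <= INR (length l) ->
    let h := ln (INR (length l)) in
    9 <= h /\ exists chi, X chi /\ chi <> principal_character q /\
      delta / 64 / 28 * h * yneg sigma h / 2 <= ln (Cmod (Lfun chi (RtoC sigma))).
Proof.
  intros Hs Hd G.
  destruct prime_set as [h0 [Hh0 PS]].
  set (eps := delta / 64).
  assert (He : 0 < eps < 1 / 64) by (unfold eps; lra).
  destruct (yneg_large sigma (eps / 28) ltac:(lra) ltac:(lra)) as [h1 YL].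
  destruct (ln_small 2 (ln 3 + 1) ltac:(lra)) as [x2 [Hx2 LS]].
  destruct (ln_small 6 (6 * ln 3 + 1) ltac:(lra)) as [x3 [Hx3 LS3]].
  set (D := 2 * sigma - 1). assert (HD : 0 < D < 1) by (unfold D; lra).
  set (c24 := ln (24 / D)).
  (* Then log(t/lam) <= (1 - sigma) (1 + 1/14), and 7 * 15/14 = 15/2 is still below the 8 in
     b(sigma). *)
  set (lam := exp (- ((1 - sigma) / 14))).
  assert (Hlam : 0 < lam < 1).
  { unfold lam. split; [apply exp_pos|]. apply Rlt_le_trans with (exp 0); [apply exp_increasing; lra|rewrite exp_0; lra]. }
  set (c4 := ln (4 * (1 + / (1 - lam)))).
  assert (Pc4 : 0 < 4 * (1 + / (1 - lam))) by (pose proof (Rinv_0_lt_compat (1 - lam) ltac:(lra)); lra).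
  set (bs := b sigma).
  assert (Ebs : bs = 8 * (1 - sigma) / D) by reflexivity.
  assert (Pbs : 0 < bs) by (rewrite Ebs; apply Rdiv_lt_0_compat; lra).
  set (S0 := h0 + Rabs h1 + 32 * (Rabs c4 + 2) + 9).
  (* All thresholds are put on L0 = log log q; those on h follow from h >= b(sigma) L0. *)
  set (L1 := S0 / bs + x2 + x3 + 6 * Rabs c24 + 9).
  pose proof (Rabs_pos h1) as Ph1. pose proof (Rle_abs h1). pose proof (Rabs_pos c4). pose proof (Rle_abs c4).
  pose proof (Rabs_pos c24). pose proof (Rle_abs c24).
  assert (HS0 : 9 <= S0) by (unfold S0; lra).
  assert (HSb : 0 <= S0 / bs) by (apply Rdiv_le_0_compat; lra).
  exists (exp (exp L1)). intros q X l Hq Hp HX Hnd Hl HH h.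
  set (lq := ln (INR q)) in *.
  assert (Hlq : exp L1 <= lq) by (unfold lq; rewrite <- (ln_exp (exp L1)); apply ln_le; [apply exp_pos|exact Hq]).
  pose proof (exp_ineq1_le L1) as EL1.
  assert (HL1 : 9 + x2 + x3 <= L1) by (unfold L1; lra).
  assert (Pq : 10 <= INR q) by (pose proof (exp_ineq1_le (exp L1)); lra).
  assert (Hq5 : (5 <= q)%nat) by (apply INR_le; simpl INR; lra).
  set (L0 := ln lq).
  assert (HL0 : L1 <= L0) by (unfold L0; rewrite <- (ln_exp L1); apply ln_le; [apply exp_pos|exact Hlq]).
  unfold Rpower in HH. fold L0 bs in HH.
  assert (Hlen : 0 < INR (length l)) by (eapply Rlt_le_trans; [apply exp_pos|exact HH]).
  assert (Hh : (1 + delta) * bs * L0 <= h).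
  { unfold h. rewrite <- (ln_exp (_ * L0)). apply ln_le; [apply exp_pos|exact HH]. }
  assert (PL0 : 0 < L0) by lra.
  assert (Hhb : bs * L0 <= h).
  { assert (0 <= delta * (bs * L0)) by (apply Rmult_le_pos; [lra|apply Rmult_le_pos; lra]). lra. }
  assert (HhS : S0 <= h).
  { assert (HSL : S0 / bs <= L0) by (unfold L1 in *; lra).
    apply Rmult_le_compat_l with (r := bs) in HSL; [|lra]. replace (bs * (S0 / bs)) with S0 in HSL by (field; lra). lra. }
  assert (Hhq : h <= lq).
  { unfold h, lq. apply ln_le; [exact Hlen|]. apply le_INR. apply (X_length_le_q q X l); auto; lia. }
  assert (Hh9 : 9 <= h) by lra.
  split; [exact Hh9|].
  specialize (YL h ltac:(unfold S0 in *; lra)). specialize (LS lq ltac:(lra)). specialize (LS3 L0 ltac:(lra)).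
  pose proof (ln_ge_2 h Hh9) as Lh.
  set (y := 3 * (h * ln h)). assert (Hy : 27 <= y) by (unfold y; nra).
  assert (LhL : ln h <= L0) by (apply ln_le; lra).
  assert (Ely : ln y = ln 3 + (ln h + ln (ln h))).
  { unfold y. rewrite !ln_mult by (try apply Rmult_lt_0_compat; lra). reflexivity. }
  assert (Lyq : ln y < lq).
  { rewrite Ely. pose proof (ln_le_self (ln h) ltac:(lra)). fold L0 in LS. lra. }
  assert (Lyp : 0 < ln y) by (rewrite <- ln_1; apply ln_increasing; lra).
  assert (Hyq : y < INR q) by (apply ln_lt_inv; [lra|lra|exact Lyq]).
  set (Y := yneg sigma h) in *.
  assert (EY : Y = exp (- sigma * ln y)) by reflexivity.
  assert (HY : 0 < Y <= 1).
  { rewrite EY. split; [apply exp_pos|]. rewrite <- exp_0. apply exp_le_compat. nra. }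
  destruct (nfloor_ex (eps * h) ltac:(nra)) as [m [Hm1 Hm2]].
  destruct (PS h ltac:(unfold S0 in *; lra) m ltac:(nra)) as [S [HnS [HlS HpS]]].
  assert (HSp : forall r, List.In r S -> prime (Z.of_nat r)) by (intros r Hr; now apply HpS).
  assert (HSy : forall r, List.In r S -> INR r <= y) by (intros r Hr; now apply HpS).
  assert (HSc : forall r, List.In r S -> Nat.gcd r q = 1%nat).
  { intros r Hr. apply gcd_lt_prime; [exact Hp|]. pose proof (prime_ge_2 _ (HSp r Hr)).
    specialize (HSy r Hr). split; [lia|apply INR_lt; lra]. }
  set (t := 2 - sigma). set (rho := (t + 3 / 2) / 2).
  assert (Ht : 1 < t < 3 / 2) by (unfold t; lra).
  assert (Hrho : t < rho < 3 / 2) by (unfold rho; lra).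
  (* The 7 meets two demands. The remainder decays by exp(-D/6) per degree and must beat log q =
     exp(L0), so K must exceed 6 L0/D; and (t/lam)^K must stay below H, which is at least exp(8 (1 -
     sigma) L0/D). *)
  destruct (nfloor_ex (7 * L0 / D) ltac:(apply Rdiv_le_0_compat; lra)) as [K0 [HK1 HK2]].
  set (K := Datatypes.S K0).
  assert (EK : INR K = INR K0 + 1) by apply S_INR.
  assert (HKD : 7 * L0 <= INR K * D).
  { assert (HKD' : 7 * L0 / D * D <= INR K * D) by (apply Rmult_le_compat_r; lra).
    unfold Rdiv in HKD'. rewrite Rmult_assoc, Rinv_l in HKD' by lra. lra. }
  assert (HKu : INR K <= 7 * L0 / D + 1) by lra.
  pose proof (pos_INR K) as PK.
  set (Zv := eps / 28 * h * Y) in *.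
  assert (HmY : eps * h * Y / 2 <= INR m * Y).
  { apply Rle_trans with (eps * h / 2 * Y); [right; field|].
    apply Rmult_le_compat_r; [lra|].
    assert (28 * 3 <= eps * h * Y) by (unfold Zv in YL; lra).
    assert (eps * h * Y <= eps * h * 1) by (apply Rmult_le_compat_l; nra). lra. }
  destruct (conditional_large_value q X l sigma K lam S (INR m * Y / 4) Hs G Hp Hq5 HX Hnd Hl ltac:(unfold K; lia) Hlam
    HSc HSp HnS) as [chi [Xc [Nc HL]]].
  - assert (I : INR (length S) * (Y / 2) <= Rsum (fun p => pp_coef K t p 1) S).
    { apply Rsum_ge_const. intros p Hp'. specialize (HSy p Hp').
      pose proof (prime_ge_2 _ (HSp p Hp')) as P2.
      assert (P2' : 2 <= INR p) by (change 2 with (INR 2); apply le_INR; lia).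
      assert (Lp : 0 <= ln (INR p) <= ln y).
      { split; [rewrite <- ln_1; apply ln_le; lra|apply ln_le; lra]. }
      unfold pp_coef. simpl (INR 1). rewrite Rmult_1_l. unfold Rdiv at 2. rewrite Rinv_1, Rmult_1_r.
      (* As h <= log q, log y is at most L0 + log L0 + log 3; with 4t < 6 the left side is at most 6
         L0 plus lower terms, which the threshold [x3] bounds by L0. *)
      assert (HKx : 4 * (t * ln (INR p)) + 1 <= INR K).
      { assert (ln (ln h) <= ln L0) by (apply ln_le; lra).
        assert (t * ln (INR p) <= 3 / 2 * ln y) by (apply Rmult_le_compat; lra).
        assert (INR K * D <= INR K * 1) by (apply Rmult_le_compat_l; lra). lra. }
      pose proof (exp_trunc_lower K (t * ln (INR p)) ltac:(apply Rmult_le_pos; lra) HKx) as U.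
      apply Rle_trans with (exp (- 2 * ln (INR p)) * (exp (t * ln (INR p)) / 2)).
      - unfold Rdiv. rewrite <- Rmult_assoc, <- exp_plus. apply Rmult_le_compat_r; [lra|].
        rewrite EY. apply exp_le_compat. unfold t.
        assert (sigma * ln (INR p) <= sigma * ln y) by (apply Rmult_le_compat_l; lra). lra.
      - apply Rmult_le_compat_l; [left; apply exp_pos|exact U]. }
    rewrite HlS in I. change (INR m * Y / 4 <= / 2 * Rsum (fun p => pp_coef K t p 1) S). lra.
  - assert (84 <= eps * h * Y) by (unfold Zv in YL; lra). lra.
  - assert (P4 : 4 ^ length S <= exp (2 * (eps * h))) by (apply pow_4_le; rewrite HlS; exact Hm1).
    fold t. set (r := (t / lam) ^ K).
    assert (Er : r = exp (INR K * (ln t + (1 - sigma) / 14))).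
    { unfold r. rewrite <- exp_pow_INR. f_equal. rewrite exp_plus, exp_ln by lra.
      unfold lam. rewrite exp_Ropp. unfold Rdiv at 1. rewrite Rinv_inv. reflexivity. }
    assert (Pr : 0 < r) by (rewrite Er; apply exp_pos).
    apply Rle_trans with (exp c4 * r * exp (2 * (eps * h))).
    { unfold c4. rewrite exp_ln by exact Pc4.
      apply Rle_trans with (4 * (1 + / (1 - lam)) * r * 4 ^ length S); [right; ring|].
      apply Rmult_le_compat_l; [apply Rmult_le_pos; lra|exact P4]. }
    rewrite Er, <- !exp_plus. rewrite <- (exp_ln (INR (length l))) by exact Hlen. fold h.
    apply exp_le_compat.
    assert (Lt : ln t <= 1 - sigma) by (pose proof (ln_le_self t ltac:(lra)); unfold t in *; lra).
    assert (I1 : INR K * (ln t + (1 - sigma) / 14) <= (7 * L0 / D + 1) * ((1 - sigma) * (15 / 14))).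
    { apply Rmult_le_compat; [lra| |exact HKu|lra].
      assert (0 <= ln t) by (rewrite <- ln_1; apply ln_le; lra). lra. }
    (* The exponents add up to 15/16 h from K and at most 1/32 h from 4^|S|; the remaining h/32
       covers the constants by the choice of [S0]. *)
    assert (I2 : 7 * L0 / D * ((1 - sigma) * (15 / 14)) = 15 / 16 * (bs * L0)) by (rewrite Ebs; field; lra).
    assert (I3 : eps * h <= 1 / 64 * h) by (apply Rmult_le_compat_r; lra).
    unfold S0 in HhS. lra.
  - fold t rho.
    (* The midpoint gives rho - t = D/4, and rho < 3/2 turns this into a relative gap of at least
       D/6. *)
    assert (Ek : t / rho <= 1 - D / 6).
    { apply Rmult_le_reg_r with rho; [lra|]. unfold Rdiv at 1. rewrite Rmult_assoc, Rinv_l by lra.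
      unfold rho, t, D. nra. }
    set (kap := t / rho) in *.
    assert (Pk : 0 < kap) by (apply Rdiv_lt_0_compat; lra).
    assert (Lk : ln kap <= - (D / 6)) by (pose proof (ln_le_self kap Pk); lra).
    assert (EkK : kap ^ K <= exp (- (7 / 6 * L0))).
    { rewrite <- (exp_ln kap) by exact Pk. rewrite exp_pow_INR. apply exp_le_compat.
      assert (INR K * ln kap <= INR K * - (D / 6)) by (apply Rmult_le_compat_l; lra). lra. }
    assert (I1 : / (1 - kap) <= 6 / D).
    { replace (6 / D) with (/ (D / 6)) by (field; lra). apply Rinv_le_contravar; lra. }
    assert (I0 : 0 < / (1 - kap)) by (apply Rinv_0_lt_compat; lra).
    assert (Pkk : 0 <= kap ^ K) by (apply pow_le; lra).
    assert (I2 : 2 * (lq + 8) <= 4 * exp L0) by (unfold L0; rewrite exp_ln by lra; lra).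
    fold lq.
    apply Rle_trans with (4 * exp L0 * (exp (- (7 / 6 * L0)) * (6 / D))).
    + apply Rmult_le_compat; [lra|apply Rmult_le_pos; lra|exact I2|].
      unfold Rdiv at 1. apply Rmult_le_compat; lra.
    + replace (4 * exp L0 * (exp (- (7 / 6 * L0)) * (6 / D))) with (24 / D * (exp L0 * exp (- (7 / 6 * L0)))) by (field; lra).
      rewrite <- (exp_ln (24 / D)) by (apply Rdiv_lt_0_compat; lra). rewrite <- !exp_plus. fold c24.
      rewrite <- exp_0. apply exp_le_compat. unfold L1 in *. lra.
  - exists chi. split; [exact Xc|split; [exact Nc|]].
    (* Since m Y / 4 >= eps h Y / 8 = 7/2 Zv and Zv >= 3, the loss of 3 leaves more than Zv/2. *)
    fold Zv. eapply Rle_trans; [|exact HL].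
    assert (E28 : eps * h * Y = 28 * Zv) by (unfold Zv; field). lra.
Qed.

Theorem theorem2p2 :
  forall sigma delta : R,
    1 / 2 < sigma < 1 -> 0 < delta < 1 ->
    exists (c : R) (q0 : nat),
      0 < c /\
      forall (q : nat) (X : Ensemble (nat -> C)) (H : nat),
        (q0 <= q)%nat -> prime (Z.of_nat q) ->
        character_subgroup q X -> cardinal (nat -> C) X H ->
        (Rpower (INR q) ((2 - 2 * sigma) / (2 - sigma) + delta) <= INR H \/
         (GRH /\ Rpower (ln (INR q)) ((1 + delta) * b sigma) <= INR H)) ->
        exists (chi : nat -> C) (L : C -> C),
          In (nat -> C) X chi /\ chi <> principal_character q /\
          is_L_function q chi L /\
          Rabs (Rpower (ln (INR H)) (1 - sigma) *
                Rpower (iterlog 2 (INR H)) (- sigma))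
            <= c * ln (Cmod (L (RtoC sigma))).
Proof.
  intros sigma delta Hs Hd.
  destruct (unconditional_bound sigma delta Hs Hd) as [T1 H1].
  (* [q0] is fixed before it is known which alternative holds, so GRH is decided classically; if it
     fails, any threshold will do. *)
  assert (H2 : exists T, GRH -> forall q X l, T <= INR q -> prime (Z.of_nat q) -> character_subgroup q X ->
    NoDup l -> (forall chi, List.In chi l <-> X chi) ->
    Rpower (ln (INR q)) ((1 + delta) * b sigma) <= INR (length l) ->
    let h := ln (INR (length l)) in
    9 <= h /\ exists chi, X chi /\ chi <> principal_character q /\
      delta / 64 / 28 * h * yneg sigma h / 2 <= ln (Cmod (Lfun chi (RtoC sigma)))).
  { destruct (classic GRH) as [G|G].
    - destruct (conditional_bound sigma delta Hs Hd G) as [T HT]. exists T. auto.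
    - exists 0. tauto. }
  destruct H2 as [T2 H2].
  destruct (INR_unbounded (Rabs T1 + Rabs T2 + 2)) as [q0 Hq0].
  (* The 3 comes from [main_term_bound]; the rest inverts the factor delta / 64 / 28 / 2 of the
     lower bounds. *)
  set (c := 3 * (2 * 28 * 64) / delta).
  exists c, q0. split; [apply Rdiv_lt_0_compat; lra|].
  intros q X H Hq Hp HX HH Hcase.
  destruct (cardinal_list X H HH) as [l [Hnd [Hlen Hl]]].
  assert (Hqr : Rabs T1 + Rabs T2 + 2 <= INR q) by (apply le_INR in Hq; lra).
  pose proof (Rle_abs T1). pose proof (Rle_abs T2). pose proof (Rabs_pos T1). pose proof (Rabs_pos T2).
  assert (Hq2 : (2 <= q)%nat) by (apply INR_le; simpl (INR 2); lra).
  assert (K : 9 <= ln (INR H) /\ exists chi, X chi /\ chi <> principal_character q /\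
      delta / 64 / 28 * ln (INR H) * yneg sigma (ln (INR H)) / 2 <= ln (Cmod (Lfun chi (RtoC sigma)))).
  { rewrite <- Hlen in *. destruct Hcase as [Hc|[G Hc]].
    - apply (H1 q X l); auto; lra.
    - apply (H2 G q X l); auto; lra. }
  destruct K as [Hh [chi [Xc [Nc HL]]]].
  set (h := ln (INR H)) in *.
  exists chi, (Lfun chi). split; [exact Xc|split; [exact Nc|split]].
  - apply Lfun_is_L_function; [exact Hq2|now apply (X_character q X HX)|exact Nc].
  - pose proof (ln_ge_2 h Hh) as L2.
    (* As h >= 9, both maxima with 2 in the iterated logarithm are attained by the logarithms. *)
    assert (E : iterlog 2 (INR H) = ln h).
    { simpl. fold h. rewrite (Rmax_right 2 h) by lra. apply Rmax_right. exact L2. }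
    rewrite E, Rabs_right by (apply Rle_ge, Rmult_le_pos; left; apply exp_pos).
    eapply Rle_trans; [apply main_term_bound; lra|].
    apply Rle_trans with (c * (delta / 64 / 28 * h * yneg sigma h / 2)).
    + right. unfold c. field. lra.
    + apply Rmult_le_compat_l; [left; apply Rdiv_lt_0_compat; lra|exact HL].
Qed.
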